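(* Let $n\ge1$ be an integer, let $\Lambda\subset\mathbb{R}^2$ be a lattice and $\mathbf{h}_n=(h_0,\dots,h_{n-1})$. Then $\mathcal{G}(\mathbf{h}_n,\Lambda)=\{M_\omega T_x\mathbf{h}_n:(x,\omega)\in\Lambda\}$ is a Riesz sequence in $L^2(\mathbb{R},\mathbb{C}^n)$ if and only if $D(\Lambda)<n$.
   Context: Hermite functions: $h_j(t)=c_je^{\pi t^2}\frac{d^j}{dt^j}e^{-2\pi t^2}$ with $c_j>0$ chosen so that $\|h_j\|_{L^2(\mathbb{R})}=1$. $T_xf(t)=f(t-x)$, $M_\omega f(t)=e^{2\pi i\omega t}f(t)$, acting coordinatewise. $L^2(\mathbb{R},\mathbb{C}^n)$ consists of $\mathbf{f}=(f_0,\dots,f_{n-1})$ with $\langle\mathbf{f},\mathbf{g}\rangle=\sum_k\langle f_k,g_k\rangle_{L^2(\mathbb{R})}$. A family $(g_i)$ is a Riesz sequence if there are $A,B>0$ with $A\sum|c_i|^2\le\|\sum c_ig_i\|^2\le B\sum|c_i|^2$ for all finitely supported $(c_i)$. A lattice is $\Lambda=A\mathbb{Z}^2$ with $A$ invertible, and $D(\Lambda)=|\det A|^{-1}$. *)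

(* Defs.v *)
(* classical reals. Complex numbers are represented as pairs
   (real part, imaginary part) of reals. *)
From Stdlib Require Import Reals Lra ZArith List.
Open Scope R_scope.

Definition improper_integral (f : R -> R) (L : R) : Prop :=
  (forall a b, inhabited (Riemann_integrable f a b)) /\
  (forall eps, 0 < eps -> exists M, forall a b (pr : Riemann_integrable f a b),
      a <= - M -> M <= b -> Rabs (RiemannInt pr - L) < eps).

Definition is_hermite_family (h : nat -> R -> R) : Prop :=
  exists (D : nat -> R -> R) (c : nat -> R),
    (forall t, D 0%nat t = exp (- (2 * PI * t ^ 2))) /\
    (forall j t, derivable_pt_lim (D j) t (D (S j) t)) /\
    (forall j, 0 < c j) /\
    (forall j t, h j t = c j * exp (PI * t ^ 2) * D j t) /\
    (forall j, improper_integral (fun t => (h j t) ^ 2) 1).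

(* Lattice Lambda = A Z^2 with A = [[a, b], [c, d]]; the point indexed by
   (k,l) is (x, omega) = (a k + b l, c k + d l). *)
Definition lat_x (a b c d : R) (p : Z * Z) : R := a * IZR (fst p) + b * IZR (snd p).
Definition lat_w (a b c d : R) (p : Z * Z) : R := c * IZR (fst p) + d * IZR (snd p).

Definition lattice_density (a b c d : R) : R := / Rabs (a * d - b * c).

Definition sumR (l : list R) : R := fold_right Rplus 0 l.

(* k-th coordinate of sum_{p in idx} co p * M_{w_p} T_{x_p} h_k, real and
   imaginary parts; co p = (Re, Im) of the coefficient. *)
Definition gsum_re (h : nat -> R -> R) (a b c d : R) (idx : list (Z * Z))
  (co : Z * Z -> R * R) (k : nat) (t : R) : R :=
  sumR (map (fun p =>
    let th := 2 * PI * lat_w a b c d p * t in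
    (fst (co p) * cos th - snd (co p) * sin th) * h k (t - lat_x a b c d p)) idx).

Definition gsum_im (h : nat -> R -> R) (a b c d : R) (idx : list (Z * Z))
  (co : Z * Z -> R * R) (k : nat) (t : R) : R :=
  sumR (map (fun p =>
    let th := 2 * PI * lat_w a b c d p * t in
    (fst (co p) * sin th + snd (co p) * cos th) * h k (t - lat_x a b c d p)) idx).

Definition gsum_sq (n : nat) (h : nat -> R -> R) (a b c d : R) (idx : list (Z * Z))
  (co : Z * Z -> R * R) (t : R) : R :=
  sumR (map (fun k => (gsum_re h a b c d idx co k t) ^ 2
                    + (gsum_im h a b c d idx co k t) ^ 2) (seq 0 n)).

Definition coef_sq (idx : list (Z * Z)) (co : Z * Z -> R * R) : R :=
  sumR (map (fun p => (fst (co p)) ^ 2 + (snd (co p)) ^ 2) idx).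

(* G(h_n, Lambda) is a Riesz sequence in L^2(R, C^n): for every finitely
   supported coefficient family (support contained in the duplicate-free
   list idx of lattice indices), ||sum c_p g_p||^2 lies between A and B
   times sum |c_p|^2. *)
Definition gabor_riesz (n : nat) (h : nat -> R -> R) (a b c d : R) : Prop :=
  exists A B, 0 < A /\ 0 < B /\
    forall (idx : list (Z * Z)) (co : Z * Z -> R * R), NoDup idx ->
      exists L, improper_integral (gsum_sq n h a b c d idx co) L /\
        A * coef_sq idx co <= L /\ L <= B * coef_sq idx co.

(* Main.v *)
(** Integration by parts shows that the inner products of shifted Hermite
    functions, divided by those of the Gaussian, satisfy a two-term recursion.
    It follows that the Gram matrix of [{M_w T_x h_k}] depends, up to symplectic
    phases, only on the distances between lattice points, so the Riesz property
    is invariant under rotations of the lattice; one may therefore take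
    Λ = {(ak, ck + dl)} with a > 0.

    The span of h_0, ..., h_{n-1} is that of t^j φ(t), j < n, with
    φ(t) = exp(-π t²), so the h_k may be replaced by t^j φ.  By orthogonality of
    the exp(2πi d l t) over a period H = 1/|d|, the squared norm becomes the
    integral over t in one period of the fibre sums
      Σ_m Σ_{j<n} |Σ_k b_k exp(2πi c k m H) (s - ak)^j φ(s - ak)|²,  s = t + mH,
    where Σ_k |b_k|² has mean (over a period) Σ |c_p|².
    Expanding φ(s - ak), the inner sums are combinations of the jets of order n
    of one Laurent polynomial P(z) = Σ_k β_k z^k at the points
    z_m = exp(2π a s + 2πi c m H), a geometric progression.

    If H < a n (that is, D(Λ) < n), Hermite interpolation of P at 2M of these
    points bounds each β_k by the jets with rapidly decaying weights, and Schur's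
    test gives a lower bound for the fibre sums.  If H >= a n, the polynomials
    with n-fold zeros at 2M central points give, at one particular t, fibre sums
    that are arbitrarily small compared to Σ |b_k|²; multiplying by a Dirichlet
    kernel concentrated at that t violates every lower Riesz bound. *)
Require Import Defs.
From Stdlib Require Import Reals Lra ZArith List.
From Stdlib Require Lia Psatz ClassicalChoice FunctionalExtensionality.
From Coquelicot Require Coquelicot.
From mathcomp Require all_boot all_order all_algebra complex Rstruct ring lra zify ssrZ.
Open Scope R_scope.

(** In the estimates only the moduli of the points z_m matter; c rotates these points and enters no
    constant. The threshold comes from comparing two Gaussians. Put Q = exp(2πaH). A node k steps
    from the unit circle is separated from it by k other nodes, whose inverse factors have sizes
    about Q^-1, ..., Q^-k; with multiplicity n they give about exp(-π a n H k²). Passing from fibre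
    sums to jets of P costs exp(π s²), about exp(π H² k²). The product decays if and only if H < an.

    For H >= an the same exponents appear, and at H = an they cancel, so no exponential gain is
    available. What remains is a factor M: the zeros occupy nodes of the fibre t = -H/2, whose other
    nodes contribute a bounded multiple of some E², while M nodes of the fibre t = 0 contribute at
    least a multiple of E² each and are dominated by Σ |b_k|². This failure concerns one t only, a
    null set. It reaches the integral because fibre sums are Lipschitz in t and the squared
    Dirichlet kernel is bounded by K/(t - t0)² uniformly in its length. *)

Module Analysis.
Import Lia Psatz ClassicalChoice FunctionalExtensionality Coquelicot.Coquelicot.

(** * Improper integrals *)

Definition cont (f : R -> R) := forall t, continuous f t.

(* Working with [RInt], total on continuous functions, instead of proofs of Riemann
   integrability. *)
Definition IR (f : R -> R) (L : R) : Prop :=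
  forall eps, 0 < eps -> exists M, forall a b, a <= - M -> M <= b ->
    Rabs (RInt f a b - L) < eps.

Lemma cont_ex f a b : cont f -> ex_RInt f a b.
Proof. intros H. apply (@ex_RInt_continuous R_CompleteNormedModule). intros; apply H. Qed.

Lemma cont_scal f c : cont f -> cont (fun t => c * f t).
Proof. intros H t. apply (continuous_scal_r c f). apply H. Qed.
Lemma cont_plus f g : cont f -> cont g -> cont (fun t => f t + g t).
Proof. intros H H' t. apply (continuous_plus f g); [apply H | apply H']. Qed.
Lemma cont_mult f g : cont f -> cont g -> cont (fun t => f t * g t).
Proof. intros H H' t. apply (continuous_mult f g); [apply H | apply H']. Qed.

Lemma improper_IR f L : cont f -> (improper_integral f L <-> IR f L).
Proof.
  intros Hc; split.
  - intros [_ H] eps He; destruct (H eps He) as [M HM]; exists M; intros a b Ha Hb.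
    rewrite (RInt_Reals f a b (ex_RInt_Reals_0 f a b (cont_ex f a b Hc))).
    now apply HM.
  - intros H; split.
    + intros a b; constructor; apply ex_RInt_Reals_0, cont_ex, Hc.
    + intros eps He; destruct (H eps He) as [M HM]; exists M; intros a b pr Ha Hb.
      rewrite <- RInt_Reals; now apply HM.
Qed.

Lemma improper_ext f g L : (forall t, f t = g t) -> improper_integral f L -> improper_integral g L.
Proof.
  intros E [H1 H2]; split.
  - intros a b; destruct (H1 a b) as [pr]; constructor.
    apply ex_RInt_Reals_0; apply (ex_RInt_ext f); [intros; apply E | now apply ex_RInt_Reals_1].
  - intros eps He; destruct (H2 eps He) as [M HM]; exists M; intros a b pr Ha Hb.
    destruct (H1 a b) as [pr'].
    rewrite <- (RInt_Reals g a b pr), <- (RInt_ext f g) by (intros; apply E).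
    rewrite (RInt_Reals f a b pr'); now apply HM.
Qed.

Lemma IR_ext f g L : (forall t, f t = g t) -> IR f L -> IR g L.
Proof.
  intros E H eps He; destruct (H eps He) as [M HM]; exists M; intros a b Ha Hb.
  rewrite <- (RInt_ext f g) by (intros; apply E); auto.
Qed.

Lemma IR_unique f L L' : IR f L -> IR f L' -> L = L'.
Proof.
  intros H H'. destruct (Req_dec L L') as [|N]; [assumption|exfalso].
  set (e := Rabs (L - L') / 2).
  assert (He : 0 < e) by (unfold e; assert (0 < Rabs (L - L')) by (apply Rabs_pos_lt; lra); lra).
  destruct (H e He) as [M HM]; destruct (H' e He) as [M' HM'].
  set (X := Rmax M M').
  assert (m1 := Rmax_l M M'); assert (m2 := Rmax_r M M'); fold X in m1, m2.
  assert (h1 := HM (- X) X ltac:(lra) ltac:(lra)).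
  assert (h2 := HM' (- X) X ltac:(lra) ltac:(lra)).
  unfold e in *; revert h1 h2; unfold Rabs; repeat destruct Rcase_abs; lra.
Qed.

Lemma IR_lin f g a b L L' : cont f -> cont g -> IR f L -> IR g L' ->
  IR (fun t => a * f t + b * g t) (a * L + b * L').
Proof.
  intros Cf Cg H H' eps He.
  set (K := 1 + Rabs a + Rabs b).
  assert (K0 : 0 < K) by (unfold K; generalize (Rabs_pos a) (Rabs_pos b); lra).
  assert (He' : 0 < eps / K) by (apply Rdiv_lt_0_compat; lra).
  destruct (H _ He') as [M HM]; destruct (H' _ He') as [M' HM'].
  exists (Rmax M M'); intros x y Hx Hy.
  assert (m1 := Rmax_l M M'); assert (m2 := Rmax_r M M').
  assert (h1 := HM x y ltac:(lra) ltac:(lra)); assert (h2 := HM' x y ltac:(lra) ltac:(lra)).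
  rewrite (RInt_plus (fun t => a * f t) (fun t => b * g t)) by (apply cont_ex, cont_scal; assumption).
  rewrite (RInt_scal f) by (apply cont_ex; assumption). rewrite (RInt_scal g) by (apply cont_ex; assumption).
  unfold plus, scal; simpl; unfold mult; simpl.
  replace (a * RInt f x y + b * RInt g x y - (a * L + b * L'))
    with (a * (RInt f x y - L) + b * (RInt g x y - L')) by ring.
  apply Rle_lt_trans with (Rabs a * (eps / K) + Rabs b * (eps / K)).
  - eapply Rle_trans; [apply Rabs_triang|]. rewrite !Rabs_mult.
    apply Rplus_le_compat; apply Rmult_le_compat_l; try apply Rabs_pos; lra.
  - rewrite <- Rmult_plus_distr_r. replace eps with (K * (eps / K)) at 2 by (field; lra).
    apply Rmult_lt_compat_r; [exact He' | unfold K; lra].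
Qed.

Lemma IR_0 : IR (fun _ => 0) 0.
Proof.
  intros eps He; exists 0; intros; rewrite RInt_const. unfold scal; simpl; unfold mult; simpl.
  rewrite Rmult_0_r, Rminus_0_r, Rabs_R0; lra.
Qed.

Lemma IR_scal f a L : cont f -> IR f L -> IR (fun t => a * f t) (a * L).
Proof.
  intros C H. apply IR_ext with (fun t => a * f t + 0 * f t); [intros; ring|].
  replace (a * L) with (a * L + 0 * L) by ring. now apply IR_lin.
Qed.

Lemma IR_plus f g L L' : cont f -> cont g -> IR f L -> IR g L' ->
  IR (fun t => f t + g t) (L + L').
Proof.
  intros Cf Cg H H'. apply IR_ext with (fun t => 1 * f t + 1 * g t); [intros; ring|].
  replace (L + L') with (1 * L + 1 * L') by ring. now apply IR_lin.
Qed.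

Lemma IR_shift f s L : cont f -> IR f L -> IR (fun t => f (t + s)) L.
Proof.
  intros C H eps He; destruct (H eps He) as [M HM]; exists (M + Rabs s); intros a b Ha Hb.
  replace (RInt (fun t => f (t + s)) a b) with (RInt f (a + s) (b + s)).
  - apply HM; revert Ha Hb; unfold Rabs; destruct Rcase_abs; lra.
  - assert (E := RInt_comp_lin f 1 s a b (cont_ex _ _ _ C)).
    rewrite !Rmult_1_l in E; rewrite <- E; apply RInt_ext.
    intros; unfold scal; simpl; unfold mult; simpl; rewrite !Rmult_1_l; reflexivity.
Qed.

Definition vanishes (F : R -> R) :=
  forall eps, 0 < eps -> exists M, forall t, M <= Rabs t -> Rabs (F t) < eps.

Lemma IR_deriv F f : (forall t, is_derive F t (f t)) -> cont f -> vanishes F -> IR f 0.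
Proof.
  intros HF Cf HV eps He; destruct (HV (eps / 2) ltac:(lra)) as [M HM].
  exists (Rmax M 0); intros a b Ha Hb.
  assert (hm := Rmax_l M 0); assert (h0 := Rmax_r M 0).
  assert (E : RInt f a b = F b - F a).
  { apply is_RInt_unique. apply (is_RInt_derive F f); intros; [apply HF | apply Cf]. }
  rewrite E, Rminus_0_r.
  assert (h1 := HM a ltac:(rewrite Rabs_left1; lra)).
  assert (h2 := HM b ltac:(rewrite Rabs_right; lra)).
  revert h1 h2; unfold Rabs; repeat destruct Rcase_abs; lra.
Qed.

Lemma IR_le_abs f g L L' : cont f -> cont g -> (forall t, Rabs (f t) <= g t) ->
  IR f L -> IR g L' -> Rabs L <= L'.
Proof.
  intros Cf Cg H Hf Hg. apply Rnot_lt_le; intros N.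
  set (e := (Rabs L - L') / 2). assert (He : 0 < e) by (unfold e; lra).
  destruct (Hf e He) as [M HM]; destruct (Hg e He) as [M' HM'].
  set (X := Rmax (Rmax M M') 0).
  assert (x1 := Rmax_l (Rmax M M') 0); assert (x2 := Rmax_r (Rmax M M') 0).
  assert (x3 := Rmax_l M M'); assert (x4 := Rmax_r M M'). fold X in x1, x2.
  assert (h1 := HM (-X) X ltac:(lra) ltac:(lra)); assert (h2 := HM' (-X) X ltac:(lra) ltac:(lra)).
  assert (h3 : Rabs (RInt f (-X) X) <= RInt g (-X) X).
  { apply Rle_trans with (RInt (fun t => Rabs (f t)) (-X) X).
    - apply abs_RInt_le; [lra | now apply cont_ex].
    - apply RInt_le; [lra | | now apply cont_ex | intros; apply H].
      apply cont_ex. intros t. apply (continuous_comp f Rabs); [apply Cf | apply continuous_Rabs]. }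
  unfold e in *; revert h1 h2 h3; unfold Rabs; repeat destruct Rcase_abs; lra.
Qed.

Lemma cont_abs f : cont f -> cont (fun t => Rabs (f t)).
Proof. intros Cf t. apply (continuous_comp f Rabs); [apply Cf | apply continuous_Rabs]. Qed.

Lemma RInt_Chasles_cont f a b c : cont f -> RInt f a b + RInt f b c = RInt f a c.
Proof. intros C. apply (RInt_Chasles f); now apply cont_ex. Qed.

Lemma IR_mono f L a b : cont f -> (forall t, 0 <= f t) -> IR f L -> a <= b -> RInt f a b <= L.
Proof.
  intros C P H ab. apply Rnot_lt_le; intros N.
  destruct (H (RInt f a b - L) ltac:(lra)) as [M HM].
  set (x := Rmin a (-M)); set (y := Rmax b M).
  assert (x1 := Rmin_l a (-M)); assert (x2 := Rmin_r a (-M)).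
  assert (y1 := Rmax_l b M); assert (y2 := Rmax_r b M). fold x in x1, x2; fold y in y1, y2.
  assert (h := HM x y ltac:(lra) ltac:(lra)).
  rewrite <- (RInt_Chasles_cont f x a y C), <- (RInt_Chasles_cont f a b y C) in h.
  assert (p1 : 0 <= RInt f x a) by (apply RInt_ge_0; [lra | now apply cont_ex | intros; apply P]).
  assert (p2 : 0 <= RInt f b y) by (apply RInt_ge_0; [lra | now apply cont_ex | intros; apply P]).
  revert h; unfold Rabs; destruct Rcase_abs; lra.
Qed.

(** Outside [-M, M] the integrals of f are dominated by those of g, so the integrals over [-N, N]
    form a Cauchy sequence; the same tail bound gives convergence for endpoints moving
    independently. *)
Lemma IR_exists f g L : cont f -> cont g -> (forall t, Rabs (f t) <= g t) -> IR g L ->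
  exists L', IR f L'.
Proof.
  intros Cf Cg H Hg.
  assert (gpos : forall t, 0 <= g t) by (intros t; eapply Rle_trans; [apply Rabs_pos | apply H]).
  assert (tail : forall eps, 0 < eps -> exists M, 0 <= M /\ forall a b a' b',
     a <= -M -> M <= b -> a' <= -M -> M <= b' -> Rabs (RInt f a b - RInt f a' b') < eps).
  (* Integrals of g over large intervals lie within eps/5 of L, so a one-sided tail is below 2 eps/5
     and two of them stay below eps. *)
  { intros eps He. destruct (Hg (eps / 5) ltac:(lra)) as [M0 HM0].
    set (M := Rmax M0 0). assert (m1 := Rmax_l M0 0); assert (m2 := Rmax_r M0 0). fold M in m1, m2.
    assert (small : forall c d, M <= c -> c <= d -> Rabs (RInt f c d) < 2 * eps / 5 /\ Rabs (RInt f (-d) (-c)) < 2 * eps / 5).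
    { intros c d Hc Hd.
      assert (i1 := HM0 (-c) c ltac:(lra) ltac:(lra)).
      assert (i2 := HM0 (-c) d ltac:(lra) ltac:(lra)).
      assert (i3 := HM0 (-d) c ltac:(lra) ltac:(lra)).
      rewrite <- (RInt_Chasles_cont g (-c) c d Cg) in i2.
      rewrite <- (RInt_Chasles_cont g (-d) (-c) c Cg) in i3.
      assert (dom : forall x y, x <= y -> Rabs (RInt f x y) <= RInt g x y).
      { intros x y xy. apply Rle_trans with (RInt (fun t => Rabs (f t)) x y).
        - apply abs_RInt_le; [lra | now apply cont_ex].
        - apply RInt_le; [lra | | now apply cont_ex | intros; apply H].
          apply cont_ex, cont_abs; auto. }
      assert (d1 := dom c d Hd); assert (d2 := dom (-d) (-c) ltac:(lra)).
      revert i1 i2 i3; unfold Rabs at 1 2 3; repeat destruct Rcase_abs; lra. }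
    exists M; split; [assumption|]; intros a b a' b' ha hb ha' hb'.
    assert (s1 : Rabs (RInt f b' b) < 2 * eps / 5).
    { destruct (Rle_dec b' b) as [l|l]; [apply small; lra|].
      rewrite <- (opp_RInt_swap f) by now apply cont_ex. unfold opp; simpl.
      rewrite Rabs_Ropp. apply small; lra. }
    assert (s2 : Rabs (RInt f a a') < 2 * eps / 5).
    { destruct (Rle_dec a a') as [l|l].
      - destruct (small (-a') (-a) ltac:(lra) ltac:(lra)) as [_ q]. now rewrite !Ropp_involutive in q.
      - rewrite <- (opp_RInt_swap f) by now apply cont_ex. unfold opp; simpl.
        rewrite Rabs_Ropp. destruct (small (-a) (-a') ltac:(lra) ltac:(lra)) as [_ q]. now rewrite !Ropp_involutive in q. }
    rewrite <- (RInt_Chasles_cont f a a' b Cf), <- (RInt_Chasles_cont f a' b' b Cf).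
    revert s1 s2; unfold Rabs; repeat destruct Rcase_abs; lra. }
  set (u := fun n => RInt f (- INR n) (INR n)).
  assert (CC : Cauchy_crit u).
  { intros eps He; destruct (tail eps He) as [M [M0 HM]].
    destruct (INR_unbounded M) as [N HN].
    exists N; intros p q hp hq; unfold Rdist, u.
    assert (INR N <= INR p) by (apply le_INR; lia). assert (INR N <= INR q) by (apply le_INR; lia).
    apply HM; lra. }
  destruct (Rcomplete.R_complete u CC) as [l Hl]; exists l; intros eps He.
  destruct (tail (eps / 2) ltac:(lra)) as [M [M0 HM]]; exists M; intros a b ha hb.
  destruct (Hl (eps / 2) ltac:(lra)) as [N HN]; destruct (INR_unbounded M) as [N' HN'].
  assert (hk := HN (max N N') ltac:(lia)); unfold Rdist, u in hk.
  assert (INR N' <= INR (max N N')) by (apply le_INR; lia).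
  assert (hm := HM a b (- INR (max N N')) (INR (max N N')) ha hb ltac:(lra) ltac:(lra)).
  revert hk hm; unfold Rabs; repeat destruct Rcase_abs; lra.
Qed.

Lemma is_derive_extR (f g : R -> R) (x l : R) :
  (forall t : R, f t = g t :> R) -> is_derive f x l -> is_derive g x l.
Proof. intros E; apply is_derive_ext; exact E. Qed.

Lemma is_derive_eq (f : R -> R) (x l l' : R) : is_derive f x l -> l = l' :> R -> is_derive f x l'.
Proof. now intros H <-. Qed.

Lemma is_derive_multR (f g : R -> R) (x l l' : R) : is_derive f x l -> is_derive g x l' ->
  is_derive (fun t => f t * g t) x (l * g x + f x * l').
Proof. intros H H'. apply (is_derive_mult f g x l l' H H'). intros; apply Rmult_comm. Qed.

Lemma is_derive_plusR (f g : R -> R) (x l l' : R) : is_derive f x l -> is_derive g x l' ->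
  is_derive (fun t => f t + g t) x (l + l').
Proof. intros H H'. apply (is_derive_plus f g x l l' H H'). Qed.

Lemma is_derive_scalR (f : R -> R) (x k l : R) : is_derive f x l ->
  is_derive (fun t => k * f t) x (k * l).
Proof. intros H. apply (is_derive_scal f x k l H). Qed.

Lemma is_derive_idR (x : R) : is_derive (fun t : R => t) x 1.
Proof. apply (is_derive_id x). Qed.

(** * Hermite polynomials with a Gaussian weight *)

(* [He j] is the polynomial exp(2πt²) (d/dt)^j exp(-2πt²). *)
Fixpoint He (j : nat) (t : R) : R :=
  match j with
  | O => 1
  | S i => - (4 * PI * t) * He i t +
      match i with O => 0 | S i' => - (4 * PI * INR i) * He i' t end
  end.

Lemma He_S j t : He (S j) t = - (4 * PI * t) * He j t - 4 * PI * INR j * He (pred j) t.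
Proof.
  destruct j as [|j]; [simpl; ring|].
  change (He (S (S j)) t) with (- (4 * PI * t) * He (S j) t + - (4 * PI * INR (S j)) * He j t).
  change (pred (S j)) with j. ring.
Qed.

(** The [He j] form an Appell sequence up to scaling. The induction is strong because the recursion
    reaches back two indices. *)
Lemma He_deriv j t : is_derive (He j) t (- (4 * PI * INR j) * He (pred j) t).
Proof.
  revert t; induction j as [j IH] using (well_founded_induction lt_wf); intros t.
  destruct j as [|j].
  - simpl He. replace (- (4 * PI * INR 0) * 1) with 0 by (simpl; ring). apply (is_derive_const 1).
  - apply (is_derive_extR (fun t => - (4 * PI) * (t * He j t) + - (4 * PI * INR j) * He (pred j) t)).
    { intros s; rewrite He_S; ring. }
    eapply is_derive_eq.
    { apply is_derive_plusR; apply is_derive_scalR.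
      - apply is_derive_multR; [apply is_derive_idR | apply IH; lia].
      - apply IH; lia. }
    destruct j as [|j]; [simpl; ring|].
    change (pred (S (S j))) with (S j). change (pred (S j)) with j.
    rewrite (He_S j t), !S_INR. ring.
Qed.

Definition gw (t : R) : R := exp (- (2 * PI * t ^ 2)).

Lemma gw_deriv t : is_derive gw t (- (4 * PI * t) * gw t).
Proof. unfold gw; auto_derive; [trivial | simpl; ring]. Qed.

Lemma hermite_D (D : nat -> R -> R) :
  (forall t, D 0%nat t = gw t) -> (forall j t, derivable_pt_lim (D j) t (D (S j) t)) ->
  forall j t, D j t = He j t * gw t.
Proof.
  intros H0 HS; induction j as [|j IH]; intros t; [rewrite H0; simpl; ring|].
  assert (d : is_derive (D j) t (D (S j) t)) by (apply is_derive_Reals, HS).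
  assert (d' : is_derive (D j) t (He (S j) t * gw t)).
  { apply (is_derive_extR (fun t => He j t * gw t)); [intros; now rewrite IH|].
    eapply is_derive_eq; [apply is_derive_multR; [apply He_deriv | apply gw_deriv]|].
    rewrite He_S; ring. }
  now rewrite <- (is_derive_unique _ _ _ d), (is_derive_unique _ _ _ d').
Qed.

(** A class stable under sums, products and translations that contains polynomials and bounded
    trigonometric factors; multiplication by [gw] sends it to functions vanishing at infinity, as
    integration by parts requires. *)
Definition exp_growth (f : R -> R) := exists C k, 0 <= C /\ 0 <= k /\ forall t, Rabs (f t) <= C * exp (k * Rabs t).

Lemma exp_mono x y : x <= y -> exp x <= exp y.
Proof. intros [H|H]; [left; now apply exp_increasing | right; now rewrite H]. Qed.

Lemma exp_growth_const c : exp_growth (fun _ => c).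
Proof.
  exists (Rabs c), 0; repeat split; try apply Rabs_pos; try lra.
  intros t; rewrite Rmult_0_l, exp_0; lra.
Qed.

Lemma exp_growth_id : exp_growth (fun t => t).
Proof.
  exists 1, 1; repeat split; try lra; intros t.
  rewrite !Rmult_1_l; generalize (exp_ineq1_le (Rabs t)); lra.
Qed.

Lemma exp_growth_plus f g : exp_growth f -> exp_growth g -> exp_growth (fun t => f t + g t).
Proof.
  intros [C [k [C0 [k0 H]]]] [C' [k' [C0' [k0' H']]]].
  exists (C + C'), (k + k'); repeat split; try lra; intros t.
  assert (p := Rabs_pos t).
  assert (e1 : exp (k * Rabs t) <= exp ((k + k') * Rabs t)) by (apply exp_mono; nra).
  assert (e2 : exp (k' * Rabs t) <= exp ((k + k') * Rabs t)) by (apply exp_mono; nra).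
  eapply Rle_trans; [apply Rabs_triang|]. generalize (H t) (H' t); nra.
Qed.

Lemma exp_growth_mult f g : exp_growth f -> exp_growth g -> exp_growth (fun t => f t * g t).
Proof.
  intros [C [k [C0 [k0 H]]]] [C' [k' [C0' [k0' H']]]].
  exists (C * C'), (k + k'); repeat split; try nra; intros t.
  rewrite Rabs_mult, Rmult_plus_distr_r, exp_plus.
  replace (C * C' * (exp (k * Rabs t) * exp (k' * Rabs t))) with
    ((C * exp (k * Rabs t)) * (C' * exp (k' * Rabs t))) by ring.
  apply Rmult_le_compat; auto using Rabs_pos.
Qed.

Lemma exp_growth_shift f s : exp_growth f -> exp_growth (fun t => f (t + s)).
Proof.
  intros [C [k [C0 [k0 H]]]]; exists (C * exp (k * Rabs s)), k; repeat split; auto.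
  - generalize (exp_pos (k * Rabs s)); nra.
  - intros t; eapply Rle_trans; [apply H|]. rewrite Rmult_assoc, <- exp_plus.
    apply Rmult_le_compat_l; [assumption|]. apply exp_mono. generalize (Rabs_triang t s); nra.
Qed.

Lemma exp_growth_bounded f c : (forall t, Rabs (f t) <= c) -> exp_growth f.
Proof.
  intros H; exists c, 0; repeat split; try lra.
  - eapply Rle_trans; [apply Rabs_pos | apply (H 0)].
  - intros t; rewrite Rmult_0_l, exp_0; generalize (H t); lra.
Qed.

Lemma exp_growth_He j : exp_growth (He j).
Proof.
  assert (G : exp_growth (He j) /\ exp_growth (He (pred j))).
  { induction j as [|j [IH1 IH2]]; [split; apply (exp_growth_const 1)|]. split; [|exact IH1].
    assert (e : exp_growth (fun t => - (4 * PI) * (t * He j t) + - (4 * PI * INR j) * He (pred j) t)).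
    { apply exp_growth_plus; apply exp_growth_mult; try apply exp_growth_const; auto. apply exp_growth_mult; [apply exp_growth_id | auto]. }
    destruct e as [C [k [C0 [k0 H]]]]; exists C, k; repeat split; auto; intros t.
    rewrite He_S. replace (- (4 * PI * t) * He j t - 4 * PI * INR j * He (pred j) t) with
      (- (4 * PI) * (t * He j t) + - (4 * PI * INR j) * He (pred j) t) by ring. apply H. }
  apply G.
Qed.

(** Completing the square: (k + 1)²/(4s) is the maximum of (k + 1)x - s x². *)
Lemma gauss_exp_decay s k : 0 < s ->
  exists C, 0 <= C /\ forall t, exp (- (s * t ^ 2)) * exp (k * Rabs t) <= C * exp (- Rabs t).
Proof.
  intros s0. exists (exp ((k + 1) ^ 2 / (4 * s))); split; [left; apply exp_pos|]; intros t.
  rewrite <- !exp_plus; apply exp_mono.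
  rewrite <- (pow2_abs t).
  set (x := Rabs t). apply Rminus_le_0.
  replace ((k + 1) ^ 2 / (4 * s) + - x - (- (s * x ^ 2) + k * x)) with
    ((2 * s * x - (k + 1)) ^ 2 / (4 * s)) by (field; lra).
  apply Rmult_le_pos; [apply pow2_ge_0 | left; apply Rinv_0_lt_compat; lra].
Qed.

Lemma gw_decay k : exists C, 0 <= C /\ forall t, gw t * exp (k * Rabs t) <= C * exp (- Rabs t).
Proof. apply gauss_exp_decay. generalize PI_RGT_0; lra. Qed.

Lemma exp_growth_vanishes f : exp_growth f -> vanishes (fun t => f t * gw t).
Proof.
  intros [C [k [C0 [k0 H]]]] eps He; destruct (gw_decay k) as [C' [C0' H']].
  exists ((C * C' + 1) / eps); intros t Ht.
  assert (q : 0 <= C * C') by nra.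
  assert (b : Rabs (f t * gw t) <= C * C' * exp (- Rabs t)).
  { rewrite Rabs_mult, (Rabs_right (gw t)) by (left; apply exp_pos).
    generalize (H t) (H' t) (exp_pos (- (2 * PI * t ^ 2))); unfold gw; nra. }
  eapply Rle_lt_trans; [exact b|].
  assert (e1 : Rabs t < exp (Rabs t)) by (generalize (exp_ineq1_le (Rabs t)); lra).
  rewrite exp_Ropp.
  apply (Rmult_le_compat_r eps) in Ht; [|lra]. unfold Rdiv in Ht.
  rewrite Rmult_assoc, Rinv_l, Rmult_1_r in Ht by lra.
  apply (Rmult_lt_reg_r (exp (Rabs t))); [apply exp_pos|].
  rewrite Rmult_assoc, Rinv_l, Rmult_1_r by (apply Rgt_not_eq, exp_pos). nra.
Qed.

Lemma cont_ext f g : (forall t, f t = g t) -> cont f -> cont g.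
Proof. intros E H t. apply (continuous_ext f); auto. Qed.
Lemma cont_derive f (df : R -> R) : (forall t, is_derive f t (df t)) -> cont f.
Proof. intros H t. apply (ex_derive_continuous f). exists (df t); apply H. Qed.
Lemma cont_He j : cont (He j).
Proof. apply (cont_derive _ _ (He_deriv j)). Qed.
Lemma cont_gw : cont gw.
Proof. apply (cont_derive _ _ gw_deriv). Qed.
Lemma cont_shift f s : cont f -> cont (fun t => f (t + s)).
Proof.
  intros H t. apply (continuous_comp (fun t => t + s) f); [|apply H].
  apply (continuous_plus (fun t => t) (fun _ => s)); [apply continuous_id | apply continuous_const].
Qed.
Lemma cont_const c : cont (fun _ => c).
Proof. intros t; apply continuous_const. Qed.
Lemma cont_cos a : cont (fun t => cos (a * t)).
Proof. apply (cont_derive _ (fun t => - (a * sin (a * t)))). intros t; auto_derive; [trivial | ring]. Qed.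
Lemma cont_sin a : cont (fun t => sin (a * t)).
Proof. apply (cont_derive _ (fun t => a * cos (a * t))). intros t; auto_derive; [trivial | ring]. Qed.
Lemma cont_id : cont (fun t => t).
Proof. intros t; apply continuous_id. Qed.

(** * Fourier transform of the Gaussian *)

Lemma IR_odd f L : cont f -> (forall t, f (- t) = - f t) -> IR f L -> L = 0.
Proof.
  intros Cf Ho H.
  assert (Z : forall X, RInt f (- X) X = 0).
  { intros X. assert (E := RInt_comp_lin f (-1) 0 (- X) X (cont_ex _ _ _ Cf)).
    rewrite (RInt_ext _ f) in E.
    2: { intros x _. unfold scal; simpl; unfold mult; simpl.
         replace (-1 * x + 0) with (- x) by ring. rewrite Ho; ring. }
    replace (-1 * - X + 0) with X in E by ring. replace (-1 * X + 0) with (- X) in E by ring.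
    assert (S := opp_RInt_swap f X (- X) (cont_ex _ _ _ Cf)). unfold opp in S; simpl in S. lra. }
  destruct (Req_dec L 0) as [|N]; [assumption|exfalso].
  destruct (H (Rabs L) (Rabs_pos_lt _ N)) as [M HM].
  assert (h := HM (- Rabs M) (Rabs M) ltac:(generalize (RRle_abs M); lra) (RRle_abs M)).
  rewrite Z in h. unfold Rminus in h; rewrite Rplus_0_l, Rabs_Ropp in h; lra.
Qed.

Section FT.
Variable om : R.

(** The Fourier transform of P [gw] with kernel exp(i om t). Being a relation, it states convergence
    and value together. *)
Definition isFT (P : R -> R) (z : C) :=
  IR (fun t => P t * gw t * cos (om * t)) (Re z) /\ IR (fun t => P t * gw t * sin (om * t)) (Im z).

Lemma cont_FTc P : cont P -> cont (fun t => P t * gw t * cos (om * t)).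
Proof. intros H. apply cont_mult; [apply cont_mult; [exact H | apply cont_gw] | apply cont_cos]. Qed.
Lemma cont_FTs P : cont P -> cont (fun t => P t * gw t * sin (om * t)).
Proof. intros H. apply cont_mult; [apply cont_mult; [exact H | apply cont_gw] | apply cont_sin]. Qed.

Lemma FT_ext P P' z z' : (forall t, P t = P' t) -> z = z' -> isFT P z -> isFT P' z'.
Proof.
  intros E <- [H1 H2]; split; eapply IR_ext; [| exact H1 | | exact H2]; intros; simpl; now rewrite E.
Qed.

Lemma FT_lin P P' z z' (a b : R) : cont P -> cont P' -> isFT P z -> isFT P' z' ->
  isFT (fun t => a * P t + b * P' t) (a * z + b * z')%C.
Proof.
  intros C1 C2 [H1 H2] [H1' H2']; split.
  - apply IR_ext with (fun t => a * (P t * gw t * cos (om * t)) + b * (P' t * gw t * cos (om * t))).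
    { intros; ring. }
    replace (Re (a * z + b * z')%C) with (a * Re z + b * Re z') by (destruct z, z'; simpl; ring).
    apply IR_lin; auto using cont_FTc.
  - apply IR_ext with (fun t => a * (P t * gw t * sin (om * t)) + b * (P' t * gw t * sin (om * t))).
    { intros; ring. }
    replace (Im (a * z + b * z')%C) with (a * Im z + b * Im z') by (destruct z, z'; simpl; ring).
    apply IR_lin; auto using cont_FTs.
Qed.

Lemma cos_deriv t : is_derive (fun t => cos (om * t)) t (- (om * sin (om * t))).
Proof. auto_derive; [trivial | ring]. Qed.
Lemma sin_deriv t : is_derive (fun t => sin (om * t)) t (om * cos (om * t)).
Proof. auto_derive; [trivial | ring]. Qed.

(** Since (P gw)' = (P' - 4πtP) gw and P gw vanishes at infinity, differentiation becomes
    multiplication by -i om. *)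
Lemma FT_parts P dP z : exp_growth P -> cont P -> cont dP -> (forall t, is_derive P t (dP t)) ->
  isFT P z -> isFT (fun t => dP t - 4 * PI * t * P t) (Cmult (0, - om) z).
Proof.
  intros EP CP CdP HP [H1 H2].
  assert (CQ : cont (fun t => dP t - 4 * PI * t * P t)).
  { apply (cont_ext (fun t => dP t + (- (4 * PI)) * (t * P t))); [intros; ring|].
    apply cont_plus; [exact CdP|]. apply cont_scal, cont_mult; [apply cont_id | exact CP]. }
  split.
  - apply IR_ext with (fun t => 1 * ((dP t - 4 * PI * t * P t) * gw t * cos (om * t) - om * (P t * gw t * sin (om * t)))
       + om * (P t * gw t * sin (om * t))); [intros; ring|].
    replace (Re (Cmult (0, - om) z)) with (1 * 0 + om * Im z) by (destruct z; simpl; ring).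
    assert (K : cont (fun t => (dP t - 4 * PI * t * P t) * gw t * cos (om * t) - om * (P t * gw t * sin (om * t)))).
    { apply (cont_ext (fun t => (dP t - 4 * PI * t * P t) * gw t * cos (om * t) + (- om) * (P t * gw t * sin (om * t)))).
      - intros; ring.
      - apply cont_plus; [now apply cont_FTc | now apply cont_scal, cont_FTs]. }
    apply IR_lin; auto using cont_FTs.
    apply (IR_deriv (fun t => P t * gw t * cos (om * t))); auto.
    + intros t; eapply is_derive_eq.
      { apply is_derive_multR; [apply is_derive_multR; [apply HP | apply gw_deriv] | apply cos_deriv]. }
      cbv beta; ring.
    + assert (v := exp_growth_vanishes (fun t => P t * cos (om * t))).
      intros eps He; destruct (v ltac:(apply exp_growth_mult; [assumption | apply (exp_growth_bounded _ 1); intros; apply Rabs_le, COS_bound]) eps He) as [M HM].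
      exists M; intros t Ht. replace (P t * gw t * cos (om * t)) with (P t * cos (om * t) * gw t) by ring. auto.
  - apply IR_ext with (fun t => 1 * ((dP t - 4 * PI * t * P t) * gw t * sin (om * t) + om * (P t * gw t * cos (om * t)))
       + (- om) * (P t * gw t * cos (om * t))); [intros; ring|].
    replace (Im (Cmult (0, - om) z)) with (1 * 0 + (- om) * Re z) by (destruct z; simpl; ring).
    assert (K : cont (fun t => (dP t - 4 * PI * t * P t) * gw t * sin (om * t) + om * (P t * gw t * cos (om * t)))).
    { apply cont_plus; [now apply cont_FTs | now apply cont_scal, cont_FTc]. }
    apply IR_lin; auto using cont_FTc.
    apply (IR_deriv (fun t => P t * gw t * sin (om * t))); auto.
    + intros t; eapply is_derive_eq.
      { apply is_derive_multR; [apply is_derive_multR; [apply HP | apply gw_deriv] | apply sin_deriv]. }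
      cbv beta; ring.
    + assert (v := exp_growth_vanishes (fun t => P t * sin (om * t))).
      intros eps He; destruct (v ltac:(apply exp_growth_mult; [assumption | apply (exp_growth_bounded _ 1); intros; apply Rabs_le, SIN_bound]) eps He) as [M HM].
      exists M; intros t Ht. replace (P t * gw t * sin (om * t)) with (P t * sin (om * t) * gw t) by ring. auto.
Qed.

End FT.

Lemma sin_le_abs y : Rabs (sin y) <= Rabs y.
Proof.
  destruct (MVT_gen sin 0 y cos) as [c [_ Hc]].
  - intros; auto_derive; [trivial | ring].
  - intros; apply continuity_sin.
  - rewrite sin_0, !Rminus_0_r in Hc; rewrite Hc, Rabs_mult.
    assert (Rabs (cos c) <= 1) by apply Rabs_le, COS_bound. generalize (Rabs_pos y); nra.
Qed.

Lemma one_minus_cos y : Rabs (cos y - 1) <= y ^ 2 / 2 /\ Rabs (cos y - 1) <= Rabs y.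
Proof.
  assert (E : cos y - 1 = - (2 * (sin (y / 2) * sin (y / 2)))).
  { replace y with (2 * (y / 2)) at 1 by field. rewrite cos_2a_sin. ring. }
  assert (s := sin_le_abs (y / 2)). assert (b := SIN_bound (y / 2)).
  assert (s1 : Rabs (sin (y / 2)) <= 1) by (apply Rabs_le; exact b).
  rewrite E, Rabs_Ropp, Rabs_mult, (Rabs_right 2), Rabs_mult by lra.
  assert (q : Rabs (y / 2) = Rabs y / 2) by (unfold Rdiv; rewrite Rabs_mult, (Rabs_right (/ 2)); lra).
  rewrite q in s. assert (p := Rabs_pos (sin (y / 2))). assert (p' := Rabs_pos y).
  rewrite <- (pow2_abs y). split; nra.
Qed.

(** The remainder is quadratic uniformly in x, so that the second Gaussian moment dominates the
    difference quotient in [gauss_FT]. The constant is crude: 1/2 from cos y - 1 and 1 from sin y -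
    y. *)
Lemma cos_taylor x y : Rabs (cos (x + y) - cos x + y * sin x) <= 2 * y ^ 2.
Proof.
  rewrite cos_plus.
  replace (cos x * cos y - sin x * sin y - cos x + y * sin x) with
    (cos x * (cos y - 1) - sin x * (sin y - y)) by ring.
  assert (a1 : Rabs (cos x) <= 1) by apply Rabs_le, COS_bound.
  assert (a2 : Rabs (sin x) <= 1) by apply Rabs_le, SIN_bound.
  destruct (one_minus_cos y) as [b1 _].
  assert (b2 : Rabs (sin y - y) <= y ^ 2).
  { destruct (MVT_gen (fun y => sin y - y) 0 y (fun y => cos y - 1)) as [c [Hc E]].
    - intros; auto_derive; [trivial | ring].
    - intros; apply derivable_continuous_pt. exists (cos x0 - 1).
      apply is_derive_Reals; auto_derive; [trivial | ring].
    - rewrite sin_0, !Rminus_0_r in E; rewrite E, Rabs_mult.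
      destruct (one_minus_cos c) as [_ h].
      assert (Rabs c <= Rabs y).
      { revert Hc; unfold Rmin, Rmax; destruct Rle_dec; unfold Rabs; repeat destruct Rcase_abs; lra. }
      rewrite <- (pow2_abs y). generalize (Rabs_pos y) (Rabs_pos (cos c - 1)); nra. }
  eapply Rle_trans; [apply Rabs_triang|]. rewrite Rabs_Ropp, !Rabs_mult.
  generalize (Rabs_pos (cos x)) (Rabs_pos (sin x)) (Rabs_pos (cos y - 1)) (Rabs_pos (sin y - y)).
  nra.
Qed.

Section GaussianFT.
Variables (E1 E2 : R).
Hypotheses (H1 : IR gw E1) (H2 : IR (fun t => t ^ 2 * gw t) E2).

Lemma gauss_FT_exists om : exists c : R, isFT om (fun _ => 1) (c, 0).
Proof.
  assert (Cc : cont (fun t => 1 * gw t * cos (om * t))) by apply cont_FTc, cont_const.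
  assert (Cs : cont (fun t => 1 * gw t * sin (om * t))) by apply cont_FTs, cont_const.
  destruct (IR_exists _ gw E1 Cc cont_gw) as [c Hc]; [|exact H1|].
  { intros t. rewrite Rabs_mult, Rmult_1_l, (Rabs_right (gw t)) by (left; apply exp_pos).
    assert (Rabs (cos (om * t)) <= 1) by apply Rabs_le, COS_bound.
    generalize (exp_pos (- (2 * PI * t ^ 2))); unfold gw; nra. }
  destruct (IR_exists _ gw E1 Cs cont_gw) as [s Hs]; [|exact H1|].
  { intros t. rewrite Rabs_mult, Rmult_1_l, (Rabs_right (gw t)) by (left; apply exp_pos).
    assert (Rabs (sin (om * t)) <= 1) by apply Rabs_le, SIN_bound.
    generalize (exp_pos (- (2 * PI * t ^ 2))); unfold gw; nra. }
  exists c; split; [exact Hc|]. simpl.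
  rewrite <- (IR_odd _ s Cs); [exact Hs | | exact Hs].
  intros t; unfold gw. replace ((- t) ^ 2) with (t ^ 2) by ring.
  replace (om * - t) with (- (om * t)) by ring. rewrite sin_neg; ring.
Qed.

(* As a function of om, the transform J satisfies J' = - om J / (4π); the second moment E2
   justifies differentiating under the integral. *)
Lemma gauss_FT om : isFT om (fun _ => 1) (E1 * exp (- (om ^ 2 / (8 * PI))), 0).
Proof.
  assert (P0 := PI_RGT_0).
  destruct (choice (fun om c => isFT om (fun _ => 1) (c, 0)) gauss_FT_exists) as [J HJ].
  assert (D : forall om, is_derive J om (- (om / (4 * PI)) * J om)).
  { clear om; intros om. apply is_derive_Reals. intros eps He.
    assert (hd : 0 < eps / (2 * Rabs E2 + 1)) by (apply Rdiv_lt_0_compat; [lra | generalize (Rabs_pos E2); lra]).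
    exists (mkposreal _ hd); simpl; intros eta h0 hle.
    (* With P = 1 this says that -4π times the integral of t gw(t) sin(om t) equals -om J(om), which
       identifies the derivative expected under the integral sign. *)
    assert (parts := FT_parts om (fun _ => 1) (fun _ => 0) _ (exp_growth_const 1) (cont_const 1) (cont_const 0)
      (fun t => is_derive_const 1 t) (HJ om)).
    destruct parts as [_ parts]; simpl in parts.
    assert (I : IR (fun t => 1 * (1 * (1 * gw t * cos ((om + eta) * t)) + (-1) * (1 * gw t * cos (om * t))) +
        (- (eta / (4 * PI))) * ((0 - 4 * PI * t * 1) * gw t * sin (om * t)))
       (1 * (1 * J (om + eta) + (-1) * J om) + (- (eta / (4 * PI))) * (0 * 0 + - om * J om))).
    { apply IR_lin.
      - apply cont_plus; apply cont_scal, cont_FTc, cont_const.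
      - apply (cont_FTs om (fun t => 0 - 4 * PI * t * 1)).
        apply (cont_ext (fun t => (- (4 * PI)) * t)); [intros; ring | apply cont_scal, cont_id].
      - apply IR_lin; try apply cont_FTc, cont_const; [apply (HJ (om + eta)) | apply (HJ om)].
      - exact parts. }
    assert (B : Rabs (1 * (1 * J (om + eta) + (-1) * J om) + (- (eta / (4 * PI))) * (0 * 0 + - om * J om)) <= 2 * eta ^ 2 * E2).
    { refine (IR_le_abs _ (fun t => 2 * eta ^ 2 * (t ^ 2 * gw t)) _ _ _ _ _ I _).
      - apply cont_plus; [apply cont_scal, cont_plus; apply cont_scal, cont_FTc, cont_const|].
        apply cont_scal. apply (cont_FTs om (fun t => 0 - 4 * PI * t * 1)).
        apply (cont_ext (fun t => (- (4 * PI)) * t)); [intros; ring | apply cont_scal, cont_id].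
      - apply cont_scal, cont_mult; [|apply cont_gw].
        apply (cont_ext (fun t => t * t)); [intros; ring | apply cont_mult; apply cont_id].
      - intros t.
        replace (1 * (1 * (1 * gw t * cos ((om + eta) * t)) + (-1) * (1 * gw t * cos (om * t))) +
          - (eta / (4 * PI)) * ((0 - 4 * PI * t * 1) * gw t * sin (om * t))) with
          (gw t * (cos (om * t + eta * t) - cos (om * t) + (eta * t) * sin (om * t))).
        2: { rewrite (Rmult_plus_distr_r om eta t). field; lra. }
        rewrite Rabs_mult, (Rabs_right (gw t)) by (left; apply exp_pos).
        generalize (cos_taylor (om * t) (eta * t)) (exp_pos (- (2 * PI * t ^ 2))); unfold gw; nra.
      - apply IR_scal; [|exact H2].
        apply cont_mult; [|apply cont_gw].
        apply (cont_ext (fun t => t * t)); [intros; ring | apply cont_mult; apply cont_id]. }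
    replace ((J (om + eta) - J om) / eta - - (om / (4 * PI)) * J om) with
      ((1 * (1 * J (om + eta) + (-1) * J om) + (- (eta / (4 * PI))) * (0 * 0 + - om * J om)) / eta).
    2: { field; lra. }
    unfold Rdiv at 1; rewrite Rabs_mult, Rabs_inv by assumption.
    assert (ep : 0 < Rabs eta) by now apply Rabs_pos_lt.
    apply (Rmult_lt_reg_r (Rabs eta)); [assumption|].
    rewrite Rmult_assoc, Rinv_l, Rmult_1_r by lra.
    eapply Rle_lt_trans; [exact B|].
    assert (hh : Rabs eta * (2 * Rabs E2 + 1) < eps).
    { apply (Rmult_lt_reg_r (/ (2 * Rabs E2 + 1))); [apply Rinv_0_lt_compat; generalize (Rabs_pos E2); lra|].
      rewrite Rmult_assoc, Rinv_r, Rmult_1_r by (generalize (Rabs_pos E2); lra). exact hle. }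
    rewrite <- (pow2_abs eta). generalize (RRle_abs E2) (Rabs_pos E2); nra. }
  (* exp(x²/(8π)) is the integrating factor of J' = -x J/(4π). *)
  assert (G : forall x, J x * exp (x ^ 2 / (8 * PI)) = J 0).
  { intros x.
    destruct (MVT_gen (fun x => J x * exp (x ^ 2 / (8 * PI))) 0 x (fun _ => 0)) as [c [_ E]].
    - intros y _. eapply is_derive_eq.
      + apply is_derive_multR; [apply D|].
        assert (Dx : is_derive (fun x => exp (x ^ 2 / (8 * PI))) y (y / (4 * PI) * exp (y ^ 2 / (8 * PI)))).
        { auto_derive; [trivial|]. simpl. unfold Rdiv. set (e := exp _). field; lra. }
        exact Dx.
      + cbv beta. field; lra.
    - intros y _. apply derivable_continuous_pt. apply derivable_pt_mult.
      + exists (- (y / (4 * PI)) * J y). apply is_derive_Reals, D.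
      + apply ex_derive_Reals_0. auto_derive; trivial.
    - rewrite Rmult_0_l in E. replace (0 ^ 2 / (8 * PI)) with 0 in E by (field; lra). rewrite exp_0 in E; lra. }
  assert (J0 : J 0 = E1).
  { apply (IR_unique gw); [|exact H1]. destruct (HJ 0) as [h _]; simpl in h.
    apply (IR_ext (fun t => 1 * gw t * cos (0 * t))); [|exact h].
    intros; rewrite Rmult_0_l, cos_0; ring. }
  rewrite <- J0, <- (G om), exp_Ropp, Rmult_assoc, Rinv_r, Rmult_1_r by (apply Rgt_not_eq, exp_pos).
  apply HJ.
Qed.
End GaussianFT.

(** * Gram matrix of shifted Hermite functions *)

(* [Q u v j k] is the quotient by the Gaussian case j = k = 0 of ∫ He_j(t+de) He_k(t-de)
   exp(-2πt²) exp(2πi nu t) dt, with u = de + i nu/2 and v = -de + i nu/2; see [FT_cross]. *)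
Fixpoint Q (u v : C) (j k : nat) : C :=
  match j with
  | O => Cpow (Cmult (RtoC (- (4 * PI))) v) k
  | S i => Cplus (Cmult (Cmult (RtoC (- (4 * PI))) u) (Q u v i k))
      (Cmult (RtoC (4 * PI * INR k)) (Q u v i (pred k)))
  end.

(** Giving u weight 1 and v weight -1 makes [Q u v j k] homogeneous of weight j - k, because the
    second term of the recursion lowers both indices. Powers of x on both sides avoid negative
    exponents. *)
Lemma Q_cov (u v x y : C) j k : Cmult x y = RtoC 1 ->
  Cmult (Cpow x k) (Q (Cmult x u) (Cmult y v) j k) = Cmult (Cpow x j) (Q u v j k).
Proof.
  intros E; revert k; induction j as [|j IH]; intros k; simpl.
  - rewrite <- Cpow_mult_l, Cmult_1_l. f_equal.
    transitivity (Cmult (Cmult x y) (Cmult (RtoC (- (4 * PI))) v)); [ring|].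
    rewrite E; ring.
  - rewrite Cmult_plus_distr_l.
    replace (Cmult (Cpow x k) (Cmult (Cmult (RtoC (- (4 * PI))) (Cmult x u)) (Q (Cmult x u) (Cmult y v) j k)))
      with (Cmult (Cmult x (Cmult (RtoC (- (4 * PI))) u)) (Cmult (Cpow x k) (Q (Cmult x u) (Cmult y v) j k))) by ring.
    rewrite IH. destruct k as [|k].
    + simpl INR. rewrite Rmult_0_r. ring.
    + simpl pred. simpl (Cpow x (S k)).
      replace (Cmult (Cmult x (Cpow x k)) (Cmult (RtoC (4 * PI * INR (S k))) (Q (Cmult x u) (Cmult y v) j k)))
        with (Cmult (Cmult x (RtoC (4 * PI * INR (S k)))) (Cmult (Cpow x k) (Q (Cmult x u) (Cmult y v) j k))) by ring.
      rewrite IH. ring.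
Qed.

(* For |x| = 1 this is the action of a rotation of the time-frequency plane. *)
Lemma Q_rot (u v x y : C) k : Cmult x y = RtoC 1 -> Q (Cmult x u) (Cmult y v) k k = Q u v k k.
Proof.
  intros E. assert (N : x <> RtoC 0).
  { intros ->. rewrite Cmult_0_l in E. apply (f_equal fst) in E; simpl in E; lra. }
  assert (h := Q_cov u v x y k k E).
  apply (f_equal (fun z => Cmult (Cinv (Cpow x k)) z)) in h.
  rewrite !Cmult_assoc, Cinv_l, !Cmult_1_l in h by now apply Cpow_nz. exact h.
Qed.

(** Here v is minus the conjugate of u. With x = u/|u|, u = x|u| and v = conj(x)(-|u|), so [Q_rot]
    applies; r = 0 is separate because x is then undefined. *)
Lemma Q_diag (d n : R) k :
  let r := sqrt (d ^ 2 + n ^ 2) in Q (d, n) (- d, n) k k = Q (r, 0) (- r, 0) k k.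
Proof.
  intros r. destruct (Req_dec r 0) as [Z|N].
  - assert (d ^ 2 + n ^ 2 = 0).
    { apply sqrt_eq_0; [generalize (pow2_ge_0 d) (pow2_ge_0 n); lra | exact Z]. }
    assert (d = 0) by nra. assert (n = 0) by nra. rewrite Z; subst; reflexivity.
  - assert (rr : r * r = d ^ 2 + n ^ 2).
    { apply sqrt_sqrt. generalize (pow2_ge_0 d) (pow2_ge_0 n); lra. }
    rewrite <- (Q_rot (r, 0) (- r, 0) (d / r, n / r) (d / r, - (n / r))).
    + f_equal; apply injective_projections; simpl; field; assumption.
    + apply injective_projections; simpl; [|ring].
      replace (d / r * (d / r) - n / r * - (n / r)) with ((d ^ 2 + n ^ 2) / (r * r)) by (field; assumption).
      rewrite rr. field. rewrite <- rr. nra.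
Qed.

Section Cross.
Variables (E1 E2 : R).
Hypotheses (H1 : IR gw E1) (H2 : IR (fun t => t ^ 2 * gw t) E2).
Variables (de nu : R).
Let P j k t := He j (t + de) * He k (t + - de).
Let u : C := (de, nu / 2).
Let v : C := (- de, nu / 2).
Let om := 2 * PI * nu.

Lemma cont_cross j k : cont (P j k).
Proof. apply cont_mult; apply cont_shift, cont_He. Qed.

Lemma cross_deriv j k t : is_derive (P j k) t
  (- (4 * PI * INR j) * P (pred j) k t + - (4 * PI * INR k) * P j (pred k) t).
Proof.
  assert (D : forall i s, is_derive (fun t => He i (t + s)) t (- (4 * PI * INR i) * He (pred i) (t + s))).
  { intros i s. eapply is_derive_eq.
    - apply (is_derive_comp (He i) (fun t => t + s)); [apply He_deriv|].
      apply (is_derive_plusR (fun t => t) (fun _ => s)); [apply is_derive_idR | apply (is_derive_const s)].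
    - unfold scal; simpl; unfold mult; simpl. unfold zero; simpl. ring. }
  eapply is_derive_eq; [apply is_derive_multR; apply D|].
  unfold P; cbv beta; ring.
Qed.

Lemma exp_growth_cross j k : exp_growth (P j k).
Proof. apply exp_growth_mult; apply exp_growth_shift, exp_growth_He. Qed.

Lemma FT_step j k z : isFT om (P j k) z ->
  isFT om (fun t => - (4 * PI * INR j) * P (pred j) k t + - (4 * PI * INR k) * P j (pred k) t
    - 4 * PI * t * P j k t) (Cmult (0, - om) z).
Proof.
  intros H. refine (FT_parts om (P j k) _ z (exp_growth_cross j k) (cont_cross j k) _ (cross_deriv j k) H).
  apply cont_plus; apply cont_scal, cont_cross.
Qed.

Lemma cont_step j k : cont (fun t => - (4 * PI * INR j) * P (pred j) k t + - (4 * PI * INR k) * P j (pred k) t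
    - 4 * PI * t * P j k t).
Proof.
  apply (cont_ext (fun t => (- (4 * PI * INR j) * P (pred j) k t + - (4 * PI * INR k) * P j (pred k) t) +
    (- (4 * PI)) * (t * P j k t))); [intros; ring|].
  apply cont_plus; [apply cont_plus; apply cont_scal, cont_cross|].
  apply cont_scal, cont_mult; [apply cont_id | apply cont_cross].
Qed.

(* The recursion for [Q] is [FT_parts] combined with [He_S]. *)
Lemma FT_cross j k : isFT om (P j k) (Cmult (RtoC (E1 * exp (- (om ^ 2 / (8 * PI))))) (Q u v j k)).
Proof.
  set (g := RtoC (E1 * _)). revert k; induction j as [|j IH]; intros k.
  - induction k as [|k IHk].
    + eapply FT_ext; [| | apply (gauss_FT E1 E2 H1 H2)].
      * intros; unfold P; simpl; ring.
      * fold g. simpl. rewrite Cmult_1_r. reflexivity.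
    + eapply FT_ext; [| | apply FT_lin with (a := 1) (b := 4 * PI * de);
        [apply (cont_step 0 k) | apply (cont_cross 0 k) | apply FT_step, IHk | exact IHk]].
      * intros t; unfold P; cbv beta. simpl (pred 0). rewrite (He_S k). simpl INR. simpl (He 0 _). ring.
      * simpl Q. set (w := Cpow _ k). clearbody g w.
        destruct g, w; unfold v, om; apply injective_projections; simpl; field.
  - eapply FT_ext; [| | apply FT_lin with (a := 1) (b := 1);
      [apply (cont_step j k) | | apply FT_step, (IH k) | apply FT_lin with (a := - (4 * PI * de)) (b := 4 * PI * INR k);
         [apply cont_cross | apply cont_cross | apply (IH k) | apply (IH (pred k))]]].
    + intros t; unfold P; cbv beta. rewrite (He_S j (t + de)). ring.
    + simpl Q. set (w := Q u v j k). set (w' := Q u v j (pred k)). clearbody g w w'.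
      destruct g, w, w'; unfold u, om; apply injective_projections; simpl; field.
    + apply cont_plus; apply cont_scal, cont_cross.
Qed.
End Cross.

Definition hermite_like (h : nat -> R -> R) (c : nat -> R) :=
  (forall j, 0 < c j) /\ (forall j t, h j t = c j * He j t * exp (- (PI * t ^ 2))).

(* The normalisation of h_0 and h_1 provides the zeroth and second Gaussian moments. *)
Lemma hermite_family_like h : is_hermite_family h -> exists c E1 E2,
  hermite_like h c /\ IR gw E1 /\ IR (fun t => t ^ 2 * gw t) E2.
Proof.
  intros [D [c [H0 [HS [Hc [Hh Hn]]]]]].
  assert (HD := hermite_D D H0 HS).
  assert (Eh : forall j t, h j t = c j * He j t * exp (- (PI * t ^ 2))).
  { intros j t. rewrite Hh, HD. unfold gw.
    replace (- (2 * PI * t ^ 2)) with (- (PI * t ^ 2) + - (PI * t ^ 2)) by ring.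
    rewrite exp_plus, (exp_Ropp (PI * t ^ 2)).
    assert (exp (PI * t ^ 2) <> 0) by (apply Rgt_not_eq, exp_pos). field; assumption. }
  assert (Eg : forall t, exp (- (PI * t ^ 2)) * exp (- (PI * t ^ 2)) = gw t).
  { intros t; unfold gw; rewrite <- exp_plus; f_equal; ring. }
  exists c, (/ (c 0%nat ^ 2) * 1), (/ (c 1%nat ^ 2 * (4 * PI) ^ 2) * 1).
  assert (P0 := PI_RGT_0). assert (c0 := Hc 0%nat). assert (c1 := Hc 1%nat).
  assert (C2 : cont (fun t => t ^ 2)).
  { apply (cont_ext (fun t => t * t)); [intros; ring | apply cont_mult; apply cont_id]. }
  split; [split; assumption|].
  assert (S0 : forall t, h 0%nat t ^ 2 = c 0%nat ^ 2 * gw t).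
  { intros t; rewrite Eh, <- Eg; simpl; ring. }
  assert (S1 : forall t, h 1%nat t ^ 2 = (c 1%nat ^ 2 * (4 * PI) ^ 2) * (t ^ 2 * gw t)).
  { intros t; rewrite Eh, <- Eg; simpl; ring. }
  split.
  - apply (IR_ext (fun t => / (c 0%nat ^ 2) * (c 0%nat ^ 2 * gw t))).
    { intros t; field; lra. }
    apply IR_scal; [apply cont_scal, cont_gw|].
    apply improper_IR; [apply cont_scal, cont_gw|].
    apply (improper_ext (fun t => h 0%nat t ^ 2)); [exact S0 | apply Hn].
  - assert (K : cont (fun t => (c 1%nat ^ 2 * (4 * PI) ^ 2) * (t ^ 2 * gw t))).
    { apply cont_scal, cont_mult; [exact C2 | apply cont_gw]. }
    apply (IR_ext (fun t => / (c 1%nat ^ 2 * (4 * PI) ^ 2) * ((c 1%nat ^ 2 * (4 * PI) ^ 2) * (t ^ 2 * gw t)))).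
    { intros t; field; lra. }
    apply IR_scal; [exact K|]. apply improper_IR; [exact K|].
    apply (improper_ext (fun t => h 1%nat t ^ 2)); [exact S1 | apply Hn].
Qed.

Definition sep (x w x' w' : R) := (x - x') ^ 2 + (w - w') ^ 2.

Section Gram.
Variables (h : nat -> R -> R) (c : nat -> R) (E1 E2 : R).
Hypotheses (Hh : hermite_like h c) (H1 : IR gw E1) (H2 : IR (fun t => t ^ 2 * gw t) E2).

Lemma cont_h k : cont (h k).
Proof.
  destruct Hh as [_ E]. apply (cont_ext (fun t => c k * He k t * exp (- (PI * t ^ 2)))); [intros; now rewrite E|].
  apply cont_mult; [apply cont_scal, cont_He|].
  apply (cont_derive _ (fun t => - (2 * PI * t) * exp (- (PI * t ^ 2)))).
  intros t; auto_derive; [trivial|]. simpl; ring.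
Qed.

(** The inner product of two shifted copies of h_k, with the phase measured from the midpoint of the
    shifts, as a function of the squared distance s. The argument sqrt(s/4) is the modulus |u| of
    [Q_diag]. *)
Definition gram (k : nat) (s : R) : C :=
  Cmult (RtoC (c k ^ 2 * E1 * exp (- (PI / 2 * s)))) (Q (sqrt (s / 4), 0) (- sqrt (s / 4), 0) k k).

(** Centring t at the midpoint of x and x' gives the situation of [FT_cross] with de = (x' - x)/2
    and nu = w - w'. The factors exp(-2π de²) and exp(-om²/(8π)) combine to exp(-(π/2) sep), and
    [Q_diag] leaves only the distance. *)
Lemma gram_FT k x w x' w' :
  let g t := h k (t - x) * h k (t - x') in
  let th t := 2 * PI * (w - w') * (t - (x + x') / 2) in
  IR (fun t => g t * cos (th t)) (Re (gram k (sep x w x' w'))) /\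
  IR (fun t => g t * sin (th t)) (Im (gram k (sep x w x' w'))).
Proof.
  intros g th. set (de := (x' - x) / 2). set (nu := w - w'). set (m := (x + x') / 2).
  set (om := 2 * PI * nu). assert (P0 := PI_RGT_0).
  destruct Hh as [_ E].
  assert (Eg : forall t, g t = (c k ^ 2 * exp (- (2 * PI * de ^ 2))) *
    (He k ((t + - m) + de) * He k ((t + - m) + - de) * gw (t + - m))).
  { intros t; unfold g. rewrite !E.
    replace (t + - m + de) with (t - x) by (unfold m, de; field).
    replace (t + - m + - de) with (t - x') by (unfold m, de; field).
    transitivity (c k ^ 2 * He k (t - x) * He k (t - x') * (exp (- (PI * (t - x) ^ 2)) * exp (- (PI * (t - x') ^ 2)))); [ring|].
    transitivity (c k ^ 2 * He k (t - x) * He k (t - x') * (exp (- (2 * PI * de ^ 2)) * gw (t + - m))); [|ring].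
    f_equal. unfold gw. rewrite <- !exp_plus. f_equal. unfold m, de. field. }
  destruct (FT_cross E1 E2 H1 H2 de nu k k) as [h1 h2].
  set (z := Cmult _ _) in h1, h2.
  assert (Ez : Cmult (RtoC (c k ^ 2 * exp (- (2 * PI * de ^ 2)))) z = gram k (sep x w x' w')).
  { unfold gram, z. rewrite Q_diag.
    assert (Es : de ^ 2 + (nu / 2) ^ 2 = sep x w x' w' / 4) by (unfold de, nu, sep; field).
    rewrite Es, Cmult_assoc, <- RtoC_mult. f_equal. f_equal.
    replace (c k ^ 2 * exp (- (2 * PI * de ^ 2)) * (E1 * exp (- ((2 * PI * nu) ^ 2 / (8 * PI))))) with
      (c k ^ 2 * E1 * (exp (- (2 * PI * de ^ 2)) * exp (- ((2 * PI * nu) ^ 2 / (8 * PI))))) by ring.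
    f_equal. rewrite <- exp_plus. f_equal.
    replace (PI / 2 * sep x w x' w') with (2 * PI * (sep x w x' w' / 4)) by field.
    rewrite <- Es. field. lra. }
  rewrite <- Ez. clearbody z.
  split.
  - replace (Re _) with (c k ^ 2 * exp (- (2 * PI * de ^ 2)) * Re z) by (destruct z; simpl; ring).
    apply (IR_ext (fun t => c k ^ 2 * exp (- (2 * PI * de ^ 2)) *
       (He k ((t + - m) + de) * He k ((t + - m) + - de) * gw (t + - m) * cos (om * (t + - m))))).
    { intros t. rewrite Eg. unfold th, om, nu, m.
      replace (2 * PI * (w - w') * (t - (x + x') / 2)) with (2 * PI * (w - w') * (t + - ((x + x') / 2))) by ring. ring. }
    apply IR_scal; [exact (cont_shift _ (- m) (cont_FTc om _ (cont_cross de k k)))|].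
    exact (IR_shift _ (- m) _ (cont_FTc om _ (cont_cross de k k)) h1).
  - replace (Im _) with (c k ^ 2 * exp (- (2 * PI * de ^ 2)) * Im z) by (destruct z; simpl; ring).
    apply (IR_ext (fun t => c k ^ 2 * exp (- (2 * PI * de ^ 2)) *
       (He k ((t + - m) + de) * He k ((t + - m) + - de) * gw (t + - m) * sin (om * (t + - m))))).
    { intros t. rewrite Eg. unfold th, om, nu, m.
      replace (2 * PI * (w - w') * (t - (x + x') / 2)) with (2 * PI * (w - w') * (t + - ((x + x') / 2))) by ring. ring. }
    apply IR_scal; [exact (cont_shift _ (- m) (cont_FTs om _ (cont_cross de k k)))|].
    exact (IR_shift _ (- m) _ (cont_FTs om _ (cont_cross de k k)) h2).
Qed.

End Gram.

Lemma sumR_ext {T} (f g : T -> R) l : (forall x, f x = g x) -> sumR (map f l) = sumR (map g l).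
Proof. intros E; now rewrite (map_ext _ _ E). Qed.

Lemma sumR_lin {T} (f g : T -> R) a b l :
  sumR (map (fun x => a * f x + b * g x) l) = a * sumR (map f l) + b * sumR (map g l).
Proof. induction l as [|x l IH]; simpl; [ring|]. unfold sumR in *; rewrite IH; ring. Qed.

Lemma sumR_mul {T} (f g : T -> R) l l' :
  sumR (map f l) * sumR (map g l') = sumR (map (fun p => sumR (map (fun q => f p * g q) l')) l).
Proof.
  induction l as [|x l IH]; simpl; [ring|]. unfold sumR in *. rewrite Rmult_plus_distr_r, IH. f_equal.
  clear IH. induction l' as [|y l' IH]; simpl; [ring|]. rewrite Rmult_plus_distr_l, IH. ring.
Qed.

Lemma cont_sumR {T} (f : T -> R -> R) l : (forall x, cont (f x)) -> cont (fun t => sumR (map (fun x => f x t) l)).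
Proof.
  intros H; induction l as [|x l IH]; simpl; [apply cont_const | apply cont_plus; [apply H | exact IH]].
Qed.

Lemma IR_sumR {T} (f : T -> R -> R) L l : (forall x, cont (f x)) -> (forall x, IR (f x) (L x)) ->
  IR (fun t => sumR (map (fun x => f x t) l)) (sumR (map L l)).
Proof.
  intros Hc H; induction l as [|x l IH]; simpl; [apply IR_0|].
  apply IR_plus; auto. apply (cont_sumR f l Hc).
Qed.

(** * Isometry invariance *)

Definition twist (th : R) (z : R * R) : R * R :=
  (fst z * cos th - snd z * sin th, fst z * sin th + snd z * cos th).

Lemma twist_add s t z : twist s (twist t z) = twist (s + t) z.
Proof. unfold twist; simpl; rewrite cos_plus, sin_plus; f_equal; ring. Qed.

Lemma twist_sq th z : fst (twist th z) ^ 2 + snd (twist th z) ^ 2 = fst z ^ 2 + snd z ^ 2.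
Proof. unfold twist; simpl. generalize (sin2_cos2 th); unfold Rsqr; intros E.
  transitivity ((fst z ^ 2 + snd z ^ 2) * (sin th * sin th + cos th * cos th)); [ring|rewrite E; ring].
Qed.

Definition dotp (z z' : R * R) := fst z * fst z' + snd z * snd z'.
Definition crossp (z z' : R * R) := snd z * fst z' - fst z * snd z'.

Lemma dotp_twist s s' z z' : dotp (twist s z) (twist s' z') =
  dotp z z' * cos (s - s') - crossp z z' * sin (s - s').
Proof. unfold dotp, crossp, twist; simpl. rewrite cos_minus, sin_minus. ring. Qed.

Section Energy.
Variables (n : nat) (h : nat -> R -> R) (c : nat -> R) (E1 E2 : R).
Hypotheses (Hh : hermite_like h c) (H1 : IR gw E1) (H2 : IR (fun t => t ^ 2 * gw t) E2).

(* With the coefficients ct_p = exp(i π w_p x_p) c_p, the squared norm only involves the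
   symplectic form S and the squared distances N of lattice points. *)
Definition energy (S N : Z * Z -> Z * Z -> R) idx (ct : Z * Z -> R * R) : R :=
  sumR (map (fun k => sumR (map (fun p => sumR (map (fun q =>
    dotp (twist (PI * S p q) (ct p)) (ct q) * Re (gram c E1 k (N p q))
    + - crossp (twist (PI * S p q) (ct p)) (ct q) * Im (gram c E1 k (N p q))) idx)) idx)) (seq 0 n)).

Lemma cont_gsum_sq a b cc d idx co : cont (gsum_sq n h a b cc d idx co).
Proof.
  unfold gsum_sq. apply (cont_sumR (fun k t => gsum_re h a b cc d idx co k t ^ 2 + gsum_im h a b cc d idx co k t ^ 2)).
  intros k.
  assert (S : forall f, cont f -> cont (fun t => f t ^ 2)).
  { intros f F; apply (cont_ext (fun t => f t * f t)); [intros; ring | now apply cont_mult]. }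
  assert (Ch : forall s, cont (fun t => h k (t - s))) by (intros s; apply (cont_shift _ (- s)), (cont_h h c Hh)).
  apply cont_plus; apply S; [unfold gsum_re|unfold gsum_im]; apply cont_sumR; intros p;
    apply cont_mult; try apply Ch.
  - apply (cont_ext (fun t => fst (co p) * cos (2 * PI * lat_w a b cc d p * t) + - snd (co p) * sin (2 * PI * lat_w a b cc d p * t))); [intros; ring|].
    apply cont_plus; apply cont_scal; [apply cont_cos | apply cont_sin].
  - apply cont_plus; apply cont_scal; [apply cont_sin | apply cont_cos].
Qed.

(** Expanding the square, the phase 2π(w_p - w_q)t is split at the midpoint of x_p and x_q. The
    constant left over, π(w_p - w_q)(x_p + x_q), is π(w_p x_p - w_q x_q), absorbed into the
    coefficients, plus π(w_p x_q - w_q x_p), the symplectic term. *)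
Lemma gsum_sq_energy a b cc d idx co :
  let X := lat_x a b cc d in let W := lat_w a b cc d in
  IR (gsum_sq n h a b cc d idx co)
   (energy (fun p q => W p * X q - W q * X p) (fun p q => sep (X p) (W p) (X q) (W q)) idx
     (fun p => twist (PI * (W p * X p)) (co p))).
Proof.
  intros X W.
  set (ct := fun p => twist (PI * (W p * X p)) (co p)).
  set (S := fun p q => W p * X q - W q * X p).
  set (F := fun k p q t => dotp (twist (PI * S p q) (ct p)) (ct q) *
       (h k (t - X p) * h k (t - X q) * cos (2 * PI * (W p - W q) * (t - (X p + X q) / 2))) +
       - crossp (twist (PI * S p q) (ct p)) (ct q) *
       (h k (t - X p) * h k (t - X q) * sin (2 * PI * (W p - W q) * (t - (X p + X q) / 2)))).
  assert (Ch : forall k s, cont (fun t => h k (t - s))) by (intros k s; apply (cont_shift _ (- s)), (cont_h h c Hh)).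
  assert (CC : forall k p q, cont (fun t => h k (t - X p) * h k (t - X q) * cos (2 * PI * (W p - W q) * (t - (X p + X q) / 2)))).
  { intros k p q. apply cont_mult; [apply cont_mult; apply Ch|].
    apply (cont_shift (fun t => cos (2 * PI * (W p - W q) * t)) (- ((X p + X q) / 2))), cont_cos. }
  assert (CS : forall k p q, cont (fun t => h k (t - X p) * h k (t - X q) * sin (2 * PI * (W p - W q) * (t - (X p + X q) / 2)))).
  { intros k p q. apply cont_mult; [apply cont_mult; apply Ch|].
    apply (cont_shift (fun t => sin (2 * PI * (W p - W q) * t)) (- ((X p + X q) / 2))), cont_sin. }
  assert (CF : forall k p q, cont (F k p q)) by (intros; apply cont_plus; apply cont_scal; auto).
  apply (IR_ext (fun t => sumR (map (fun k => sumR (map (fun p => sumR (map (fun q => F k p q t) idx)) idx)) (seq 0 n)))).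
  - intros t. unfold gsum_sq. apply sumR_ext; intros k.
    unfold gsum_re, gsum_im. simpl pow. rewrite !Rmult_1_r, !sumR_mul.
    rewrite <- (Rmult_1_l (sumR _)) at 1. symmetry.
    match goal with |- ?u + ?v = _ => rewrite <- (Rmult_1_l u), <- (Rmult_1_l v) end.
    rewrite <- sumR_lin, Rmult_1_l. apply sumR_ext; intros p.
    rewrite <- sumR_lin. apply sumR_ext; intros q.
    fold (W p) (W q) (X p) (X q). unfold F.
    transitivity (dotp (twist (2 * PI * W p * t) (co p)) (twist (2 * PI * W q * t) (co q)) * (h k (t - X p) * h k (t - X q))).
    + unfold dotp, twist; simpl; ring.
    + transitivity (dotp (twist (2 * PI * (W p - W q) * (t - (X p + X q) / 2)) (twist (PI * S p q) (ct p))) (ct q) * (h k (t - X p) * h k (t - X q))).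
      * f_equal. unfold ct. rewrite !twist_add, !dotp_twist. unfold S.
        f_equal; f_equal; f_equal; field.
      * replace (ct q) with (twist 0 (ct q)) at 1 by (unfold twist; rewrite cos_0, sin_0; destruct (ct q); simpl; f_equal; ring).
        rewrite dotp_twist, Rminus_0_r. ring.
  - unfold energy. apply IR_sumR; [intros k; apply cont_sumR; intros p; apply cont_sumR; intros q; apply CF|].
    intros k. apply IR_sumR; [intros p; apply cont_sumR; intros q; apply CF|].
    intros p. apply IR_sumR; [intros q; apply CF|]. intros q.
    destruct (gram_FT h c E1 E2 Hh H1 H2 k (X p) (W p) (X q) (W q)) as [g1 g2].
    unfold F.
    apply IR_lin; auto.
Qed.

Lemma energy_ext S S' N N' idx ct ct' : (forall p q, S p q = S' p q) -> (forall p q, N p q = N' p q) ->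
  (forall p, ct p = ct' p) -> energy S N idx ct = energy S' N' idx ct'.
Proof.
  intros e1 e2 e3. unfold energy. do 3 (apply sumR_ext; intro). now rewrite e1, e2, !e3.
Qed.

(** Multiplying each coefficient by a unimodular number makes the two families of [ct] equal. The
    energies then coincide and the sum of squared moduli is unchanged. *)
Lemma gabor_riesz_isometric a b cc d a' b' cc' d' :
  let X := lat_x a b cc d in let W := lat_w a b cc d in
  let X' := lat_x a' b' cc' d' in let W' := lat_w a' b' cc' d' in
  (forall p q, W p * X q - W q * X p = W' p * X' q - W' q * X' p) ->
  (forall p q, sep (X p) (W p) (X q) (W q) = sep (X' p) (W' p) (X' q) (W' q)) ->
  gabor_riesz n h a b cc d -> gabor_riesz n h a' b' cc' d'.
Proof.
  intros X W X' W' ES EN [A [B [A0 [B0 H]]]]. exists A, B; split; [assumption|]; split; [assumption|].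
  intros idx co ND.
  set (co1 := fun p => twist (PI * (W' p * X' p) - PI * (W p * X p)) (co p)).
  destruct (H idx co1 ND) as [L [HL bnd]]. exists L.
  assert (Eco : coef_sq idx co1 = coef_sq idx co).
  { unfold coef_sq. apply sumR_ext; intros p. apply twist_sq. }
  rewrite Eco in bnd. split; [|exact bnd].
  apply improper_IR in HL; [|apply cont_gsum_sq]. apply improper_IR; [apply cont_gsum_sq|].
  assert (e := gsum_sq_energy a b cc d idx co1). assert (e' := gsum_sq_energy a' b' cc' d' idx co).
  cbv zeta in e, e'.
  rewrite (IR_unique _ _ _ HL e).
  rewrite (energy_ext _ (fun p q => W' p * X' q - W' q * X' p) _ (fun p q => sep (X' p) (W' p) (X' q) (W' q)) _ _
    (fun p => twist (PI * (W' p * X' p)) (co p))); [exact e' | exact ES | exact EN |].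
  intros p. unfold co1. rewrite twist_add. f_equal. fold (W p) (X p). ring.
Qed.
End Energy.

(* Rotate the second generator onto the frequency axis. *)
Lemma lattice_reduce n h c E1 E2 a b cc d :
  hermite_like h c -> IR gw E1 -> IR (fun t => t ^ 2 * gw t) E2 -> a * d - b * cc <> 0 ->
  exists a' c' d', 0 < a' /\ d' <> 0 /\ a' * d' = a * d - b * cc /\
    (gabor_riesz n h a b cc d <-> gabor_riesz n h a' 0 c' d').
Proof.
  intros Hh H1 H2 HD. set (D := a * d - b * cc) in *.
  assert (r0 : 0 < b ^ 2 + d ^ 2).
  { destruct (Req_dec d 0) as [->|]; [|nra]. destruct (Req_dec b 0) as [->|]; [|nra].
    exfalso; apply HD; unfold D; ring. }
  (* Up to sign, d' is the length of the second generator; the sign is that of D, so that a' = D/d'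
     is positive. *)
  assert (Hd : exists d', d' * d' = b ^ 2 + d ^ 2 /\ 0 < D / d' /\ d' <> 0).
  { assert (s0 := sqrt_lt_R0 _ r0). assert (ss : sqrt (b ^ 2 + d ^ 2) * sqrt (b ^ 2 + d ^ 2) = b ^ 2 + d ^ 2) by (apply sqrt_sqrt; lra).
    destruct (Rlt_dec 0 D).
    - exists (sqrt (b ^ 2 + d ^ 2)); repeat split; [exact ss | apply Rdiv_lt_0_compat; lra | lra].
    - exists (- sqrt (b ^ 2 + d ^ 2)); repeat split; [lra | | lra].
      replace (D / - sqrt (b ^ 2 + d ^ 2)) with (- D / sqrt (b ^ 2 + d ^ 2)) by (field; lra).
      apply Rdiv_lt_0_compat; lra. }
  destruct Hd as [d' [e3 [a0 d0]]].
  (* c' is the component of the first generator along the second, a' the signed height over it. *)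
  set (a' := D / d') in *. set (c' := (a * b + cc * d) / d').
  assert (e1 : a' * d' = D) by (unfold a'; field; assumption).
  assert (e2 : c' * d' = a * b + cc * d) by (unfold c'; field; assumption).
  assert (e4 : a' * a' + c' * c' = a ^ 2 + cc ^ 2).
  { apply Rmult_eq_reg_r with (d' * d'); [|nra].
    transitivity ((a' * d') * (a' * d') + (c' * d') * (c' * d')); [ring|].
    rewrite e1, e2, e3; unfold D; ring. }
  exists a', c', d'; repeat split; try assumption.
  - apply (gabor_riesz_isometric n h c E1 E2 Hh H1 H2); intros p q; unfold lat_w, lat_x, sep.
    + transitivity (- D * (IZR (fst p) * IZR (snd q) - IZR (fst q) * IZR (snd p))); [unfold D; ring | rewrite <- e1; ring].
    + set (k := IZR (fst p) - IZR (fst q)). set (l := IZR (snd p) - IZR (snd q)).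
      transitivity ((a ^ 2 + cc ^ 2) * (k * k) + 2 * (a * b + cc * d) * (k * l) + (b ^ 2 + d ^ 2) * (l * l)); [unfold k, l; ring|].
      rewrite <- e2, <- e3, <- e4; unfold k, l; ring.
  - apply (gabor_riesz_isometric n h c E1 E2 Hh H1 H2); intros p q; unfold lat_w, lat_x, sep.
    + transitivity (- D * (IZR (fst p) * IZR (snd q) - IZR (fst q) * IZR (snd p))); [rewrite <- e1; ring | unfold D; ring].
    + set (k := IZR (fst p) - IZR (fst q)). set (l := IZR (snd p) - IZR (snd q)).
      transitivity ((a ^ 2 + cc ^ 2) * (k * k) + 2 * (a * b + cc * d) * (k * l) + (b ^ 2 + d ^ 2) * (l * l)); [|unfold k, l; ring].
      rewrite <- e2, <- e3, <- e4; unfold k, l; ring.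
Qed.

(** * Hermite functions and monomials times a Gaussian *)

(** Linear combinations up to pointwise equality. The inductive form lets estimates be proved by
    combining two functions at a time. *)
Inductive span (g : nat -> R -> R) (m : nat) : (R -> R) -> Prop :=
| span_gen j : (j < m)%nat -> span g m (g j)
| span_lin f1 f2 a b f : (forall t, f t = a * f1 t + b * f2 t) -> span g m f1 -> span g m f2 -> span g m f.

Lemma span_mono g m m' f : (m <= m')%nat -> span g m f -> span g m' f.
Proof.
  intros le H; induction H as [j Hj | f1 f2 a b f E _ IH1 _ IH2].
  - apply span_gen; lia.
  - exact (span_lin g m' f1 f2 a b f E IH1 IH2).
Qed.

Lemma span_mul_id g m f : (forall j, span g (S (S j)) (fun t => t * g j t)) ->
  span g m f -> span g (S m) (fun t => t * f t).
Proof.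
  intros G H; induction H as [j Hj | f1 f2 a b f E _ IH1 _ IH2].
  - apply (span_mono g (S (S j))); [lia | apply G].
  - apply (span_lin g _ _ _ a b _) with (2 := IH1) (3 := IH2). intros t; rewrite E; ring.
Qed.

Lemma gsum_lin h f1 f2 al be f k a b c d idx co t : (forall t, f t = al * f1 t + be * f2 t) ->
  h = (fun _ => f) ->
  gsum_re h a b c d idx co k t = al * gsum_re (fun _ => f1) a b c d idx co k t + be * gsum_re (fun _ => f2) a b c d idx co k t /\
  gsum_im h a b c d idx co k t = al * gsum_im (fun _ => f1) a b c d idx co k t + be * gsum_im (fun _ => f2) a b c d idx co k t.
Proof.
  intros E ->. split; unfold gsum_re, gsum_im; rewrite <- sumR_lin; apply sumR_ext; intros p; rewrite E; ring.
Qed.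

Lemma sumR_app l l' : sumR (l ++ l') = sumR l + sumR l'.
Proof. induction l as [|x l IH]; simpl; [ring|]. unfold sumR in *; rewrite IH; ring. Qed.

Lemma sumR_ge0 {T} (f : T -> R) l : (forall x, 0 <= f x) -> 0 <= sumR (map f l).
Proof. intros H; unfold sumR; induction l as [|x l IH]; simpl; [lra | generalize (H x); lra]. Qed.

Lemma sumR_le {T} (f g : T -> R) l : (forall x, f x <= g x) -> sumR (map f l) <= sumR (map g l).
Proof. intros H; unfold sumR; induction l as [|x l IH]; simpl; [lra | generalize (H x); lra]. Qed.

Lemma sumR_term {T} (f : T -> R) l x : (forall x, 0 <= f x) -> In x l -> f x <= sumR (map f l).
Proof.
  intros H; induction l as [|y l IH]; simpl; [tauto|]. intros [->|I].
  - generalize (sumR_ge0 f l H); unfold sumR; lra.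
  - generalize (H y) (IH I); unfold sumR; lra.
Qed.

Lemma gsum_sq_ge0 n h a b c d idx co t : 0 <= gsum_sq n h a b c d idx co t.
Proof. apply sumR_ge0; intros k. generalize (pow2_ge_0 (gsum_re h a b c d idx co k t)) (pow2_ge_0 (gsum_im h a b c d idx co k t)); lra. Qed.

(** The lattice sums are linear in the window and |αx + βy|² <= 2α²|x|² + 2β²|y|². The summand 1
    keeps the constant positive when α = β = 0. *)
Lemma span_bound n g f : span g n f -> exists B, 0 < B /\ forall a b c d idx co t,
  gsum_re (fun _ => f) a b c d idx co 0 t ^ 2 + gsum_im (fun _ => f) a b c d idx co 0 t ^ 2
    <= B * gsum_sq n g a b c d idx co t.
Proof.
  induction 1 as [j Hj | f1 f2 al be f E _ [B1 [P1 IH1]] _ [B2 [P2 IH2]]].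
  - exists 1; split; [lra|]; intros. rewrite Rmult_1_l. unfold gsum_sq.
    change (gsum_re (fun _ => g j) a b c d idx co 0 t) with (gsum_re g a b c d idx co j t).
    change (gsum_im (fun _ => g j) a b c d idx co 0 t) with (gsum_im g a b c d idx co j t).
    apply (sumR_term (fun k => gsum_re g a b c d idx co k t ^ 2 + gsum_im g a b c d idx co k t ^ 2)).
    + intros k. generalize (pow2_ge_0 (gsum_re g a b c d idx co k t)) (pow2_ge_0 (gsum_im g a b c d idx co k t)); lra.
    + apply in_seq; lia.
  - exists (2 * al ^ 2 * B1 + 2 * be ^ 2 * B2 + 1); split; [generalize (pow2_ge_0 al) (pow2_ge_0 be); nra|]; intros.
    destruct (gsum_lin _ f1 f2 al be f 0 a b c d idx co t E eq_refl) as [-> ->].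
    assert (i1 := IH1 a b c d idx co t). assert (i2 := IH2 a b c d idx co t).
    assert (g0 := gsum_sq_ge0 n g a b c d idx co t).
    set (G := gsum_sq n g a b c d idx co t) in *.
    set (x1 := gsum_re _ _ _ _ _ _ _ _ _) in *. set (x2 := gsum_re (fun _ => f2) _ _ _ _ _ _ _ _) in *.
    set (y1 := gsum_im _ _ _ _ _ _ _ _ _) in *. set (y2 := gsum_im (fun _ => f2) _ _ _ _ _ _ _ _) in *.
    apply Rle_trans with (2 * al ^ 2 * (x1 ^ 2 + y1 ^ 2) + 2 * be ^ 2 * (x2 ^ 2 + y2 ^ 2)).
    + apply Rminus_le_0. replace (_ - _) with ((al * x1 - be * x2) ^ 2 + (al * y1 - be * y2) ^ 2) by ring.
      generalize (pow2_ge_0 (al * x1 - be * x2)) (pow2_ge_0 (al * y1 - be * y2)); lra.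
    + assert (2 * al ^ 2 * (x1 ^ 2 + y1 ^ 2) <= 2 * al ^ 2 * (B1 * G)).
      { apply Rmult_le_compat_l; [generalize (pow2_ge_0 al); lra | exact i1]. }
      assert (2 * be ^ 2 * (x2 ^ 2 + y2 ^ 2) <= 2 * be ^ 2 * (B2 * G)).
      { apply Rmult_le_compat_l; [generalize (pow2_ge_0 be); lra | exact i2]. }
      lra.
Qed.

Lemma gsum_sq_span n g h : (forall k, (k < n)%nat -> span g n (h k)) -> exists B, 0 < B /\
  forall a b c d idx co t, gsum_sq n h a b c d idx co t <= B * gsum_sq n g a b c d idx co t.
Proof.
  intros H.
  assert (G : forall m, (m <= n)%nat -> exists B, 0 < B /\ forall a b c d idx co t,
    gsum_sq m h a b c d idx co t <= B * gsum_sq n g a b c d idx co t).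
  { induction m as [|m IH]; intros le.
    - exists 1; split; [lra|]; intros. generalize (gsum_sq_ge0 n g a b c d idx co t).
      unfold gsum_sq at 2; simpl; lra.
    - destruct (IH ltac:(lia)) as [B [B0 HB]]. destruct (span_bound n g _ (H m ltac:(lia))) as [B' [B0' HB']].
      exists (B + B'); split; [lra|]; intros. unfold gsum_sq at 1. rewrite seq_S, map_app, sumR_app.
      specialize (HB a b c d idx co t). specialize (HB' a b c d idx co t).
      unfold gsum_sq in HB at 1.
      change (gsum_re (fun _ => h m) a b c d idx co 0 t) with (gsum_re h a b c d idx co m t) in HB'.
      change (gsum_im (fun _ => h m) a b c d idx co 0 t) with (gsum_im h a b c d idx co m t) in HB'.
      unfold sumR in *. cbn [map fold_right Nat.add]. lra. }
  apply (G n); lia.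
Qed.

Definition psi (j : nat) (t : R) : R := t ^ j * exp (- (PI * t ^ 2)).

Lemma span_psi_mul j : span psi (S (S j)) (fun t => t * psi j t).
Proof.
  apply (span_lin _ _ (psi (S j)) (psi (S j)) 1 0); [intros t; unfold psi; simpl; ring | |]; apply span_gen; lia.
Qed.

Section Hermite.
Variables (h : nat -> R -> R) (c : nat -> R).
Hypothesis Hh : hermite_like h c.

Lemma span_h_mul j : span h (S (S j)) (fun t => t * h j t).
Proof.
  destruct Hh as [Hc E]. assert (P0 := PI_RGT_0).
  assert (c0 := Hc j); assert (c1 := Hc (S j)); assert (c2 := Hc (pred j)).
  (* The recursion solved for t He_j: t He_j = -He_(j+1)/(4π) - j He_(j-1). For j = 0 the default
     [pred 0] = 0 comes with coefficient 0. *)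
  apply (span_lin _ _ (h (S j)) (h (pred j)) (- (c j / (4 * PI * c (S j)))) (- (c j * INR j / c (pred j)))).
  - intros t; rewrite !E, He_S. field. lra.
  - apply span_gen; lia.
  - apply span_gen; lia.
Qed.

Lemma span_psi_h k : span h (S k) (psi k).
Proof.
  destruct Hh as [Hc E]. induction k as [|k IH].
  - apply (span_lin _ _ (h 0%nat) (h 0%nat) (/ c 0%nat) 0); try (apply span_gen; lia).
    intros t; rewrite E; unfold psi; simpl. assert (c0 := Hc 0%nat). field. lra.
  - assert (S1 := span_mul_id h _ _ span_h_mul IH).
    apply (span_lin _ _ _ _ 1 0) with (2 := S1) (3 := S1). intros t; unfold psi; simpl; ring.
Qed.

Lemma span_h_psi k : span psi (S k) (h k).
Proof.
  destruct Hh as [Hc E].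
  assert (G : span psi (S k) (fun t => He k t * exp (- (PI * t ^ 2))) /\
    span psi (S (pred k)) (fun t => He (pred k) t * exp (- (PI * t ^ 2)))).
  { induction k as [|k [IH1 IH2]].
    - assert (S0 : span psi 1 (fun t => He 0 t * exp (- (PI * t ^ 2)))).
      { apply (span_lin _ _ (psi 0) (psi 0) 1 0); try (apply span_gen; lia). intros t; unfold psi; simpl; ring. }
      split; exact S0.
    - split; [|exact IH1].
      apply (span_lin _ _ (fun t => t * (He k t * exp (- (PI * t ^ 2)))) (fun t => He (pred k) t * exp (- (PI * t ^ 2))) (- (4 * PI)) (- (4 * PI * INR k))).
      + intros t; rewrite He_S; ring.
      + apply span_mul_id; [apply span_psi_mul | exact IH1].
      + apply (span_mono _ (S (pred k))); [lia | exact IH2]. }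
  destruct G as [G _].
  apply (span_lin _ _ _ _ (c k) 0) with (2 := G) (3 := G). intros t; rewrite E; ring.
Qed.

Lemma gsum_sq_equiv n : exists al be, 0 < al /\ 0 < be /\ forall a b cc d idx co t,
  al * gsum_sq n psi a b cc d idx co t <= gsum_sq n h a b cc d idx co t /\
  gsum_sq n h a b cc d idx co t <= be * gsum_sq n psi a b cc d idx co t.
Proof.
  destruct (gsum_sq_span n psi h) as [be [b0 Hb]].
  { intros k Hk; apply (span_mono _ (S k)); [lia | apply span_h_psi]. }
  destruct (gsum_sq_span n h psi) as [al [a0 Ha]].
  { intros k Hk; apply (span_mono _ (S k)); [lia | apply span_psi_h]. }
  exists (/ al), be; split; [now apply Rinv_0_lt_compat|]; split; [assumption|]; intros; split; [|apply Hb].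
  apply (Rmult_le_reg_l al); [assumption|]. rewrite <- Rmult_assoc, Rinv_r, Rmult_1_l by lra. apply Ha.
Qed.
End Hermite.

(** * Periodisation *)

Lemma trig_periodZ x m : cos (x + 2 * PI * IZR m) = cos x /\ sin (x + 2 * PI * IZR m) = sin x.
Proof.
  assert (N : forall k y, cos (y + 2 * PI * INR k) = cos y /\ sin (y + 2 * PI * INR k) = sin y).
  { intros k y. replace (y + 2 * PI * INR k) with (y + 2 * INR k * PI) by ring.
    split; [apply cos_period | apply sin_period]. }
  destruct (Z_le_dec 0 m) as [p|p].
  - rewrite <- (Z2Nat.id m p), <- INR_IZR_INZ. apply N.
  - destruct (N (Z.to_nat (- m)) (x + 2 * PI * IZR m)) as [<- <-].
    rewrite INR_IZR_INZ, Z2Nat.id, opp_IZR by lia.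
    replace (x + 2 * PI * IZR m + 2 * PI * - IZR m) with x by ring. tauto.
Qed.

Lemma sumR_scal {T} (f : T -> R) a l : sumR (map (fun x => a * f x) l) = a * sumR (map f l).
Proof. unfold sumR; induction l as [|x l IH]; simpl; [ring | rewrite IH; ring]. Qed.

Lemma sumR_ext' {T} (f g : T -> R) l : (forall x, In x l -> f x = g x) -> sumR (map f l) = sumR (map g l).
Proof. intros H; f_equal; now apply map_ext_in. Qed.

Lemma RInt_sumR {T} (f : T -> R -> R) l a b : (forall x, cont (f x)) ->
  RInt (fun t => sumR (map (fun x => f x t) l)) a b = sumR (map (fun x => RInt (f x) a b) l).
Proof.
  intros C; induction l as [|x l IH]; simpl.
  - rewrite RInt_const. unfold scal; simpl; unfold mult; simpl; ring.
  - unfold sumR in *. rewrite (RInt_plus (f x)); [unfold plus; simpl; now rewrite IH | apply cont_ex, C|].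
    apply cont_ex, (cont_sumR f l C).
Qed.

Lemma RInt_shift f v a b : cont f -> RInt (fun t => f (t + v)) a b = RInt f (a + v) (b + v).
Proof.
  intros C. assert (E := RInt_comp_lin f 1 v a b (cont_ex _ _ _ C)).
  rewrite !Rmult_1_l in E; rewrite <- E; apply RInt_ext.
  intros; unfold scal; simpl; unfold mult; simpl; rewrite !Rmult_1_l; reflexivity.
Qed.

Lemma RInt_lin f g al be a b : cont f -> cont g ->
  RInt (fun t => al * f t + be * g t) a b = al * RInt f a b + be * RInt g a b.
Proof.
  intros Cf Cg. rewrite (RInt_plus (fun t => al * f t) (fun t => be * g t)) by (apply cont_ex, cont_scal; assumption).
  rewrite (RInt_scal f) by (apply cont_ex; assumption). rewrite (RInt_scal g) by (apply cont_ex; assumption).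
  reflexivity.
Qed.

Lemma RInt_mono f g a b : a <= b -> cont f -> cont g -> (forall t, a <= t <= b -> f t <= g t) ->
  RInt f a b <= RInt g a b.
Proof.
  intros ab Cf Cg H. apply RInt_le; [assumption | now apply cont_ex | now apply cont_ex | intros; apply H; lra].
Qed.

(** The half-open interval [-M, M) of integers: the corresponding 2M periods tile
    [s - M hh, s + M hh] exactly. *)
Definition zrange (M : nat) : list Z :=
  map Z.of_nat (seq 0 M) ++ map (fun i => Z.opp (Z.of_nat (S i))) (seq 0 M).

Lemma RInt_periods f s hh M : cont f ->
  RInt f (s - INR M * hh) (s + INR M * hh) =
  RInt (fun t => sumR (map (fun m => f (t + IZR m * hh)) (zrange M))) s (s + hh).
Proof.
  intros C. rewrite (RInt_sumR (fun m t => f (t + IZR m * hh))) by (intros; now apply cont_shift).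
  rewrite (sumR_ext _ (fun m => RInt f (s + IZR m * hh) (s + hh + IZR m * hh))) by (intros; now apply RInt_shift).
  unfold zrange; rewrite map_app, sumR_app, !map_map.  cbv beta.
  assert (U : sumR (map (fun i => RInt f (s + IZR (Z.of_nat i) * hh) (s + hh + IZR (Z.of_nat i) * hh)) (seq 0 M)) =
    RInt f s (s + INR M * hh)).
  { induction M as [|M IH].
    - simpl. replace (s + 0 * hh) with s by ring. now rewrite RInt_point.
    - rewrite seq_S, map_app, sumR_app, IH, <- (RInt_Chasles_cont f s (s + INR M * hh) (s + INR (S M) * hh) C).
      unfold sumR; cbn [map fold_right Nat.add]. rewrite <- INR_IZR_INZ, S_INR, Rplus_0_r.
      f_equal; f_equal; ring. }
  assert (V : sumR (map (fun i => RInt f (s + IZR (- Z.of_nat (S i)) * hh) (s + hh + IZR (- Z.of_nat (S i)) * hh)) (seq 0 M)) =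
    RInt f (s - INR M * hh) s).
  { clear U; induction M as [|M IH].
    - simpl. replace (s - 0 * hh) with s by ring. now rewrite RInt_point.
    - rewrite seq_S, map_app, sumR_app, IH, <- (RInt_Chasles_cont f (s - INR (S M) * hh) (s - INR M * hh) s C).
      unfold sumR; cbn [map fold_right Nat.add]. rewrite opp_IZR, <- INR_IZR_INZ, S_INR, Rplus_0_r, Rplus_comm.
      f_equal; f_equal; ring. }
  etransitivity; [|symmetry; exact (f_equal2 Rplus U V)]. symmetry. etransitivity; [apply Rplus_comm|]. apply RInt_Chasles_cont, C.
Qed.

(* With the constant window [one], [gsum_re] and [gsum_im] are the real and imaginary parts of a
   trigonometric polynomial in t. *)
Definition one : nat -> R -> R := fun _ _ => 1.
Definition row (k : Z) (idx : list (Z * Z)) := filter (fun p => Z.eqb (fst p) k) idx.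
Definition axis (ks : list Z) : list (Z * Z) := map (fun k => (k, 0%Z)) ks.

Lemma sumR_single (F : Z -> R) v x ks : NoDup ks -> In x ks ->
  sumR (map (fun k => (if Z.eqb x k then v else 0) + F k) ks) = v + sumR (map F ks).
Proof.
  induction ks as [|y ks IH]; [simpl; tauto|]. intros N I; inversion N as [|? ? Ny N']; subst.
  unfold sumR in *; simpl. destruct (Z.eqb_spec x y) as [->|ne].
  - assert (Z0 : fold_right Rplus 0 (map (fun k => (if Z.eqb y k then v else 0) + F k) ks) = fold_right Rplus 0 (map F ks)).
    { f_equal. apply map_ext_in. intros z Hz. destruct (Z.eqb_spec y z) as [->|]; [contradiction|ring]. }
    rewrite Z0; ring.
  - rewrite IH; [ring | assumption | destruct I; congruence].
Qed.

Lemma sumR_rows (f : Z * Z -> R) ks idx : NoDup ks -> (forall p, In p idx -> In (fst p) ks) ->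
  sumR (map (fun k => sumR (map f (row k idx))) ks) = sumR (map f idx).
Proof.
  intros N; induction idx as [|p idx IH]; intros H.
  - simpl. clear; induction ks; simpl; [reflexivity|]. unfold sumR in *; simpl; lra.
  - rewrite (sumR_ext _ (fun k => (if Z.eqb (fst p) k then f p else 0) + sumR (map f (row k idx)))).
    + rewrite sumR_single, IH; [reflexivity | | assumption | apply H; now left].
      intros q Hq; apply H; now right.
    + intros k; simpl. destruct (Z.eqb (fst p) k); unfold sumR; simpl; ring.
Qed.

(* The coefficient at (k, 0) of the k-th row: Σ_l c_{k,l} exp(2πi d l t). *)
Definition row_coef (d : R) idx co (t : R) (p : Z * Z) : R * R :=
  (gsum_re one 0 0 0 d (row (fst p) idx) co 0 t, gsum_im one 0 0 0 d (row (fst p) idx) co 0 t).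

(** The second generator lies on the frequency axis, so all points of a row share the translation
    ak, and the phase of (k, l) is that of (k, 0) times exp(2πi d l s). *)
Lemma gsum_row_coef g a c d idx co ks j s : NoDup ks -> (forall p, In p idx -> In (fst p) ks) ->
  gsum_re g a 0 c d idx co j s = gsum_re g a 0 c d (axis ks) (row_coef d idx co s) j s /\
  gsum_im g a 0 c d idx co j s = gsum_im g a 0 c d (axis ks) (row_coef d idx co s) j s.
Proof.
  intros N H. unfold gsum_re, gsum_im, axis. rewrite !map_map.
  rewrite <- 2!(sumR_rows _ ks idx N H). split; apply sumR_ext; intros k.
  - set (th := 2 * PI * lat_w a 0 c d (k, 0%Z) * s).
    transitivity (cos th * g j (s - lat_x a 0 c d (k, 0%Z)) * gsum_re one 0 0 0 d (row k idx) co 0 s +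
      (- (sin th * g j (s - lat_x a 0 c d (k, 0%Z)))) * gsum_im one 0 0 0 d (row k idx) co 0 s); [|simpl; ring].
    unfold gsum_re, gsum_im; rewrite <- sumR_lin. f_equal; apply map_ext_in; intros p Hp.
    apply filter_In in Hp; destruct Hp as [_ Hp]; apply Z.eqb_eq in Hp.
    unfold one, th, lat_w, lat_x; simpl; rewrite Hp.
    replace (2 * PI * (c * IZR k + d * IZR (snd p)) * s) with
      (2 * PI * (c * IZR k + d * 0) * s + 2 * PI * (0 * IZR k + d * IZR (snd p)) * s) by ring.
    rewrite cos_plus, sin_plus.
    replace (s - (a * IZR k + 0 * IZR (snd p))) with (s - (a * IZR k + 0 * 0)) by ring. ring.
  - set (th := 2 * PI * lat_w a 0 c d (k, 0%Z) * s).
    transitivity (sin th * g j (s - lat_x a 0 c d (k, 0%Z)) * gsum_re one 0 0 0 d (row k idx) co 0 s +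
      (cos th * g j (s - lat_x a 0 c d (k, 0%Z))) * gsum_im one 0 0 0 d (row k idx) co 0 s); [|simpl; ring].
    unfold gsum_re, gsum_im; rewrite <- sumR_lin. f_equal; apply map_ext_in; intros p Hp.
    apply filter_In in Hp; destruct Hp as [_ Hp]; apply Z.eqb_eq in Hp.
    unfold one, th, lat_w, lat_x; simpl; rewrite Hp.
    replace (2 * PI * (c * IZR k + d * IZR (snd p)) * s) with
      (2 * PI * (c * IZR k + d * 0) * s + 2 * PI * (0 * IZR k + d * IZR (snd p)) * s) by ring.
    rewrite cos_plus, sin_plus.
    replace (s - (a * IZR k + 0 * IZR (snd p))) with (s - (a * IZR k + 0 * 0)) by ring. ring.
Qed.

Lemma gsum_sq_row_coef n g a c d idx co ks s : NoDup ks -> (forall p, In p idx -> In (fst p) ks) ->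
  gsum_sq n g a 0 c d idx co s = gsum_sq n g a 0 c d (axis ks) (row_coef d idx co s) s.
Proof.
  intros N H; apply sumR_ext; intros j.
  destruct (gsum_row_coef g a c d idx co ks j s N H) as [-> ->]; reflexivity.
Qed.

Section Period.
Variable d : R.
Hypothesis d0 : d <> 0.
Let hh := / Rabs d.

Lemma period_pos : 0 < hh.
Proof. now apply Rinv_0_lt_compat, Rabs_pos_lt. Qed.

Lemma period_shift t l m : exists m', 2 * PI * (d * IZR l) * (t + IZR m * hh) = 2 * PI * (d * IZR l) * t + 2 * PI * IZR m'.
Proof.
  unfold hh, Rabs; destruct Rcase_abs.
  - exists (- (l * m))%Z. rewrite opp_IZR, mult_IZR. field; lra.
  - exists (l * m)%Z. rewrite mult_IZR. field; lra.
Qed.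

Lemma gsum_one_period idx co t m :
  gsum_re one 0 0 0 d idx co 0 (t + IZR m * hh) = gsum_re one 0 0 0 d idx co 0 t /\
  gsum_im one 0 0 0 d idx co 0 (t + IZR m * hh) = gsum_im one 0 0 0 d idx co 0 t.
Proof.
  unfold gsum_re, gsum_im, lat_w, one; split; apply sumR_ext; intros q.
  all: rewrite Rmult_0_l, Rplus_0_l; destruct (period_shift t (snd q) m) as [m' ->].
  all: destruct (trig_periodZ (2 * PI * (d * IZR (snd q)) * t) m') as [-> ->]; reflexivity.
Qed.

Lemma row_coef_period idx co t m : row_coef d idx co (t + IZR m * hh) = row_coef d idx co t.
Proof.
  unfold row_coef. extensionality p. destruct (gsum_one_period (row (fst p) idx) co t m) as [-> ->]; reflexivity.
Qed.

Lemma RInt_character l s : l <> 0%Z ->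
  RInt (fun t => cos (2 * PI * (d * IZR l) * t)) s (s + hh) = 0 /\
  RInt (fun t => sin (2 * PI * (d * IZR l) * t)) s (s + hh) = 0.
Proof.
  intros l0. set (w := 2 * PI * (d * IZR l)).
  assert (w0 : w <> 0).
  { unfold w. assert (IZR l <> 0) by now apply not_0_IZR. assert (PI <> 0) by (generalize PI_RGT_0; lra).
    intros e. apply Rmult_integral in e; destruct e as [e|e]; [lra|]. apply Rmult_integral in e; destruct e; contradiction. }
  destruct (period_shift s l 1) as [m Em]. fold w in Em. rewrite Rmult_1_l in Em.
  destruct (trig_periodZ (w * s) m) as [Ec Es]. rewrite <- Em in Ec, Es. split.
  - apply is_RInt_unique. replace 0 with (sin (w * (s + hh)) / w - sin (w * s) / w) by (rewrite Es; field; assumption).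
    apply (is_RInt_derive (fun t => sin (w * t) / w) (fun t => cos (w * t))); intros.
    + auto_derive; [trivial | field; assumption].
    + apply cont_cos.
  - apply is_RInt_unique. replace 0 with (- cos (w * (s + hh)) / w - - cos (w * s) / w) by (rewrite Ec; field; assumption).
    apply (is_RInt_derive (fun t => - cos (w * t) / w) (fun t => sin (w * t))); intros.
    + auto_derive; [trivial | field; assumption].
    + apply cont_sin.
Qed.

Lemma cont_gsum_one_re idx co : cont (gsum_re one 0 0 0 d idx co 0).
Proof.
  apply cont_sumR; intros p. apply cont_mult; [|exact (cont_const 1)].
  apply (cont_ext (fun t => fst (co p) * cos (2 * PI * lat_w 0 0 0 d p * t) + - snd (co p) * sin (2 * PI * lat_w 0 0 0 d p * t))); [intros; ring|].
  apply cont_plus; apply cont_scal; [apply cont_cos | apply cont_sin].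
Qed.
Lemma cont_gsum_one_im idx co : cont (gsum_im one 0 0 0 d idx co 0).
Proof.
  apply cont_sumR; intros p. apply cont_mult; [|exact (cont_const 1)].
  apply cont_plus; apply cont_scal; [apply cont_sin | apply cont_cos].
Qed.

Lemma cont_gsum_sq_one idx co : cont (gsum_sq 1 one 0 0 0 d idx co).
Proof.
  apply (cont_ext (fun t => gsum_re one 0 0 0 d idx co 0 t * gsum_re one 0 0 0 d idx co 0 t +
     gsum_im one 0 0 0 d idx co 0 t * gsum_im one 0 0 0 d idx co 0 t)).
  { intros t; unfold gsum_sq, sumR; simpl; ring. }
  apply cont_plus; apply cont_mult; try apply cont_gsum_one_re; apply cont_gsum_one_im.
Qed.

(** Parseval by induction: in |z + w|² = |z|² + 2<z, w> + |w|² the cross terms integrate to 0.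
    Within one row, distinct indices have distinct l, so each cross term is a nontrivial
    character. *)
Lemma gsum_one_orthogonality idx co k s : NoDup idx -> (forall p, In p idx -> fst p = k) ->
  RInt (gsum_sq 1 one 0 0 0 d idx co) s (s + hh) = hh * coef_sq idx co.
Proof.
  induction idx as [|p idx IH]; intros N H.
  - rewrite (RInt_ext _ (fun _ => 0)).
    + rewrite RInt_const. unfold scal, coef_sq; simpl; unfold mult; simpl. rewrite Rmult_0_r.
      unfold sumR; simpl; ring.
    + intros; unfold gsum_sq, gsum_re, gsum_im, sumR; simpl; ring.
  - inversion N as [|? ? Np N']; subst.
    set (th := fun q t => 2 * PI * lat_w 0 0 0 d q * t).
    set (F := fun q t => dotp (twist (th p t) (co p)) (twist (th q t) (co q))).
    assert (EF : forall q t, F q t = dotp (co p) (co q) * cos (2 * PI * (d * IZR (snd p - snd q)) * t)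
       + - crossp (co p) (co q) * sin (2 * PI * (d * IZR (snd p - snd q)) * t)).
    { intros q t; unfold F. rewrite dotp_twist.
      replace (th p t - th q t) with (2 * PI * (d * IZR (snd p - snd q)) * t); [ring|].
      unfold th, lat_w. rewrite minus_IZR; ring. }
    assert (CF : forall q, cont (F q)).
    { intros q. apply (cont_ext (fun t => dotp (co p) (co q) * cos (2 * PI * (d * IZR (snd p - snd q)) * t)
       + - crossp (co p) (co q) * sin (2 * PI * (d * IZR (snd p - snd q)) * t))); [intros; now rewrite EF|].
      apply cont_plus; apply cont_scal; [apply cont_cos | apply cont_sin]. }
    rewrite (RInt_ext _ (fun t => 1 * (2 * sumR (map (fun q => F q t) idx) + 1 * gsum_sq 1 one 0 0 0 d idx co t)
       + (fst (co p) ^ 2 + snd (co p) ^ 2) * 1)).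
    + rewrite RInt_lin, RInt_lin, RInt_sumR, IH, RInt_const; try assumption.
      * rewrite (sumR_ext' _ (fun _ => 0)).
        -- unfold scal; simpl; unfold mult; simpl.
           assert (Z0 : sumR (map (fun _ : Z * Z => 0) idx) = 0).
           { clear; unfold sumR; induction idx; simpl; [reflexivity | lra]. }
           rewrite Z0. unfold coef_sq, sumR; simpl. ring.
        -- intros q Hq. rewrite (RInt_ext _ _ _ _ (fun t _ => EF q t)).
           rewrite RInt_lin by (apply cont_cos || apply cont_sin).
           assert (ne : (snd p - snd q <> 0)%Z).
           { intros e. apply Np. replace p with q; [exact Hq|].
             apply injective_projections; [|lia]. rewrite (H p), (H q); [reflexivity | now right | now left]. }
           destruct (RInt_character _ s ne) as [-> ->]. ring.
      * intros q Hq; apply H; now right.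
      * apply cont_sumR, CF.
      * apply cont_gsum_sq_one.
      * apply cont_plus; apply cont_scal; [apply cont_sumR, CF | apply cont_gsum_sq_one].
      * apply cont_const.
    + intros t _.
      assert (D : sumR (map (fun q => F q t) idx) = fst (twist (th p t) (co p)) * gsum_re one 0 0 0 d idx co 0 t +
         snd (twist (th p t) (co p)) * gsum_im one 0 0 0 d idx co 0 t).
      { unfold gsum_re, gsum_im; rewrite <- sumR_lin; apply sumR_ext; intros q.
        unfold F, dotp; fold (th q t). simpl. unfold one; ring. }
      rewrite D, <- (twist_sq (th p t) (co p)).
      unfold gsum_sq, sumR. cbn [map fold_right seq].
      unfold gsum_re at 1, gsum_im at 1; cbn [map]. unfold sumR; cbn [fold_right].
      fold (gsum_re one 0 0 0 d idx co 0 t) (gsum_im one 0 0 0 d idx co 0 t).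
      change (2 * PI * lat_w 0 0 0 d p * t) with (th p t).
      unfold twist, one; simpl fst; simpl snd.
      unfold gsum_re, gsum_im, sumR, one. match goal with |- ?x = ?y => change (@eq R x y) end. ring.
Qed.

Lemma RInt_row_coef idx co ks s : NoDup ks -> NoDup idx -> (forall p, In p idx -> In (fst p) ks) ->
  cont (fun t => coef_sq (axis ks) (row_coef d idx co t)) /\
  RInt (fun t => coef_sq (axis ks) (row_coef d idx co t)) s (s + hh) = hh * coef_sq idx co.
Proof.
  intros N Ni H.
  assert (E : forall t, sumR (map (fun k => gsum_sq 1 one 0 0 0 d (row k idx) co t) ks) = coef_sq (axis ks) (row_coef d idx co t)).
  { intros t; unfold coef_sq, axis. rewrite map_map. apply sumR_ext; intros k.
    unfold gsum_sq, sumR; simpl; ring. }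
  split.
  - apply (cont_ext _ _ E). apply cont_sumR; intros; apply cont_gsum_sq_one.
  - rewrite <- (RInt_ext _ _ _ _ (fun t _ => E t)), RInt_sumR by (intros; apply cont_gsum_sq_one).
    rewrite (sumR_ext _ (fun k => hh * coef_sq (row k idx) co + 0 * 0)).
    + rewrite sumR_lin, Rmult_0_l, Rplus_0_r. f_equal.
      exact (sumR_rows (fun p => fst (co p) ^ 2 + snd (co p) ^ 2) ks idx N H).
    + intros k. rewrite (gsum_one_orthogonality _ co k); [ring | now apply NoDup_filter |].
      intros p Hp; apply filter_In in Hp; destruct Hp as [_ Hp]; now apply Z.eqb_eq in Hp.
Qed.
End Period.

(** * The Riesz property from fibre sums *)

Lemma IR_le f L s hh X : 0 < hh -> IR f L ->
  (forall M, RInt f (s - INR M * hh) (s + INR M * hh) <= X) -> L <= X.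
Proof.
  intros h0 H HX. apply Rnot_lt_le; intros N.
  destruct (H (L - X) ltac:(lra)) as [M HM].
  destruct (INR_unbounded ((Rabs M + Rabs s) / hh)) as [K HK].
  assert (k : Rabs M + Rabs s < INR K * hh).
  { apply (Rmult_lt_reg_r (/ hh)); [now apply Rinv_0_lt_compat|].
    rewrite Rmult_assoc, Rinv_r, Rmult_1_r by lra. exact HK. }
  assert (m1 := RRle_abs M). assert (m2 := RRle_abs s). assert (m3 := RRle_abs (- s)). rewrite Rabs_Ropp in m3.
  assert (e := HM (s - INR K * hh) (s + INR K * hh) ltac:(lra) ltac:(lra)).
  assert (e' := HX K). revert e; unfold Rabs; destruct Rcase_abs; lra.
Qed.

Section Sufficiency.
Variables (n : nat) (h : nat -> R -> R) (c : nat -> R) (E1 E2 : R) (a cc d : R).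
Hypotheses (Hh : hermite_like h c) (H1 : IR gw E1) (H2 : IR (fun t => t ^ 2 * gw t) E2) (d0 : d <> 0).
Let hh := / Rabs d.
Let S M (t : R) ks b := sumR (map (fun m => gsum_sq n psi a 0 cc d (axis ks) b (t + IZR m * hh)) (zrange M)).
Hypothesis Vlow : exists A, 0 < A /\ forall ks, NoDup ks -> exists M, forall t, Rabs t <= hh ->
  forall b, A * coef_sq (axis ks) b <= S M t ks b.
Hypothesis Vup : exists B, 0 < B /\ forall ks, NoDup ks -> forall t b M,
  S M t ks b <= B * coef_sq (axis ks) b.

(** Cutting the line into periods turns the norm into the integral of fibre sums over one period.
    The row coefficients are constant along a fibre, so the two hypotheses apply for each t, and
    Parseval ([RInt_row_coef]) evaluates the integral of Σ |b_k(t)|². *)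
Lemma riesz_of_fibers : gabor_riesz n h a 0 cc d.
Proof.
  destruct Vlow as [A [A0 HA]], Vup as [B [B0 HB]].
  destruct (gsum_sq_equiv h c Hh n) as [al [be [al0 [be0 EQ]]]].
  assert (h0 := period_pos d d0). fold hh in h0.
  exists (al * A * hh), (be * B * hh). split; [repeat apply Rmult_lt_0_compat; assumption|].
  split; [repeat apply Rmult_lt_0_compat; assumption|].
  intros idx co N.
  set (f := gsum_sq n h a 0 cc d idx co).
  assert (Cf : cont f) by (apply (cont_gsum_sq n h c Hh)).
  assert (e := gsum_sq_energy n h c E1 E2 Hh H1 H2 a 0 cc d idx co). cbv zeta in e.
  eexists; split; [apply improper_IR; [exact Cf | exact e]|].
  set (L := energy _ _ _ _ _ _ _) in *. clearbody L. fold f in e.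
  set (ks := nodup Z.eq_dec (map fst idx)).
  assert (Nk : NoDup ks) by apply NoDup_nodup.
  assert (Ik : forall p, In p idx -> In (fst p) ks).
  { intros p Hp. apply nodup_In. now apply in_map. }
  set (bt := fun t => row_coef d idx co t).
  assert (F : forall M t, al * S M t ks (bt t) <= sumR (map (fun m => f (t + IZR m * hh)) (zrange M)) /\
     sumR (map (fun m => f (t + IZR m * hh)) (zrange M)) <= be * S M t ks (bt t)).
  { intros M t. unfold S.
    assert (q : forall m, gsum_sq n psi a 0 cc d (axis ks) (bt t) (t + IZR m * hh) = gsum_sq n psi a 0 cc d idx co (t + IZR m * hh)).
    { intros m. rewrite (gsum_sq_row_coef n psi a cc d idx co ks _ Nk Ik). unfold bt, hh.
      now rewrite (row_coef_period d). }
    rewrite <- !sumR_scal. split; apply sumR_le; intros m; rewrite q; apply EQ. }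
  destruct (RInt_row_coef d d0 idx co ks 0 Nk N Ik) as [Cb Ib]. fold hh in Ib.
  assert (CS : forall M, cont (fun t => sumR (map (fun m => f (t + IZR m * hh)) (zrange M)))).
  { intros M. apply (cont_sumR (fun m t => f (t + IZR m * hh))). intros; now apply cont_shift. }
  split.
  (* The integrand being nonnegative, the integral over a bounded interval is already a lower bound
     for L; M may therefore depend on the rows. *)
  - destruct (HA ks Nk) as [M HM].
    apply Rle_trans with (RInt f (0 - INR M * hh) (0 + INR M * hh)).
    + rewrite RInt_periods by assumption.
      replace (al * A * hh * coef_sq idx co) with (al * A * (hh * coef_sq idx co) + 0 * (hh * coef_sq idx co)) by ring.
      rewrite <- Ib, <- RInt_lin by assumption.
      apply RInt_mono; [lra | apply cont_plus; apply cont_scal; assumption | apply CS |].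
      intros t Ht. destruct (F M t) as [F1 _].
      assert (b := HM t ltac:(rewrite Rabs_right; lra) (bt t)).
      apply (Rmult_le_compat_l al) in b; [|lra]. unfold bt in *. lra.
    + apply IR_mono; [assumption | intros; apply gsum_sq_ge0 | assumption |].
      assert (0 <= INR M * hh) by (apply Rmult_le_pos; [apply pos_INR | lra]). lra.
  - apply (IR_le f L 0 hh); [assumption | assumption|]. intros M. rewrite RInt_periods by assumption.
    replace (be * B * hh * coef_sq idx co) with (be * B * (hh * coef_sq idx co) + 0 * (hh * coef_sq idx co)) by ring.
    rewrite <- Ib, <- RInt_lin by assumption.
    apply RInt_mono; [lra | apply CS | apply cont_plus; apply cont_scal; assumption |].
    intros t Ht. destruct (F M t) as [_ F2].
    assert (b := HB ks Nk t (bt t) M).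
    apply (Rmult_le_compat_l be) in b; [|lra]. unfold bt in *. lra.
Qed.
End Sufficiency.

(** * Failure of the lower bound at a single fibre *)

(** Decay of f and of f' at rate exp(-|t|), preserved by sums and by [mild] factors. The decay of f'
    makes increments summable along a fibre. *)
Definition tame (f : R -> R) := exists df C, 0 <= C /\ forall t,
  is_derive f t (df t) /\ Rabs (f t) <= C * exp (- Rabs t) /\ Rabs (df t) <= C * exp (- Rabs t).

Definition mild (f : R -> R) := exists df C, 0 <= C /\ forall t,
  is_derive f t (df t) /\ Rabs (f t) <= C /\ Rabs (df t) <= C.

Lemma tame_ext f g : (forall t, f t = g t) -> tame f -> tame g.
Proof.
  intros E [df [C [C0 H]]]; exists df, C; split; [assumption|]; intros t; rewrite <- E.
  destruct (H t) as [d1 d2]; split; [apply (is_derive_extR f); assumption | assumption].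
Qed.

Lemma tame_mild f : tame f -> mild f.
Proof.
  intros [df [C [C0 H]]]; exists df, C; split; [assumption|]; intros t; destruct (H t) as [d1 [d2 d3]].
  assert (exp (- Rabs t) <= 1) by (rewrite <- exp_0; apply exp_mono; generalize (Rabs_pos t); lra).
  split; [assumption|]; split; nra.
Qed.

Lemma tame_plus f g : tame f -> tame g -> tame (fun t => f t + g t).
Proof.
  intros [df [C [C0 H]]] [dg [C' [C0' H']]]; exists (fun t => df t + dg t), (C + C'); split; [lra|]; intros t.
  destruct (H t) as [d1 [d2 d3]], (H' t) as [d1' [d2' d3']].
  split; [now apply is_derive_plusR|].
  split; (eapply Rle_trans; [apply Rabs_triang | lra]).
Qed.

Lemma tame_mult f g : mild f -> tame g -> tame (fun t => f t * g t).
Proof.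
  intros [df [C [C0 H]]] [dg [C' [C0' H']]]; exists (fun t => df t * g t + f t * dg t), (2 * (C * C')); split; [nra|]; intros t.
  destruct (H t) as [d1 [d2 d3]], (H' t) as [d1' [d2' d3']].
  assert (P : forall x y, Rabs x <= C -> Rabs y <= C' * exp (- Rabs t) -> Rabs (x * y) <= C * C' * exp (- Rabs t)).
  { intros x y hx hy. rewrite Rabs_mult, Rmult_assoc. apply Rmult_le_compat; auto using Rabs_pos. }
  split; [now apply is_derive_multR|].
  assert (p1 := P _ _ d2 d2'). assert (p2 := P _ _ d3 d2'). assert (p3 := P _ _ d2 d3').
  split; [generalize (Rabs_pos (f t * g t)); lra|].
  eapply Rle_trans; [apply Rabs_triang | lra].
Qed.

Lemma mild_trig al be w : mild (fun t => al * cos (w * t) + be * sin (w * t)).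
Proof.
  exists (fun t => al * - (w * sin (w * t)) + be * (w * cos (w * t))), ((Rabs al + Rabs be) * (1 + Rabs w)).
  assert (p := Rabs_pos al); assert (q := Rabs_pos be); assert (r := Rabs_pos w).
  split; [nra|]; intros t. split; [auto_derive; [trivial | ring]|].
  assert (c1 : Rabs (cos (w * t)) <= 1) by apply Rabs_le, COS_bound.
  assert (s1 : Rabs (sin (w * t)) <= 1) by apply Rabs_le, SIN_bound.
  split; (eapply Rle_trans; [apply Rabs_triang|]); rewrite ?Rabs_mult, ?Rabs_Ropp, ?Rabs_mult.
  - assert (Rabs al * Rabs (cos (w * t)) <= Rabs al * 1) by (apply Rmult_le_compat_l; lra).
    assert (Rabs be * Rabs (sin (w * t)) <= Rabs be * 1) by (apply Rmult_le_compat_l; lra). nra.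
  - assert (Rabs w * Rabs (sin (w * t)) <= Rabs w * 1) by (apply Rmult_le_compat_l; lra).
    assert (Rabs w * Rabs (cos (w * t)) <= Rabs w * 1) by (apply Rmult_le_compat_l; lra). nra.
Qed.

Lemma exp_growth_pow j : exp_growth (fun t => t ^ j).
Proof. induction j as [|j IH]; simpl; [apply exp_growth_const | apply exp_growth_mult; [apply exp_growth_id | exact IH]]. Qed.

Lemma psi_decay j : exists C, 0 <= C /\ forall t, Rabs (psi j t) <= C * exp (- Rabs t).
Proof.
  destruct (exp_growth_pow j) as [C [k [C0 [k0 H]]]]. destruct (gauss_exp_decay PI k PI_RGT_0) as [C' [C0' H']].
  exists (C * C'); split; [nra|]; intros t. unfold psi.
  rewrite Rabs_mult, (Rabs_right (exp _)) by (left; apply exp_pos).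
  apply Rle_trans with (C * (exp (- (PI * t ^ 2)) * exp (k * Rabs t))).
  - generalize (H t) (exp_pos (- (PI * t ^ 2))); nra.
  - rewrite Rmult_assoc. apply Rmult_le_compat_l; [assumption | apply H'].
Qed.

Lemma tame_psi j x : tame (fun t => psi j (t - x)).
Proof.
  destruct (psi_decay j) as [C [C0 H]], (psi_decay (pred j)) as [C1 [C10 H1]], (psi_decay (S j)) as [C2 [C20 H2]].
  assert (P0 := PI_RGT_0). assert (j0 := pos_INR j).
  assert (E : forall t, exp (- Rabs (t - x)) <= exp (Rabs x) * exp (- Rabs t)).
  { intros t; rewrite <- exp_plus; apply exp_mono. generalize (Rabs_triang (t - x) x).
    replace (t - x + x) with t by ring. lra. }
  (* psi_j' = j psi_(j-1) - 2π psi_(j+1), where j = 0 makes the default [pred 0] harmless. The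
     factor exp|x| is the cost of translating exp(-|t|). *)
  exists (fun t => INR j * psi (pred j) (t - x) + - (2 * PI) * psi (S j) (t - x)),
    ((C + INR j * C1 + 2 * PI * C2) * exp (Rabs x)).
  assert (e0 := exp_pos (Rabs x)).
  assert (q1 : 0 <= INR j * C1) by nra. assert (q2 : 0 <= 2 * PI * C2) by nra.
  split; [nra|]; intros t. split; [|split].
  - unfold psi. auto_derive; [trivial|]. destruct j as [|j]; simpl pred; simpl pow; unfold Rminus; ring.
  - eapply Rle_trans; [apply H|]. generalize (E t) (exp_pos (- Rabs (t - x))) (exp_pos (- Rabs t)); intros.
    assert (0 <= exp (Rabs x) * exp (- Rabs t)) by nra.
    apply Rle_trans with (C * (exp (Rabs x) * exp (- Rabs t))); [nra|]. nra.
  - eapply Rle_trans; [apply Rabs_triang|]. rewrite !Rabs_mult, Rabs_Ropp, (Rabs_right (INR j)), (Rabs_right (2 * _)) by lra.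
    assert (0 <= exp (Rabs x) * exp (- Rabs t)) by (generalize (exp_pos (- Rabs t)); nra).
    assert (i1 : INR j * Rabs (psi (pred j) (t - x)) <= INR j * (C1 * (exp (Rabs x) * exp (- Rabs t)))).
    { apply Rmult_le_compat_l; [assumption|]. eapply Rle_trans; [apply H1|]. apply Rmult_le_compat_l; [assumption | apply E]. }
    assert (i2 : 2 * PI * Rabs (psi (S j) (t - x)) <= 2 * PI * (C2 * (exp (Rabs x) * exp (- Rabs t)))).
    { apply Rmult_le_compat_l; [lra|]. eapply Rle_trans; [apply H2|]. apply Rmult_le_compat_l; [assumption | apply E]. }
    nra.
Qed.

Lemma tame_sumR {T} (f : T -> R -> R) l : (forall x, tame (f x)) -> tame (fun t => sumR (map (fun x => f x t) l)).
Proof.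
  intros H; induction l as [|x l IH]; unfold sumR; simpl; [|now apply tame_plus].
  exists (fun _ => 0), 0; split; [lra|]; intros t; split; [apply (is_derive_const 0)|]. rewrite Rabs_R0; lra.
Qed.

Lemma tame_gsum_sq n a b c d idx co : tame (gsum_sq n psi a b c d idx co).
Proof.
  apply (tame_sumR (fun k t => gsum_re psi a b c d idx co k t ^ 2 + gsum_im psi a b c d idx co k t ^ 2)); intros k.
  assert (Sq : forall f, tame f -> tame (fun t => f t ^ 2)).
  { intros f Hf. apply (tame_ext (fun t => f t * f t)); [intros; ring|].
    apply tame_mult; [now apply tame_mild | assumption]. }
  apply tame_plus; apply Sq; apply tame_sumR; intros p.
  - apply tame_mult; [|apply tame_psi].
    destruct (mild_trig (fst (co p)) (- snd (co p)) (2 * PI * lat_w a b c d p)) as [df [C [C0 H]]].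
    exists df, C; split; [assumption|]; intros t; destruct (H t) as [q1 [q2 q3]].
    assert (E : forall t, fst (co p) * cos (2 * PI * lat_w a b c d p * t) + - snd (co p) * sin (2 * PI * lat_w a b c d p * t)
      = fst (co p) * cos (2 * PI * lat_w a b c d p * t) - snd (co p) * sin (2 * PI * lat_w a b c d p * t)) by (intros; ring).
    rewrite <- E. split; [exact (is_derive_extR _ _ _ _ E q1) | now split].
  - apply tame_mult; [|apply tame_psi].
    destruct (mild_trig (snd (co p)) (fst (co p)) (2 * PI * lat_w a b c d p)) as [df [C [C0 H]]].
    exists df, C; split; [assumption|]; intros t; destruct (H t) as [q1 [q2 q3]].
    assert (E : forall t, snd (co p) * cos (2 * PI * lat_w a b c d p * t) + fst (co p) * sin (2 * PI * lat_w a b c d p * t)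
      = fst (co p) * sin (2 * PI * lat_w a b c d p * t) + snd (co p) * cos (2 * PI * lat_w a b c d p * t)) by (intros; ring).
    rewrite <- E. split; [exact (is_derive_extR _ _ _ _ E q1) | now split].
Qed.

(* Gives uniform continuity at t0 of the fibre sums, the increments being summable over the
   fibre. *)
Lemma tame_increment f r : tame f -> exists C, 0 <= C /\ forall t u, Rabs u <= r ->
  f (t + u) <= f t + Rabs u * (C * exp (- Rabs t)).
Proof.
  intros [df [C [C0 H]]]. exists (C * exp r); split; [generalize (exp_pos r); nra|]; intros t u Hu.
  destruct (MVT_gen f t (t + u) df) as [x [Hx E]].
  - intros; apply H.
  - intros; apply derivable_continuous_pt. exists (df x). apply is_derive_Reals, H.
  - assert (Dx : - Rabs x <= r + - Rabs t).
    { assert (Rabs (t - x) <= Rabs u).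
      { revert Hx; unfold Rmin, Rmax; destruct Rle_dec; unfold Rabs; repeat destruct Rcase_abs; lra. }
      generalize (Rabs_triang (t - x) x). replace (t - x + x) with t by ring. lra. }
    apply exp_mono in Dx; rewrite exp_plus in Dx. destruct (H x) as [_ [_ b]].
    replace (t + u - t) with u in E by ring.
    assert (Rabs (df x * u) <= Rabs u * (C * exp r * exp (- Rabs t))).
    { rewrite Rabs_mult, Rmult_comm. apply Rmult_le_compat_l; [apply Rabs_pos|].
      eapply Rle_trans; [exact b|]. rewrite Rmult_assoc. now apply Rmult_le_compat_l. }
    generalize (RRle_abs (df x * u)); lra.
Qed.

(** With y = x/2, sin x = 2 sin y cos y and sin y = y cos z for some z between 0 and y; both cosines
    are at least cos(π/4), whose square is 1/2. *)
Lemma half_le_sin x : 0 <= x <= PI / 2 -> x / 2 <= sin x.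
Proof.
  intros Hx. assert (P0 := PI_RGT_0). set (y := x / 2).
  destruct (MVT_gen sin 0 y cos) as [z [Hz E]].
  - intros; auto_derive; [trivial | ring].
  - intros; apply continuity_sin.
  - rewrite sin_0, !Rminus_0_r in E.
    assert (Hz' : 0 <= z <= PI / 4).
    { revert Hz; unfold Rmin, Rmax, y; destruct Rle_dec; lra. }
    assert (c4 : forall w, 0 <= w <= PI / 4 -> cos (PI / 4) <= cos w).
    { intros w Hw. apply cos_decr_1; lra. }
    assert (c1 := c4 z Hz'). assert (c2 := c4 y ltac:(unfold y; lra)).
    assert (q : cos (PI / 4) * cos (PI / 4) = / 2).
    { rewrite cos_PI4. unfold Rdiv. rewrite !Rmult_1_l, <- Rinv_mult, sqrt_sqrt by lra. reflexivity. }
    assert (q0 : 0 < cos (PI / 4)) by (apply cos_gt_0; lra).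
    replace x with (2 * y) by (unfold y; field). rewrite sin_2a, E.
    assert (y0 : 0 <= y) by (unfold y; lra).
    assert (cos (PI / 4) * cos (PI / 4) <= cos z * cos y) by (apply Rmult_le_compat; lra).
    assert (y * / 2 <= y * (cos z * cos y)) by (apply Rmult_le_compat_l; lra). lra.
Qed.

Lemma one_minus_cos_ge th : Rabs th <= PI -> th ^ 2 / 4 <= 2 - 2 * cos th.
Proof.
  intros H. assert (b := half_le_sin (Rabs th / 2) ltac:(generalize (Rabs_pos th); lra)).
  assert (E : cos th = cos (2 * (Rabs th / 2))).
  { replace (2 * (Rabs th / 2)) with (Rabs th) by field. unfold Rabs; destruct Rcase_abs; [now rewrite cos_neg | reflexivity]. }
  rewrite E, cos_2a_sin, <- (pow2_abs th). generalize (Rabs_pos th); nra.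
Qed.

(** Telescoping: (1 - e^(iθ)) Σ e^(ijθ) = 1 - e^(iNθ) has modulus at most 2, and |1 - e^(iθ)|² = 2 -
    2 cos θ. *)
Lemma dirichlet N th :
  let C := sumR (map (fun i => cos (INR i * th)) (seq 0 N)) in
  let S := sumR (map (fun i => sin (INR i * th)) (seq 0 N)) in
  (C ^ 2 + S ^ 2) * (2 - 2 * cos th) <= 4.
Proof.
  assert (G : let C := sumR (map (fun i => cos (INR i * th)) (seq 0 N)) in
    let S := sumR (map (fun i => sin (INR i * th)) (seq 0 N)) in
    C - (cos th * C - sin th * S) = 1 - cos (INR N * th) /\
    S - (sin th * C + cos th * S) = - sin (INR N * th)).
  { induction N as [|N [IH1 IH2]]; cbv zeta.
    - unfold sumR; simpl. rewrite Rmult_0_l, cos_0, sin_0. split; ring.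
    - rewrite seq_S, !map_app, !sumR_app. cbv zeta in *. rewrite S_INR, Rmult_plus_distr_r, Rmult_1_l, cos_plus, sin_plus.
      unfold sumR in *; cbn [map fold_right Nat.add]. split; lra. }
  cbv zeta in *. destruct G as [G1 G2]. revert G1 G2; set (C := sumR _); set (S := sumR (map (fun i => sin _) _)); intros G1 G2.
  assert (sc := sin2_cos2 th). unfold Rsqr in sc.
  assert (E : (C ^ 2 + S ^ 2) * (2 - 2 * cos th) = (C - (cos th * C - sin th * S)) ^ 2 + (S - (sin th * C + cos th * S)) ^ 2).
  { transitivity ((C ^ 2 + S ^ 2) * (1 - 2 * cos th + (sin th * sin th + cos th * cos th))); [rewrite sc; ring | ring]. }
  rewrite E, G1, G2. assert (scN := sin2_cos2 (INR N * th)). unfold Rsqr in scN.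
  assert (bN := COS_bound (INR N * th)). nra.
Qed.

Lemma sumR_list_prod (F : Z * Z -> R) ks ls :
  sumR (map F (list_prod ks ls)) = sumR (map (fun k => sumR (map (fun l => F (k, l)) ls)) ks).
Proof.
  induction ks as [|k ks IH]; [reflexivity|]. simpl. rewrite map_app, sumR_app, IH, map_map. reflexivity.
Qed.

Section Necessity.
Variables (n : nat) (h : nat -> R -> R) (c : nat -> R) (a cc d : R).
Hypotheses (Hh : hermite_like h c) (d0 : d <> 0).
Let hh := / Rabs d.

(* Modulating each row by exp(-2πi d l t0) factors the sum as a Dirichlet kernel centred at t0
   times the sum over [axis ks]. *)
Definition shift_coef (b : Z * Z -> R * R) (t0 : R) (p : Z * Z) : R * R :=
  twist (- (2 * PI * (d * IZR (snd p)) * t0)) (b (fst p, 0%Z)).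
Definition comb (N : nat) : list Z := map Z.of_nat (seq 0 N).
(* The squared modulus of the Dirichlet kernel Σ_{l<N} exp(2πi d l (t - t0)). *)
Definition kernel_sq (N : nat) (t0 t : R) : R :=
  gsum_sq 1 one 0 0 0 d (list_prod (0%Z :: nil) (comb N)) (shift_coef (fun _ => (1, 0)) t0) t.

Lemma gsum_sq_comb g ks N b t0 t :
  gsum_sq n g a 0 cc d (list_prod ks (comb N)) (shift_coef b t0) t =
  kernel_sq N t0 t * gsum_sq n g a 0 cc d (axis ks) b t.
Proof.
  set (Y := fun l => 2 * PI * (d * IZR l) * (t - t0)).
  set (Dr := sumR (map (fun l => cos (Y l)) (comb N))). set (Di := sumR (map (fun l => sin (Y l)) (comb N))).
  assert (K : kernel_sq N t0 t = Dr ^ 2 + Di ^ 2).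
  { unfold kernel_sq, gsum_sq. unfold sumR at 1. cbn [map fold_right seq]. rewrite Rplus_0_r.
    unfold gsum_re, gsum_im. rewrite !sumR_list_prod. cbn [map]. unfold sumR at 1 3. cbn [fold_right]. rewrite !Rplus_0_r.
    unfold Dr, Di. f_equal; f_equal; apply sumR_ext; intros l; unfold shift_coef, twist, lat_w, one, Y; cbn [fst snd].
    - replace (2 * PI * (d * IZR l) * (t - t0)) with (2 * PI * (0 * 0 + d * IZR l) * t + - (2 * PI * (d * IZR l) * t0)) by ring.
      rewrite cos_plus; ring.
    - replace (2 * PI * (d * IZR l) * (t - t0)) with (2 * PI * (0 * 0 + d * IZR l) * t + - (2 * PI * (d * IZR l) * t0)) by ring.
      rewrite sin_plus; ring. }
  rewrite K. unfold gsum_sq. rewrite <- sumR_scal. apply sumR_ext; intros j.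
  assert (G : gsum_re g a 0 cc d (list_prod ks (comb N)) (shift_coef b t0) j t =
      Dr * gsum_re g a 0 cc d (axis ks) b j t + - Di * gsum_im g a 0 cc d (axis ks) b j t /\
    gsum_im g a 0 cc d (list_prod ks (comb N)) (shift_coef b t0) j t =
      Di * gsum_re g a 0 cc d (axis ks) b j t + Dr * gsum_im g a 0 cc d (axis ks) b j t).
  { unfold gsum_re, gsum_im, axis. rewrite !sumR_list_prod, !map_map, <- !sumR_lin.
    split; apply sumR_ext; intros k; cbv zeta.
    all: set (P := fst (b (k, 0%Z)) * cos (2 * PI * lat_w a 0 cc d (k, 0%Z) * t) - snd (b (k, 0%Z)) * sin (2 * PI * lat_w a 0 cc d (k, 0%Z) * t)).
    all: set (Q := fst (b (k, 0%Z)) * sin (2 * PI * lat_w a 0 cc d (k, 0%Z) * t) + snd (b (k, 0%Z)) * cos (2 * PI * lat_w a 0 cc d (k, 0%Z) * t)).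
    all: set (v := g j (t - lat_x a 0 cc d (k, 0%Z))).
    - replace (Dr * (P * v) + - Di * (Q * v)) with (P * v * Dr + (- (Q * v)) * Di) by ring.
      unfold Dr, Di; rewrite <- sumR_lin; apply sumR_ext; intros l.
      unfold P, Q, v, Y, shift_coef, twist, lat_w, lat_x; cbn [fst snd].
      replace (t - (a * IZR k + 0 * IZR l)) with (t - (a * IZR k + 0 * 0)) by ring.
      (* The phase is split into a part of the row, a part of the kernel in t - t0, and Z0, which
         the twist of [shift_coef] cancels. *)
      replace (2 * PI * (cc * IZR k + d * IZR l) * t) with
        (2 * PI * (cc * IZR k + d * 0) * t + (2 * PI * (d * IZR l) * (t - t0) + (2 * PI * (d * IZR l) * t0))) by ring.
      set (X := 2 * PI * (cc * IZR k + d * 0) * t). set (Z0 := 2 * PI * (d * IZR l) * t0).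
      set (W := 2 * PI * (d * IZR l) * (t - t0)).
      replace (cos (X + (W + Z0))) with (cos ((X + W) + Z0)) by (f_equal; ring).
      replace (sin (X + (W + Z0))) with (sin ((X + W) + Z0)) by (f_equal; ring).
      rewrite cos_neg, sin_neg, (cos_plus (X + W)), (sin_plus (X + W)).
      assert (sc := sin2_cos2 Z0); unfold Rsqr in sc.
      transitivity ((fst (b (k, 0%Z)) * cos (X + W) - snd (b (k, 0%Z)) * sin (X + W)) * (sin Z0 * sin Z0 + cos Z0 * cos Z0) * g j (t - (a * IZR k + 0 * 0))); [ring|].
      rewrite sc, cos_plus, sin_plus; ring.
    - replace (Di * (P * v) + Dr * (Q * v)) with (P * v * Di + (Q * v) * Dr) by ring.
      unfold Dr, Di; rewrite <- sumR_lin; apply sumR_ext; intros l.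
      unfold P, Q, v, Y, shift_coef, twist, lat_w, lat_x; cbn [fst snd].
      replace (t - (a * IZR k + 0 * IZR l)) with (t - (a * IZR k + 0 * 0)) by ring.
      replace (2 * PI * (cc * IZR k + d * IZR l) * t) with
        (2 * PI * (cc * IZR k + d * 0) * t + (2 * PI * (d * IZR l) * (t - t0) + (2 * PI * (d * IZR l) * t0))) by ring.
      set (X := 2 * PI * (cc * IZR k + d * 0) * t). set (Z0 := 2 * PI * (d * IZR l) * t0).
      set (W := 2 * PI * (d * IZR l) * (t - t0)).
      replace (cos (X + (W + Z0))) with (cos ((X + W) + Z0)) by (f_equal; ring).
      replace (sin (X + (W + Z0))) with (sin ((X + W) + Z0)) by (f_equal; ring).
      rewrite cos_neg, sin_neg, (cos_plus (X + W)), (sin_plus (X + W)).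
      assert (sc := sin2_cos2 Z0); unfold Rsqr in sc.
      transitivity ((fst (b (k, 0%Z)) * sin (X + W) + snd (b (k, 0%Z)) * cos (X + W)) * (sin Z0 * sin Z0 + cos Z0 * cos Z0) * g j (t - (a * IZR k + 0 * 0))); [ring|].
      rewrite sc, cos_plus, sin_plus; ring. }
  destruct G as [-> ->]. ring.
Qed.

Lemma NoDup_comb (ks : list Z) N : NoDup ks -> NoDup (list_prod ks (comb N)).
Proof.
  assert (Nc : NoDup (comb N)).
  { apply (NoDup_map_inv Z.to_nat).
    unfold comb. rewrite map_map, (map_ext _ (fun i => i) Nat2Z.id), map_id. apply seq_NoDup. }
  induction 1 as [|k ks Hk _ IH]; simpl; [constructor|].
  apply NoDup_app; [|exact IH|].
  - apply (NoDup_map_inv snd). rewrite map_map, map_id. exact Nc.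
  - intros [x y] Hx Hy. apply in_map_iff in Hx; destruct Hx as [z [Ez _]]. inversion Ez; subst.
    apply in_prod_iff in Hy. tauto.
Qed.

Lemma coef_sq_comb (ks : list Z) N b t0 : coef_sq (list_prod ks (comb N)) (shift_coef b t0) = INR N * coef_sq (axis ks) b.
Proof.
  unfold coef_sq, axis. rewrite sumR_list_prod, map_map, <- sumR_scal. apply sumR_ext; intros k.
  unfold comb. rewrite map_map.
  rewrite (sumR_ext _ (fun _ => fst (b (k, 0%Z)) ^ 2 + snd (b (k, 0%Z)) ^ 2)) by (intros; apply twist_sq).
  set (v := _ + _). clear. induction N as [|N IH]; [unfold sumR; simpl; ring|].
  rewrite seq_S, map_app, sumR_app, IH, S_INR. unfold sumR; simpl; ring.
Qed.

Lemma kernel_mean N t0 s : cont (kernel_sq N t0) /\ RInt (kernel_sq N t0) s (s + hh) = hh * INR N.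
Proof.
  split; [apply cont_gsum_sq_one|]. unfold kernel_sq, hh.
  rewrite (gsum_one_orthogonality d d0 _ _ 0%Z).
  - rewrite coef_sq_comb. unfold coef_sq, sumR; simpl. ring.
  - apply NoDup_comb. constructor; [simpl; tauto | constructor].
  - intros p Hp. destruct p as [x y]. apply in_prod_iff in Hp. destruct Hp as [[<-|[]] _]. reflexivity.
Qed.

Lemma kernel_period N t0 t m : kernel_sq N t0 (t + IZR m * hh) = kernel_sq N t0 t.
Proof.
  unfold kernel_sq, gsum_sq, sumR. cbn [map fold_right seq].
  destruct (gsum_one_period d d0 (list_prod (0%Z :: nil) (comb N)) (shift_coef (fun _ => (1, 0)) t0) t m) as [q1 q2].
  unfold hh; rewrite q1, q2. reflexivity.
Qed.

Lemma kernel_ge0 N t0 t : 0 <= kernel_sq N t0 t.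
Proof. apply gsum_sq_ge0. Qed.

(** K does not depend on N while the mass of the kernel over a period is proportional to N, so the
    mass gathers at t0. The constant comes from [dirichlet]: with θ = 2πd(t - t0), the kernel times
    θ²/4 = (πd)²(t - t0)² is at most 4. *)
Lemma kernel_concentration : exists K, 0 <= K /\ forall N t0 t, Rabs (t - t0) <= hh / 2 ->
  kernel_sq N t0 t * (t - t0) ^ 2 <= K.
Proof.
  assert (P0 := PI_RGT_0). assert (dp := Rabs_pos_lt d d0).
  exists (4 / (PI * d) ^ 2). assert (w0 : 0 < (PI * d) ^ 2).
  { rewrite Rpow_mult_distr, <- (pow2_abs d). apply Rmult_lt_0_compat; apply pow_lt; assumption. }
  split; [left; apply Rdiv_lt_0_compat; lra|]; intros N t0 t Ht.
  set (th := 2 * PI * d * (t - t0)).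
  assert (E : kernel_sq N t0 t = sumR (map (fun i => cos (INR i * th)) (seq 0 N)) ^ 2 + sumR (map (fun i => sin (INR i * th)) (seq 0 N)) ^ 2).
  { unfold kernel_sq, gsum_sq. unfold sumR at 1. cbn [map fold_right seq]. rewrite Rplus_0_r.
    unfold gsum_re, gsum_im. rewrite !sumR_list_prod. cbn [map]. unfold sumR at 1 3. cbn [fold_right]. rewrite !Rplus_0_r.
    unfold comb; rewrite !map_map.
    f_equal; f_equal; apply sumR_ext; intros l; unfold shift_coef, twist, lat_w, one, th; cbn [fst snd]; rewrite <- INR_IZR_INZ.
    - replace (INR l * (2 * PI * d * (t - t0))) with (2 * PI * (0 * 0 + d * INR l) * t + - (2 * PI * (d * INR l) * t0)) by ring.
      rewrite cos_plus; ring.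
    - replace (INR l * (2 * PI * d * (t - t0))) with (2 * PI * (0 * 0 + d * INR l) * t + - (2 * PI * (d * INR l) * t0)) by ring.
      rewrite sin_plus; ring. }
  assert (D := dirichlet N th). cbv zeta in D. rewrite <- E in D.
  assert (b : Rabs th <= PI).
  { unfold th. rewrite !Rabs_mult, (Rabs_right 2), (Rabs_right PI) by lra.
    apply (Rmult_le_compat_l (2 * PI * Rabs d)) in Ht; [|nra].
    replace (2 * PI * Rabs d * (hh / 2)) with PI in Ht by (unfold hh; field; lra). exact Ht. }
  apply one_minus_cos_ge in b. assert (k0 := kernel_ge0 N t0 t).
  apply (Rmult_le_reg_r ((PI * d) ^ 2)); [assumption|].
  replace (4 / (PI * d) ^ 2 * (PI * d) ^ 2) with 4 by (field; split; lra).
  replace (kernel_sq N t0 t * (t - t0) ^ 2 * (PI * d) ^ 2) with (kernel_sq N t0 t * (th ^ 2 / 4)) by (unfold th; field).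
  eapply Rle_trans; [|exact D]. now apply Rmult_le_compat_l.
Qed.

Hypothesis Vfail : forall eps, 0 < eps -> exists ks b, NoDup ks /\ 0 < coef_sq (axis ks) b /\
  forall M, sumR (map (fun m => gsum_sq n psi a 0 cc d (axis ks) b (- (hh / 2) + IZR m * hh)) (zrange M))
    <= eps * coef_sq (axis ks) b.
Hypothesis Hexp : forall eta, 0 < eta -> exists S, forall M x,
  sumR (map (fun m => exp (- (eta * Rabs (x + IZR m)))) (zrange M)) <= S.

(** Near t0 the fibre sums are at most a small multiple of b2 plus a multiple of (t - t0)².
    Integrated against the kernel, the former gives a small multiple of N and the latter, by
    [kernel_concentration], a constant W; a lower Riesz bound A would demand A N b2 for every N. *)
Lemma not_riesz_of_fibers : ~ gabor_riesz n h a 0 cc d.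
Proof.
  intros [A [B [A0 [_ HR]]]].
  destruct (gsum_sq_equiv h c Hh n) as [al [be [al0 [be0 EQ]]]].
  assert (h0 := period_pos d d0). fold hh in h0.
  (* With this eps and the eta below, each of the two terms linear in N is at most a quarter of A b2
     N. *)
  set (eps := A / (4 * be * hh)).
  assert (eps0 : 0 < eps) by (apply Rdiv_lt_0_compat; [assumption | repeat apply Rmult_lt_0_compat; lra]).
  destruct (Vfail eps eps0) as [ks [b [Nk [b0 Hb]]]]. set (b2 := coef_sq (axis ks) b) in *.
  set (t0 := - (hh / 2)) in *. set (g := gsum_sq n psi a 0 cc d (axis ks) b) in *.
  destruct (tame_increment g (hh / 2) (tame_gsum_sq n a 0 cc d (axis ks) b)) as [C [C0 HC]].
  destruct (Hexp hh h0) as [S HS].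
  assert (S0 : 0 <= S) by (generalize (HS 0%nat 0); unfold sumR; simpl; lra).
  assert (CS : 0 <= C * S) by nra.
  destruct kernel_concentration as [K [K0 HK]].
  set (eta := A * b2 / (4 * be * hh * (C * S + 1))).
  assert (eta0 : 0 < eta).
  { apply Rdiv_lt_0_compat; repeat apply Rmult_lt_0_compat; lra. }
  assert (G : forall M u, Rabs u <= hh / 2 ->
    sumR (map (fun m => g (t0 + u + IZR m * hh)) (zrange M)) <= eps * b2 + C * S * eta + C * S / eta * u ^ 2).
  { intros M u Hu.
    apply Rle_trans with (sumR (map (fun m => 1 * g (t0 + IZR m * hh) + Rabs u * C * exp (- (hh * Rabs (t0 / hh + IZR m)))) (zrange M))).
    - apply sumR_le; intros m.
      replace (t0 + u + IZR m * hh) with ((t0 + IZR m * hh) + u) by ring.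
      eapply Rle_trans; [apply HC; exact Hu|].
      replace (hh * Rabs (t0 / hh + IZR m)) with (Rabs (t0 + IZR m * hh)); [lra|].
      rewrite <- (Rabs_right hh) at 2 by lra. rewrite <- Rabs_mult. f_equal. field. lra.
    - rewrite sumR_lin, Rmult_1_l, Rplus_assoc. apply Rplus_le_compat; [apply Hb|].
      assert (p := Rabs_pos u).
      apply Rle_trans with (Rabs u * (C * S)).
      + rewrite Rmult_assoc. apply Rmult_le_compat_l; [assumption|]. apply Rmult_le_compat_l; [assumption | apply HS].
      (* Trades the linear increment for a small constant plus a quadratic term, the order that
         [kernel_concentration] controls. *)
      + assert (q : Rabs u <= eta + u ^ 2 / eta).
        { apply (Rmult_le_reg_r eta); [assumption|].
          replace ((eta + u ^ 2 / eta) * eta) with (eta ^ 2 + u ^ 2) by (field; lra).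
          rewrite <- (pow2_abs u). generalize (pow2_ge_0 (Rabs u - eta)); nra. }
        apply (Rmult_le_compat_r (C * S)) in q; [|assumption].
        eapply Rle_trans; [exact q|]. right; field; lra. }
  set (W := be * (C * S / eta * K) * hh).
  assert (Main : forall N, INR N * (A * b2 / 2) <= W).
  { intros N.
    set (idx := list_prod ks (comb N)). set (co := shift_coef b t0).
    destruct (HR idx co (NoDup_comb ks N Nk)) as [L [HL [HA _]]].
    assert (Cf : cont (gsum_sq n h a 0 cc d idx co)) by apply (cont_gsum_sq n h c Hh).
    apply improper_IR in HL; [|exact Cf].
    unfold idx, co in HA. rewrite coef_sq_comb in HA. fold b2 in HA.
    assert (HL' : L <= be * (eps * b2 + C * S * eta) * (hh * INR N) + W).
    (* The period [-hh, 0] is centred at t0, so |t - t0| <= hh/2 throughout. *)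
    { apply (IR_le _ L (- hh) hh _ h0 HL). intros M. rewrite RInt_periods by assumption.
      destruct (kernel_mean N t0 (- hh)) as [Ck Ik].
      apply Rle_trans with (RInt (fun t => be * (eps * b2 + C * S * eta) * kernel_sq N t0 t + be * (C * S / eta * K) * 1) (- hh) (- hh + hh)).
      - apply RInt_mono; [lra | | |].
        + apply (cont_sumR (fun m t => gsum_sq n h a 0 cc d idx co (t + IZR m * hh))). intros; now apply cont_shift.
        + apply cont_plus; apply cont_scal; [exact Ck | apply cont_const].
        + intros t Ht.
          assert (ut : Rabs (t - t0) <= hh / 2) by (unfold t0; apply Rabs_le; lra).
          assert (k0 := kernel_ge0 N t0 t).
          apply Rle_trans with (be * kernel_sq N t0 t * sumR (map (fun m => g (t0 + (t - t0) + IZR m * hh)) (zrange M))).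
          * rewrite <- sumR_scal. apply sumR_le; intros m.
            destruct (EQ a 0 cc d idx co (t + IZR m * hh)) as [_ e]. eapply Rle_trans; [exact e|].
            unfold idx, co. rewrite gsum_sq_comb, kernel_period.
            replace (t0 + (t - t0)) with t by ring. fold g. lra.
          * apply Rle_trans with (be * kernel_sq N t0 t * (eps * b2 + C * S * eta + C * S / eta * (t - t0) ^ 2)).
            -- apply Rmult_le_compat_l; [nra | now apply G].
            -- assert (k1 := HK N t0 t ut).
               assert (q : 0 <= be * (C * S / eta)).
               { apply Rmult_le_pos; [lra|]. apply Rmult_le_pos; [lra | left; now apply Rinv_0_lt_compat]. }
               apply (Rmult_le_compat_l (be * (C * S / eta))) in k1; [|exact q]. nra.
      - rewrite RInt_lin, Ik, RInt_const; [| exact Ck | apply cont_const].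
        unfold scal; simpl; unfold mult; simpl. unfold W. right; ring. }
    assert (e1 : be * (eps * b2) * (hh * INR N) = INR N * (A * b2 / 4)).
    { unfold eps; field; lra. }
    assert (e2 : be * (C * S * eta) * (hh * INR N) <= INR N * (A * b2 / 4)).
    { replace (INR N * (A * b2 / 4)) with (be * ((C * S + 1) * eta) * (hh * INR N)) by (unfold eta; field; lra).
      assert (0 <= INR N) by apply pos_INR.
      apply Rmult_le_compat_r; [apply Rmult_le_pos; lra|]. apply Rmult_le_compat_l; [lra|].
      apply Rmult_le_compat_r; lra. }
    nra. }
  destruct (INR_unbounded (W / (A * b2 / 2))) as [N HN].
  assert (p : 0 < A * b2 / 2) by nra.
  apply (Rmult_lt_compat_r (A * b2 / 2)) in HN; [|assumption].
  unfold Rdiv at 1 in HN. rewrite Rmult_assoc, Rinv_l, Rmult_1_r in HN by lra.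
  generalize (Main N); lra.
Qed.
End Necessity.

End Analysis.

Module Jets.
Import mathcomp.boot.all_boot mathcomp.order.all_order mathcomp.algebra.all_algebra.
Import mathcomp.algebra_tactics.ring mathcomp.algebra_tactics.lra mathcomp.zify.zify.
Import Order.TTheory GRing.Theory Num.Theory.
Set Implicit Arguments. Unset Strict Implicit. Unset Printing Implicit Defensive.
Local Open Scope ring_scope.

(** * Absolute values and weighted norms *)

(** The values lie in an ordered field R and not in F itself, so that complex polynomials can be
    bounded by sums of real weights. *)
Record absval (F : fieldType) (R : realFieldType) := AbsVal {
  av :> F -> R;
  av_ge0 : forall x, 0 <= av x;
  av_eq0 : forall x, (av x == 0) = (x == 0);
  avM : forall x y, av (x * y) = av x * av y;
  avD : forall x y, av (x + y) <= av x + av y }.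

Arguments av : simpl never.

Section WeightedNorm.
Variables (R : realFieldType) (F : fieldType) (nm : absval F R).
Implicit Types (p q : {poly F}) (r : R) (x y : F).

Let nm_ge0 := av_ge0 nm.
Let nmM := avM nm.
Let nmD := avD nm.

Lemma av_gt0 x : (0 < nm x) = (x != 0).
Proof. by rewrite lt_def nm_ge0 andbT av_eq0. Qed.
Lemma nm0 : nm 0 = 0. Proof. by apply/eqP; rewrite av_eq0. Qed.
Lemma nm1 : nm 1 = 1.
Proof.
by apply: (@mulIf _ (nm 1)); rewrite ?av_eq0 ?oner_eq0 // mul1r -nmM mulr1.
Qed.
Lemma nmN x : nm (- x) = nm x.
Proof.
suff e : nm (-1) = 1 by rewrite -mulN1r nmM e mul1r.
apply/eqP; rewrite -(@eqrXn2 _ 2) ?ler01 // expr1n.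
by rewrite expr2 -nmM mulrNN mulr1 nm1.
Qed.
Lemma nmV x : nm x^-1 = (nm x)^-1.
Proof.
have [->|nz] := eqVneq x 0; first by rewrite invr0 nm0 invr0.
by apply: (@mulfI _ (nm x)); rewrite ?av_eq0 // -nmM !divff ?av_eq0 // nm1.
Qed.
Lemma nmX x k : nm (x ^+ k) = nm x ^+ k.
Proof. by elim: k => [|k IH]; rewrite ?expr0 ?nm1 // !exprS nmM IH. Qed.
Lemma nm_prod (I : Type) (s : seq I) (P : pred I) (f : I -> F) :
  nm (\prod_(i <- s | P i) f i) = \prod_(i <- s | P i) nm (f i).
Proof. by apply: (big_morph nm nmM nm1). Qed.
Lemma nm_sum (I : Type) (s : seq I) (P : pred I) (f : I -> F) :
  nm (\sum_(i <- s | P i) f i) <= \sum_(i <- s | P i) nm (f i).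
Proof.
apply: (big_ind2 (fun a b => nm a <= b)) => //; first by rewrite nm0.
by move=> a a' b b' H1 H2; apply: le_trans (nmD _ _) (lerD H1 H2).
Qed.
Lemma nmB_ge x y : nm x - nm y <= nm (x - y).
Proof. by rewrite lerBlDr -{1}(subrK y x) nmD. Qed.

(** The Wiener algebra norm on the circle of radius r: submultiplicative and dominating every
    coefficient, hence products can be estimated factor by factor. *)
Definition pn r p : R := \sum_(i < size p) nm p`_i * r ^+ i.

Lemma pn_widen r p k : (size p <= k)%N -> pn r p = \sum_(i < k) nm p`_i * r ^+ i.
Proof.
move=> le; rewrite /pn (big_ord_widen k (fun i => nm p`_i * r ^+ i)) // big_mkcond.
apply: eq_bigr => i _; case: ltnP => // ge.
by rewrite nth_default // nm0 mul0r.
Qed.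

Section Weight.
Variables (r : R) (r0 : 0 <= r).

Lemma pn_ge0 p : 0 <= pn r p.
Proof. by apply: sumr_ge0 => i _; rewrite mulr_ge0 ?nm_ge0 ?exprn_ge0. Qed.

Lemma pn0 : pn r 0 = 0. Proof. by rewrite /pn size_poly0 big_ord0. Qed.

Lemma pnD p q : pn r (p + q) <= pn r p + pn r q.
Proof.
set k := maxn (size p) (size q).
rewrite (@pn_widen _ (p + q) k) ?size_polyD //.
rewrite (@pn_widen _ p k) ?leq_maxl // (@pn_widen _ q k) ?leq_maxr // -big_split /=.
apply: ler_sum => i _; rewrite coefD -mulrDl ler_wpM2r ?exprn_ge0 //; exact: nmD.
Qed.

Lemma pnC x : pn r x%:P = nm x.
Proof.
rewrite (@pn_widen _ _ 1) ?size_polyC_leq1 // big_ord_recl big_ord0 addr0 coefC /=.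
by rewrite expr0 mulr1.
Qed.

Lemma pnZ x p : pn r (x *: p) = nm x * pn r p.
Proof.
rewrite (@pn_widen _ _ (size p)) ?size_scale_leq // /pn big_distrr /=.
by apply: eq_bigr => i _; rewrite coefZ nmM mulrA.
Qed.

Lemma pnMX p : pn r (p * 'X) = r * pn r p.
Proof.
rewrite (@pn_widen _ _ (size p).+1); last first.
  by have [->|nz] := eqVneq p 0; rewrite ?mul0r ?size_poly0 // size_mulX.
rewrite big_ord_recl coefMX /= nm0 mul0r add0r /pn big_distrr /=.
by apply: eq_bigr => i _; rewrite coefMX /= exprS mulrCA.
Qed.

Lemma pnM p q : pn r (p * q) <= pn r p * pn r q.
Proof.
elim/poly_ind: p => [|p c IH]; first by rewrite mul0r pn0 mul0r.
have -> : pn r (p * 'X + c%:P) = r * pn r p + nm c.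
  rewrite -pnMX; have [->|nz] := eqVneq p 0.
    by rewrite mul0r add0r pnC pn0 add0r.
  rewrite (@pn_widen _ (_ + _) (size p).+1); last first.
    by rewrite size_MXaddC (negbTE nz).
  rewrite (@pn_widen _ (p * 'X) (size p).+1); last by rewrite size_mulX.
  rewrite !big_ord_recl !coefD !coefMX !coefC /= add0r nm0 mul0r add0r expr0 mulr1 addrC.
  by congr (_ + _); apply: eq_bigr => i _; rewrite coefD coefC /= addr0.
rewrite mulrDl -mulrAC; apply: le_trans (pnD _ _) _; rewrite pnMX mul_polyC pnZ.
by rewrite mulrDl lerD2r -mulrA ler_wpM2l.
Qed.

Lemma pn1 : pn r 1 = 1. Proof. by rewrite pnC nm1. Qed.

Lemma pnX p k : pn r (p ^+ k) <= pn r p ^+ k.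
Proof.
elim: k => [|k IH]; first by rewrite !expr0 pn1.
by rewrite !exprS; apply: le_trans (pnM _ _) _; rewrite ler_wpM2l ?pn_ge0.
Qed.

Lemma pn_prod (I : Type) (s : seq I) (P : pred I) (f : I -> {poly F}) :
  pn r (\prod_(i <- s | P i) f i) <= \prod_(i <- s | P i) pn r (f i).
Proof.
suff: 0 <= pn r (\prod_(i <- s | P i) f i) <= \prod_(i <- s | P i) pn r (f i).
  by case/andP.
apply: (big_ind2 (fun a b => 0 <= pn r a <= b)) => [|p a q b /andP[_ pa] /andP[_ qb]|i _].
- by rewrite pn1 lexx ler01.
- rewrite pn_ge0; apply: le_trans (pnM _ _) _.
  by apply: ler_pM => //; apply: pn_ge0.
- by rewrite pn_ge0 lexx.
Qed.

Lemma pn_sum (I : Type) (s : seq I) (P : pred I) (f : I -> {poly F}) :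
  pn r (\sum_(i <- s | P i) f i) <= \sum_(i <- s | P i) pn r (f i).
Proof.
apply: (big_ind2 (fun a b => pn r a <= b)) => //; first by rewrite pn0.
by move=> a a' b b' H1 H2; apply: le_trans (pnD _ _) (lerD H1 H2).
Qed.

Lemma pn_take p k : pn r (take_poly k p) <= pn r p.
Proof.
have le : (size (take_poly k p) <= k + size p)%N.
  by apply: leq_trans (size_take_poly _ _) (leq_addr _ _).
rewrite (pn_widen _ le) (@pn_widen _ p (k + size p)) ?leq_addl //.
apply: ler_sum => i _; rewrite coef_take_poly; case: ifP => // _.
by rewrite nm0 mul0r mulr_ge0 ?nm_ge0 ?exprn_ge0.
Qed.

Lemma pn_coef p k : nm p`_k * r ^+ k <= pn r p.
Proof.
rewrite (@pn_widen _ p (k + size p).+1); last by rewrite leqW // leq_addl.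
have lt : (k < (k + size p).+1)%N by rewrite ltnS leq_addr.
rewrite (bigD1 (Ordinal lt)) //= lerDl.
by apply: sumr_ge0 => i _; rewrite mulr_ge0 ?nm_ge0 ?exprn_ge0.
Qed.

End Weight.
End WeightedNorm.

Section Jets.
Variables (F : fieldType) (n : nat).
Implicit Types p q : {poly F}.

(** * Jets and Hermite interpolation *)

(** Congruence modulo X^n, see [jeq_dvd]. *)
Definition jeq p q := forall i, (i < n)%N -> p`_i = q`_i.

Lemma jeq_refl p : jeq p p. Proof. by []. Qed.
Lemma jeq_sym p q : jeq p q -> jeq q p.
Proof. by move=> H i Hi; rewrite H. Qed.
Lemma jeq_trans q p r : jeq p q -> jeq q r -> jeq p r.
Proof. by move=> H1 H2 i Hi; rewrite H1 // H2. Qed.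
Lemma jeqD p p' q q' : jeq p p' -> jeq q q' -> jeq (p + q) (p' + q').
Proof. by move=> H1 H2 i Hi; rewrite !coefD H1 // H2. Qed.
Lemma jeqN p p' : jeq p p' -> jeq (- p) (- p').
Proof. by move=> H1 i Hi; rewrite !coefN H1. Qed.
Lemma jeqZ c p p' : jeq p p' -> jeq (c *: p) (c *: p').
Proof. by move=> H1 i Hi; rewrite !coefZ H1. Qed.
Lemma jeqM p p' q q' : jeq p p' -> jeq q q' -> jeq (p * q) (p' * q').
Proof.
move=> H1 H2 i Hi; rewrite !coefM; apply: eq_bigr => j _.
by rewrite H1 ?H2 //; apply: leq_ltn_trans Hi; rewrite ?leq_subr // -ltnS.
Qed.
Lemma jeqX p p' k : jeq p p' -> jeq (p ^+ k) (p' ^+ k).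
Proof.
by move=> H; elim: k => [|k IH]; rewrite ?expr0 // !exprS; apply: jeqM.
Qed.
Lemma jeq_prod (I : Type) (s : seq I) (P : pred I) (f g : I -> {poly F}) :
  (forall i, P i -> jeq (f i) (g i)) ->
  jeq (\prod_(i <- s | P i) f i) (\prod_(i <- s | P i) g i).
Proof. by move=> H; apply: (big_ind2 jeq) => // *; apply: jeqM. Qed.
Lemma jeq_sum (I : Type) (s : seq I) (P : pred I) (f g : I -> {poly F}) :
  (forall i, P i -> jeq (f i) (g i)) ->
  jeq (\sum_(i <- s | P i) f i) (\sum_(i <- s | P i) g i).
Proof. by move=> H; apply: (big_ind2 jeq) => // *; apply: jeqD. Qed.
Lemma jeq_take p : jeq (take_poly n p) p.
Proof. by move=> i Hi; rewrite coef_take_poly Hi. Qed.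
Lemma jeq_dvd p : jeq p 0 <-> 'X^n %| p.
Proof.
split=> [H|/dvdpP[q ->] i Hi]; last by rewrite coefMXn Hi coef0.
apply/dvdpP; exists (drop_poly n p); apply/polyP => i.
rewrite coefMXn coef_drop_poly; case: ltnP => Hi; first by rewrite H ?coef0.
by rewrite subnK.
Qed.

End Jets.

Section Hermite.
Variables (F : fieldType) (n N : nat) (v c : nat -> F).
Hypothesis v0 : forall i, (i < N)%N -> v i != 0.
Hypothesis c0 : forall i, (i < N)%N -> c i != 0.
Hypothesis vinj : forall i j, (i < N)%N -> (j < N)%N -> v i = v j -> i = j.
Let f i : {poly F} := c i *: ('X - (v i)%:P).

Definition omega (m : nat) : {poly F} := \prod_(i < N | i != m :> nat) f i ^+ n.

(** In the coordinate X ↦ v_m(1 - X) the node v_m becomes the origin, so vanishing to order n there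
    is divisibility by X^n. The multiplicative form is chosen because z^k becomes v_m^k (1 -
    X)^k. *)
Lemma comp_local (m : 'I_N) :
  f m \Po (v m *: (1 - 'X)) = (- (c m * v m)) *: 'X.
Proof.
rewrite /f comp_polyZ comp_polyB comp_polyX comp_polyC.
have -> : v m *: (1 - 'X) - (v m)%:P = - v m *: 'X.
  by rewrite scalerBr -[v m *: 1]mul_polyC mulr1 addrAC subrr sub0r scaleNr.
by rewrite scalerA mulrN.
Qed.

Lemma local_inv (m : 'I_N) : (1 - (v m)^-1 *: 'X) \Po (v m *: (1 - 'X)) = 'X :> {poly F}.
Proof.
rewrite comp_polyB comp_polyZ comp_polyX -[1]/(1%:P) comp_polyC scalerA mulVf ?v0 //.
by rewrite scale1r opprB addrCA subrr addr0.
Qed.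

Lemma local_inv' (m : 'I_N) : (v m *: (1 - 'X)) \Po (1 - (v m)^-1 *: 'X) = 'X :> {poly F}.
Proof.
rewrite comp_polyZ comp_polyB comp_polyX -[1]/(1%:P) comp_polyC.
by rewrite opprB addrCA subrr addr0 scalerA mulfV ?v0 // scale1r.
Qed.

Lemma size_f (i : 'I_N) : size (f i) = 2.
Proof. by rewrite size_scale ?c0 // size_XsubC. Qed.

Lemma f_neq0 (i : 'I_N) : f i != 0.
Proof. by rewrite -size_poly_eq0 size_f. Qed.

Lemma size_fX (i : 'I_N) : size (f i ^+ n) = n.+1.
Proof.
have H : size (f i ^+ n) != 0%N by rewrite size_poly_eq0 expf_neq0 ?f_neq0.
by rewrite -(prednK (n := size (f i ^+ n))) ?lt0n // size_exp size_f mul1n.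
Qed.

Lemma coprime_f (i j : 'I_N) : i != j -> coprimep (f i ^+ n) (f j ^+ n).
Proof.
move=> ij; apply: coprimep_expl; apply: coprimep_expr.
rewrite coprimepZl ?c0 // coprimepZr ?c0 // coprimep_XsubC root_XsubC.
by apply: contra ij => /eqP e; apply/eqP/val_inj; apply: (vinj (ltn_ord _) (ltn_ord _)).
Qed.

Lemma prod_dvd (p : {poly F}) : (forall m : 'I_N, f m ^+ n %| p) ->
  \prod_(i < N) f i ^+ n %| p.
Proof.
move=> H; rewrite -[\prod_(i < N) _]big_enum /=.
elim: (enum 'I_N) (enum_uniq 'I_N) => [|i s IH] /=; first by rewrite big_nil dvd1p.
case/andP=> nis us; rewrite big_cons Gauss_dvdp ?H ?IH //.
rewrite big_seq; apply: (big_ind (fun q => coprimep (f i ^+ n) q)) => //.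
- by rewrite coprimep1.
- by move=> a b ? ?; rewrite coprimepMr; apply/andP.
- by move=> j js; apply: coprime_f; apply: contraNneq nis => ->.
Qed.

Lemma size_prod_f (P : pred 'I_N) : size (\prod_(i < N | P i) f i ^+ n) = (n * #|P|).+1.
Proof.
rewrite size_prod => [|i _]; last by rewrite expf_neq0 ?f_neq0.
rewrite (eq_bigr (fun=> n.+1)) => [|i _]; last exact: size_fX.
by rewrite sum_nat_const mulnS -addnS [(_ * n)%N]mulnC addnC addnK.
Qed.

(* Hermite interpolation in the local coordinates X ↦ v_m (1 - X), where [U m] inverts the
   product of the other factors modulo X^n. *)
Lemma hermite_interp (U : nat -> {poly F}) (p : {poly F}) :
  (forall m : 'I_N, jeq n (U m * (omega m \Po (v m *: (1 - 'X)))) 1) ->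
  (size p <= n * N)%N ->
  p = \sum_(m < N) omega m *
      (take_poly n (U m * (p \Po (v m *: (1 - 'X)))) \Po (1 - (v m)^-1 *: 'X)).
Proof.
move=> HU sp.
(* The difference D has a zero of order n at each of the N nodes but size at most nN, so it is 0. *)
set S := \sum_(m < N) _; apply/eqP; rewrite -subr_eq0; set D := p - S.
have sS : (size S <= n * N)%N.
  apply: leq_trans (size_sum _ _ _) _; apply/bigmax_leqP => m _.
  set q := take_poly _ _.
  have [->|q0] := eqVneq q 0; first by rewrite comp_poly0 mulr0 size_poly0.
  apply: leq_trans (size_polyMleq _ _) _.
  have -> : size (omega m) = (n * N.-1).+1.
    rewrite /omega (eq_bigl (fun i => i != m)) => [|i]; last by rewrite -val_eqE.
    rewrite size_prod_f; congr (_.+1); congr (_ * _)%N.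
    by have := cardC1 m; rewrite card_ord => <-; apply: eq_card => i; rewrite !inE.
  have sq : (size (q \Po (1 - (v m)^-1 *: 'X)) <= n)%N.
    have := size_comp_poly_leq q (1 - (v m)^-1 *: 'X).
    have -> : size (1 - (v m)^-1 *: 'X) = 2.
      rewrite addrC size_polyDl size_polyN size_scale ?invr_eq0 ?v0 ?size_polyX //.
      by rewrite size_poly1.
    rewrite muln1 => h; apply: leq_trans h _.
    have := size_take_poly n (U m * (p \Po (v m *: (1 - 'X)))); rewrite -/q.
    by rewrite prednK ?lt0n ?size_poly_eq0.
  rewrite addSn /=; have N0 := leq_ltn_trans (leq0n m) (ltn_ord m).
  by rewrite -[in X in (_ <= X)%N](prednK N0) mulnS addnC leq_add2r.
have HD (m : 'I_N) : f m ^+ n %| D.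
  have : jeq n (D \Po (v m *: (1 - 'X))) 0.
    rewrite /D comp_polyB -[X in jeq _ _ X](subrr (p \Po (v m *: (1 - 'X)))).
    apply: jeqD => //; apply: jeqN.
    rewrite /S raddf_sum /= (bigD1 m) //= -[X in jeq _ _ X]addr0; apply: jeqD.
      rewrite comp_polyM -comp_polyA local_inv comp_polyXr.
      apply: (@jeq_trans _ _ ((omega m \Po (v m *: (1 - 'X))) *
        (U m * (p \Po (v m *: (1 - 'X)))))); first by apply: jeqM => //; apply: jeq_take.
      rewrite mulrCA mulrA -[X in jeq _ _ X]mul1r; apply: jeqM => //.
    apply: (@jeq_trans _ _ (\sum_(i < N | i != m) 0)); last by rewrite big1.
    apply: jeq_sum => i im; apply/jeq_dvd.
    rewrite comp_polyM; apply: dvdp_mulr.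
    rewrite /omega (bigD1 m) /=; last by rewrite eq_sym.
    rewrite comp_polyM; apply: dvdp_mulr.
    by rewrite rmorphXn /= comp_local exprZn dvdpZr // expf_neq0 // oppr_eq0 mulf_neq0 ?c0 ?v0.
  move/jeq_dvd/dvdpP => [g Hg].
  have -> : D = (D \Po (v m *: (1 - 'X))) \Po (1 - (v m)^-1 *: 'X).
    by rewrite -comp_polyA local_inv' comp_polyXr.
  rewrite Hg comp_polyM; apply: dvdp_mull; rewrite rmorphXn /= comp_polyX.
  rewrite /f exprZn dvdpZl ?expf_neq0 ?c0 //; apply: dvdp_exp2r.
  have -> : 1 - (v m)^-1 *: 'X = - (v m)^-1 *: ('X - (v m)%:P).
    by rewrite scalerBr scaleNr -[_ *: _%:P]mul_polyC -polyCM mulNr mulVf ?v0 // polyCN opprK addrC.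
  by rewrite dvdpZr // oppr_eq0 invr_eq0 v0.
have := prod_dvd HD; case: (eqVneq D 0) => // nzD /dvdp_leq -/(_ nzD).
rewrite size_prod_f; have -> : #|(fun=> true) : pred 'I_N| = N by rewrite -[RHS]card_ord; apply: eq_card.
move=> lt; have := leq_trans (size_polyD p (- S)) _; rewrite -/D => /(_ (n*N)%N).
rewrite size_polyN geq_max sp sS => /(_ isT) le2.
by have := leq_trans lt le2; rewrite ltnn.
Qed.

End Hermite.

Section BinomialJet.
Variables (F : numFieldType) (n : nat).

(** * Jets of powers *)

(** The generalised binomial coefficient of x over j with sign (-1)^j; x ranges over the field
    because exponents k - T may be negative. *)
Definition binc (j : nat) (x : F) : F :=
  (-1) ^+ j * (\prod_(i < j) (x - i%:R)) / j`!%:R.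

(* The n-jet of (1 - X)^x. *)
Definition binjet (x : F) : {poly F} := \poly_(j < n) binc j x.

(** Pascal's rule with the sign absorbed. *)
Lemma bincS j x : binc j.+1 (x + 1) = binc j.+1 x - binc j x.
Proof.
have nz k : k`!%:R != 0 :> F by rewrite pnatr_eq0 -lt0n fact_gt0.
have e : \prod_(i < j.+1) (x + 1 - i%:R) = (x + 1) * \prod_(i < j) (x - i%:R).
  rewrite big_ord_recl subr0; congr (_ * _); apply: eq_bigr => i _.
  by rewrite lift0 -natr1; ring.
rewrite /binc e big_ord_recr /= factS natrM exprS.
have := nz j; move: (\prod_(i < j) _) (j`!%:R) => P f f0.
have j0 : j.+1%:R != 0 :> F by rewrite pnatr_eq0.
rewrite -natr1 in j0 *; field; by rewrite f0 j0.
Qed.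

Lemma binjetS x : jeq n ((1 - 'X) * binjet x) (binjet (x + 1)).
Proof.
move=> i Hi; rewrite mulrBl mul1r coefB coefXM !coef_poly Hi.
case: i Hi => [|j] Hi /=; first by rewrite subr0 /binc !big_ord0.
by rewrite (ltn_trans _ Hi) // bincS.
Qed.

Lemma binjetX k x : jeq n ((1 - 'X) ^+ k * binjet x) (binjet (x + k%:R)).
Proof.
elim: k => [|k IH]; first by rewrite expr0 mul1r addr0.
rewrite exprS -mulrA; apply: jeq_trans (_ : jeq n _ ((1 - 'X) * binjet (x + k%:R))) _.
  by apply: jeqM.
by rewrite -natr1 addrA; apply: binjetS.
Qed.

Lemma binjet0 : jeq n (binjet 0) 1.
Proof.
move=> i Hi; rewrite coef_poly Hi coef1 /binc; case: i Hi => [|i] Hi.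
  by rewrite big_ord0 /= expr0 mul1r mul1r invr1.
by rewrite big_ord_recl subr0 mul0r mulr0 mul0r.
Qed.

(** Extracting (1 - X)^T passes from polynomial exponents k to the signed exponents k - T of a
    Laurent polynomial. *)
Lemma binjet_nat k T : jeq n ((1 - 'X) ^+ k) ((1 - 'X) ^+ T * binjet (k%:R - T%:R)).
Proof.
apply: jeq_trans (_ : jeq n _ (binjet k%:R)) _; last first.
  by apply: jeq_sym; rewrite -{2}[k%:R](subrK T%:R); apply: binjetX.
rewrite -[(1 - 'X) ^+ k]mulr1; apply: jeq_trans (_ : jeq n _ ((1 - 'X) ^+ k * binjet 0)) _.
  by apply: jeqM => //; apply: jeq_sym; apply: binjet0.
by rewrite -[k%:R]add0r; apply: binjetX.
Qed.

End BinomialJet.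

(** * Inverses of linear factors modulo X^n *)

Section TruncatedInverse.
Variables (F : fieldType) (R : realFieldType) (nm : absval F R) (n : nat).

Definition geo (z : F) : {poly F} := \sum_(j < n) z ^+ j *: 'X ^+ j.

Lemma geoP z : jeq n ((1 - z *: 'X) * geo z) 1.
Proof.
have -> : (1 - z *: 'X) * geo z = 1 - (z *: 'X) ^+ n.
  rewrite -opprB -[1 - _]opprB subrX1 mulNr; congr (- (_ * _)).
  by apply: eq_bigr => i _; rewrite exprZn.
move=> i Hi; rewrite coefB exprZn coefZ coefXn ltn_eqF // mulr0 subr0.
by [].
Qed.

Lemma pn_geo z K : 1 <= K -> nm z <= K -> pn nm 1 (geo z) <= n%:R * K ^+ n.
Proof.
move=> K1 zK; rewrite /geo; apply: le_trans (pn_sum nm ler01 _ _ _) _.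
have -> : n%:R * K ^+ n = \sum_(j < n) K ^+ n by rewrite sumr_const card_ord mulr_natl.
apply: ler_sum => i _; rewrite pnZ nmX.
have -> : pn nm 1 'X^i = 1.
  elim: (i : nat) => [|k IH]; first by rewrite expr0 pn1.
  by rewrite exprSr pnMX IH mulr1.
rewrite mulr1; apply: le_trans (_ : K ^+ i <= _).
  by rewrite lerXn2r ?nnegrE ?av_ge0 // (le_trans ler01).
by rewrite ler_weXn2l // ltnW.
Qed.

(** Inverses modulo X^n of 1 - X - x and 1 - x(1 - X), the two normal forms of the factor of v_i
    seen from v_m. The ratio x is v_i/v_m or v_m/v_i, whichever has modulus at most 1/Q. *)
Definition invB (x : F) := (1 - x)^-1 *: geo (1 - x)^-1.
Definition invA (x : F) := (1 - x)^-1 *: geo (- (x / (1 - x))).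

Lemma invBP x : 1 - x != 0 -> jeq n ((1 - 'X - x%:P) * invB x) 1.
Proof.
move=> nz; rewrite /invB -scalerAr scalerAl.
have -> : (1 - x)^-1 *: (1 - 'X - x%:P) = 1 - (1 - x)^-1 *: 'X.
  have -> : 1 - 'X - x%:P = (1 - x)%:P - 'X by rewrite polyCB addrAC.
  by rewrite scalerBr -mul_polyC -polyCM mulVf.
exact: geoP.
Qed.

Lemma invAP x : 1 - x != 0 -> jeq n ((1 - x *: (1 - 'X)) * invA x) 1.
Proof.
move=> nz; rewrite /invA -scalerAr scalerAl.
have -> : (1 - x)^-1 *: (1 - x *: (1 - 'X)) = 1 - (- (x / (1 - x))) *: 'X.
  have -> : 1 - x *: (1 - 'X) = (1 - x)%:P + x *: 'X.
    by rewrite scalerBr -[x *: 1]mul_polyC mulr1 polyCB opprB addrA addrAC.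
  rewrite scalerDr -[_ *: _%:P]mul_polyC -polyCM mulVf // scalerA scaleNr opprK.
  by rewrite mulrC.
exact: geoP.
Qed.

Variable Q : R.
Hypothesis Q1 : 1 < Q.
(** [KQ] bounds 1/|1 - x| for |x| <= 1/Q, and [KN] the norms of the truncated inverses [invA] and
    [invB]. *)
Definition KQ : R := Q / (Q - 1).
Definition KN : R := KQ * (n%:R * KQ ^+ n).

Lemma KQ_ge1 : 1 <= KQ.
Proof. by have := Q1; rewrite /KQ => h; rewrite ler_pdivlMr ?subr_gt0 // mul1r gerBl ler01. Qed.

Lemma KN_ge0 : 0 <= KN.
Proof.
have K0 := le_trans ler01 KQ_ge1.
by apply: mulr_ge0 => //; apply: mulr_ge0; rewrite ?exprn_ge0 ?ler0n.
Qed.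

Section Small.
Variable x : F.
Hypothesis xQ : nm x <= Q^-1.

Lemma nm1B : Q / (Q - 1) >= (nm (1 - x))^-1.
Proof.
have Q0 : 0 < Q by apply: lt_trans Q1; exact: ltr01.
have h : (Q - 1) / Q <= nm (1 - x).
  have := nmB_ge nm 1 x; rewrite nm1; apply: le_trans.
  by rewrite mulrBl divff ?gt_eqF // mul1r lerD2l lerN2.
by rewrite -[Q / _]invf_div lef_pV2 // posrE ?(lt_le_trans _ h) // divr_gt0 ?subr_gt0.
Qed.

Lemma subr1_neq0 : 1 - x != 0.
Proof.
rewrite subr_eq0; apply: contraTneq xQ => <-.
by rewrite nm1 -ltNge invf_lt1 // (lt_trans ltr01).
Qed.

Lemma pn_invB : pn nm 1 (invB x) <= KN.
Proof.
rewrite /invB pnZ nmV; apply: ler_pM; rewrite ?invr_ge0 ?av_ge0 ?pn_ge0 ?ler01 ?nm1B //.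
by apply: pn_geo; rewrite ?KQ_ge1 // nmV nm1B.
Qed.

Lemma pn_invA : pn nm 1 (invA x) <= KN.
Proof.
rewrite /invA pnZ nmV; apply: ler_pM; rewrite ?invr_ge0 ?av_ge0 ?pn_ge0 ?ler01 ?nm1B //.
apply: pn_geo; rewrite ?KQ_ge1 // nmN avM nmV -[KQ]mul1r.
apply: ler_pM; rewrite ?invr_ge0 ?av_ge0 ?nm1B //.
by apply: le_trans xQ _; rewrite invf_le1 ?ltW // (lt_trans ltr01).
Qed.

End Small.
End TruncatedInverse.

Section Nodes.
Variables (F : numFieldType) (R : realFieldType) (nm : absval F R).
Variables (n M : nat) (v0 q : F).
Let Q := nm q.
Hypotheses (Q1 : 1 < Q) (M0 : (0 < M)%N) (v0_neq0 : v0 != 0).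
Let N := (M + M)%N.

(** * Nodes in geometric progression *)

(* The interpolation nodes form a geometric progression; the first M will lie in the unit disc
   and the others outside. *)
Definition node (i : nat) : F := v0 * q ^+ i.
(* The normalisation keeps the norm of c_i (X - v_i) close to 1. *)
Definition lead (i : nat) : F := if (i < M)%N then 1 else - (node i)^-1.
Local Notation v := node.
Local Notation c := lead.
Let f i : {poly F} := c i *: ('X - (v i)%:P).

Let Q0 : 0 < Q. Proof. exact: lt_trans ltr01 Q1. Qed.
Let q0 : q != 0. Proof. by rewrite -(av_gt0 nm). Qed.

Lemma node_neq0 i : v i != 0.
Proof. by rewrite mulf_neq0 // expf_neq0. Qed.

Lemma lead_neq0 i : c i != 0.
Proof.
by rewrite /lead; case: ifP => _; rewrite ?oner_eq0 // oppr_eq0 invr_eq0 node_neq0.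
Qed.

Lemma node_inj i j : v i = v j -> i = j.
Proof.
move/mulfI => /(_ v0_neq0) /(congr1 nm); rewrite !nmX.
by apply: ieexprIn; rewrite ?Q0 // gt_eqF.
Qed.

Lemma nm_node_div i j : (i <= j)%N -> nm (v i / v j) = Q ^- (j - i).
Proof.
move=> le; rewrite -{1}(subnK le) /node exprD invfM mulrACA divff // mul1r.
by rewrite invfM mulrCA divff ?expf_neq0 // mulr1 nmV nmX.
Qed.

Definition loc (m : nat) : {poly F} := v m *: (1 - 'X).

(* An inverse of c_i (X - v_i) in the coordinate at v_m, up to the factor v_m (1 - X) for i < M;
   these factors are collected in [prod_loc]. *)
Definition ufac (m i : nat) : {poly F} :=
  if (i < m)%N then
    let x := v i / v m in
    if (i < M)%N then 1 + x *: invB n x else (- x) *: invB n x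
  else
    let x := v m / v i in
    if (i < M)%N then (- x) *: ((1 - 'X) * invA n x) else 1 + x *: ((1 - 'X) * invA n x).

Lemma f_comp m i : f i \Po loc m = c i *: (loc m - (v i)%:P).
Proof. by rewrite /f comp_polyZ comp_polyB comp_polyX comp_polyC. Qed.

Let small i j : (i < j)%N -> nm (v i / v j) <= Q^-1.
Proof.
move=> lt; rewrite nm_node_div ?(ltnW lt) // -exprVn -[leRHS]expr1.
by rewrite ler_wiXn2l ?invr_ge0 ?(ltW Q0) ?invf_le1 ?(ltW Q1) // subn_gt0.
Qed.

Let nz i j : (i < j)%N -> 1 - v i / v j != 0.
Proof. by move=> lt; apply: (subr1_neq0 Q1 (small lt)). Qed.

(** For i < m < M or M <= m < i the inverse is written as 1 plus a small term: (1 - X)/(1 - X - x) =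
    1 + x/(1 - X - x), and 1/(1 - x(1 - X)) = 1 + x(1 - X)/(1 - x(1 - X)). The same form serves
    every i on the far side of the middle; for i between m and the middle the inverse itself carries
    the factor x. *)
Lemma ufacP m i : i != m ->
  jeq n (ufac m i * (f i \Po loc m)) (if (i < M)%N then loc m else 1).
Proof.
move=> im; rewrite f_comp /ufac /lead; case: (ltngtP i m) im => // lt _.
- set x := v i / v m; have H := @invBP _ n _ (nz lt); rewrite -/x in H; move: (invB n x) H => b H.
  have e : loc m - (v i)%:P = v m *: (1 - 'X - x%:P).
    by rewrite /loc [RHS]scalerBr -[_ *: x%:P]mul_polyC -polyCM /x mulrCA divff ?node_neq0 // mulr1.
  case: ifP => _; rewrite e.
    rewrite scale1r -scalerAr /loc; apply: jeqZ.
    rewrite mulrDl mul1r -scalerAl [b * _]mulrC.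
    rewrite -[X in jeq _ _ X](subrK x%:P); apply: jeqD => //.
    rewrite -[X in jeq _ _ X]mulr1 mul_polyC; exact: jeqZ.
  rewrite scalerA -scalerAr -scalerAl scalerA [b * _]mulrC -[X in jeq _ _ X]scale1r.
  have -> : - (v i)^-1 * v m * - x = 1.
    by rewrite /x mulrN !mulNr opprK mulrACA mulVf ?node_neq0 // mulfV ?node_neq0 // mulr1.
  exact: jeqZ.
- set x := v m / v i; have H := @invAP _ n _ (nz lt); rewrite -/x in H; move: (invA n x) H => b H.
  have e : loc m - (v i)%:P = - v i *: (1 - x *: (1 - 'X)).
    rewrite /loc [RHS]scalerBr scalerA mulNr /x mulrCA divff ?node_neq0 // mulr1 !scaleNr opprK addrC.
    by rewrite -[v i *: 1]mul_polyC mulr1.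
  case: ifP => _; rewrite e.
    rewrite scale1r -scalerAr -scalerAl scalerA mulrNN /loc.
    have -> : v i * x = v m by rewrite /x mulrCA divff ?node_neq0 // mulr1.
    rewrite -mulrA [b * _]mulrC; apply: jeqZ.
    rewrite -[X in jeq _ _ X]mulr1; exact: jeqM.
  rewrite scalerA mulrNN mulVf ?node_neq0 // scale1r mulrDl mul1r.
  rewrite -[X in jeq _ _ X](subrK (x *: (1 - 'X))); apply: jeqD => //.
  rewrite -scalerAl -mulrA [b * _]mulrC; apply: jeqZ.
  rewrite -[X in jeq _ _ X]mulr1; exact: jeqM.
Qed.

Variable K : R.
Hypotheses (KNK : KN n Q <= K) (K1 : 1 <= K).
Let K0 : 0 <= K. Proof. exact: le_trans ler01 K1. Qed.

Let dist m i : nat := (m - i) + (i - m).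
(* The indices between m and the middle index M, whose factors have small inverses at v_m. *)
Definition btw m i := (M <= i < m)%N || (m < i < M)%N.

Lemma pn_1X : pn nm 1 (1 - 'X) <= 2.
Proof.
apply: le_trans (pnD _ _ _ _) _; first exact: ler01.
rewrite pn1 -scaleN1r pnZ nmN nm1 mul1r -['X]mul1r pnMX pn1 mul1r; lra.
Qed.

(** Indices in [btw] gain a factor Q^-dist, the source of all decay; the remaining factors 1 + 2K
    Q^-dist form a convergent product. *)
Lemma pn_ufac m i : i != m ->
  pn nm 1 (ufac m i) <=
    (if btw m i then 2 * K * Q ^- dist m i else 1) * (1 + 2 * K * Q ^- dist m i).
Proof.
move=> im; rewrite /ufac /btw /dist.
have QV k : 0 <= Q ^- k by rewrite invr_ge0 exprn_ge0 // ltW.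
have t0 k : 0 <= 2 * K * Q ^- k by rewrite mulr_ge0 // mulr_ge0.
have fin1 (p : {poly F}) x k : nm x = Q ^- k -> pn nm 1 p <= 2 * K ->
    pn nm 1 (1 + x *: p) <= 1 + 2 * K * Q ^- k.
  move=> ex h; apply: le_trans (pnD _ ler01 _ _) _; rewrite pn1 pnZ ex lerD2l mulrC.
  by rewrite ler_wpM2r.
have fin2 (p : {poly F}) x k : nm x = Q ^- k -> pn nm 1 p <= 2 * K ->
    pn nm 1 (- x *: p) <= 2 * K * Q ^- k * (1 + 2 * K * Q ^- k).
  move=> ex h; rewrite pnZ nmN ex mulrC; apply: (@le_trans _ _ (2 * K * Q ^- k)).
    by rewrite ler_wpM2r.
  by rewrite ler_peMr // lerDl.
case: (ltngtP i m) im => // lt _.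
- have -> : (i - m = 0)%N by apply/eqP; rewrite subn_eq0 ltnW.
  have e := nm_node_div (ltnW lt); rewrite addn0 andbT orbF.
  have b : pn nm 1 (invB n (v i / v m)) <= 2 * K.
    by have := pn_invB n Q1 (small lt); move: KNK K0 => *; lra.
  by rewrite ltnNge; case: (M <= i)%N => /=; rewrite ?mul1r; [apply: fin2 | apply: fin1].
- have -> : (m - i = 0)%N by apply/eqP; rewrite subn_eq0 ltnW.
  have e := nm_node_div (ltnW lt); rewrite add0n andbF /=.
  have b : pn nm 1 ((1 - 'X) * invA n (v m / v i)) <= 2 * K.
    apply: le_trans (pnM _ ler01 _ _) _; apply: ler_pM; rewrite ?pn_ge0 ?ler01 ?pn_1X //.
    by apply: le_trans (pn_invA n Q1 (small lt)) KNK.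
  by case: (i < M)%N => /=; rewrite ?mul1r; [apply: fin2 | apply: fin1].
Qed.

End Nodes.

(** Both sides of m are indexed outwards, so that in either product the index i stands at distance i
    + 1 from m. *)
Lemma prod_skip (A : comPzRingType) (N m : nat) (G : nat -> A) : (m < N)%N ->
  \prod_(i < N | i != m :> nat) G i =
  (\prod_(i < m) G (m - i.+1)%N) * \prod_(i < N - m.+1) G (m.+1 + i)%N.
Proof.
move=> lt; rewrite -(big_mkord (fun i => i != m) G) (@big_cat_nat _ _ _ m) //=; last exact: ltnW.
congr (_ * _).
  rewrite big_mkord [LHS](eq_bigl (fun=> true)) => [|i]; last by rewrite ltn_eqF.
  by rewrite (reindex_inj rev_ord_inj).
rewrite big_ltn_cond // eqxx /= -[m.+1]add0n big_addn big_mkord.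
apply: eq_big => i; first by rewrite gtn_eqF // addnS ltnS leq_addl.
by move=> _; rewrite addnC.
Qed.

Lemma btw_below (M m i : nat) : (i < m)%N ->
  ((M <= m - i.+1 < m) || (m < m - i.+1 < M) = (i < m - M))%N.
Proof. lia. Qed.
Lemma dist_below (m i : nat) : (i < m)%N -> (m - (m - i.+1) + (m - i.+1 - m) = i.+1)%N.
Proof. lia. Qed.
Lemma btw_above (M m i : nat) :
  ((M <= m.+1 + i < m) || (m < m.+1 + i < M) = (i < M.-1 - m))%N.
Proof. lia. Qed.
Lemma dist_above (m i : nat) : (m - (m.+1 + i) + (m.+1 + i - m) = i.+1)%N.
Proof. lia. Qed.
Lemma leq_above (M m : nat) : (m < M + M -> M.-1 - m <= M + M - m.+1)%N.
Proof. lia. Qed.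
Lemma gap_lo (M m : nat) : (0 < M -> m < M -> (m - M + (M.-1 - m) = M.-1 - m))%N.
Proof. lia. Qed.
Lemma gap_hi (M m : nat) : (M <= m -> (m - M + (M.-1 - m) = m - M))%N.
Proof. lia. Qed.
Lemma gap_rev (M i : nat) : (i < M -> (M - i.+1 - M + (M.-1 - (M - i.+1)) = i))%N.
Proof. lia. Qed.
Lemma gap_add (M i : nat) : (M + i - M + (M.-1 - (M + i)) = i)%N.
Proof. lia. Qed.
Lemma ltn_pred (M m : nat) : (m < M -> m <= M.-1)%N.
Proof. lia. Qed.

(** * Products over all nodes *)

Section CoreBound.
Variables (F : numFieldType) (R : realFieldType) (nm : absval F R).
Variables (n M : nat) (v0 q : F).
Let Q := nm q.
Hypotheses (Q1 : 1 < Q) (M0 : (0 < M)%N) (v0_neq0 : v0 != 0).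
Let N := (M + M)%N.
Local Notation v := (node v0 q).
Local Notation c := (lead M v0 q).
Let f i : {poly F} := c i *: ('X - (v i)%:P).
Hypotheses (hin : nm (v M.-1) <= 1) (hout : 1 <= nm (v M)).

Variables (K C : R).
Hypotheses (KNK : KN n Q <= K) (K1 : 1 <= K).
Hypothesis HC : forall L, \prod_(k < L) (1 + 2 * K * Q ^- k) <= C.

Let Q0 : 0 < Q. Proof. exact: lt_trans ltr01 Q1. Qed.
Let K0 : 0 <= K. Proof. exact: le_trans ler01 K1. Qed.
Let g k : R := 1 + 2 * K * Q ^- k.
Let QV k : 0 <= Q ^- k. Proof. by rewrite invr_ge0 exprn_ge0 // ltW. Qed.
Let g1 k : 1 <= g k. Proof. by rewrite lerDl !mulr_ge0 ?QV. Qed.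
Let g0 k : 0 <= g k. Proof. exact: le_trans ler01 (g1 k). Qed.
Let C1 : 1 <= C. Proof. by have := HC 0; rewrite big_ord0. Qed.
Let C0 : 0 <= C. Proof. exact: le_trans ler01 C1. Qed.

Let prodg1 L : \prod_(k < L) g k.+1 <= C.
Proof.
apply: le_trans (HC L.+1); rewrite big_ord_recl ler_peMl //.
  by apply: prodr_ge0 => i _; exact: g0.
exact: g1.
Qed.

(** The number of indices in [btw M m], that is, of nodes between v_m and the unit circle. By
    truncated subtraction one summand vanishes, and both m = M - 1 and m = M have gap 0. *)
Definition gap (m : nat) : nat := (m - M) + (M.-1 - m).
(** A discrete Gaussian: (2K)^k Q^(-k(k+1)/2). *)
Definition gauss (k : nat) : R := \prod_(i < k) (2 * K * Q ^- i.+1).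

Lemma prod_btw m : (m < N)%N ->
  \prod_(i < N | i != m :> nat)
     (if btw M m i then 2 * K * Q ^- ((m - i) + (i - m)) else 1) = gauss (gap m).
Proof.
move=> lt.
pose G i := if btw M m i then 2 * K * Q ^- ((m - i) + (i - m)) else 1.
rewrite (@prod_skip _ N m G lt) /G /btw.
have -> : \prod_(i < m) (if (M <= m - i.+1 < m)%N || (m < m - i.+1 < M)%N
      then 2 * K * Q ^- (m - (m - i.+1) + (m - i.+1 - m)) else 1) = gauss (m - M).
  rewrite /gauss (big_ord_widen m (fun i => 2 * K * Q ^- i.+1)) ?leq_subr //.
  rewrite big_mkcond /= [RHS]big_mkcond /=; apply: eq_bigr => i _; have := ltn_ord i => im.
  rewrite btw_below //.
  by case: ifP => // _; rewrite dist_below.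
have -> : \prod_(i < N - m.+1) (if (M <= m.+1 + i < m)%N || (m < m.+1 + i < M)%N
      then 2 * K * Q ^- (m - (m.+1 + i) + (m.+1 + i - m)) else 1) = gauss (M.-1 - m).
  rewrite /gauss (big_ord_widen (N - m.+1) (fun i => 2 * K * Q ^- i.+1)); last exact: leq_above.
  rewrite big_mkcond /= [RHS]big_mkcond /=; apply: eq_bigr => i _; have := ltn_ord i => im.
  rewrite btw_above.
  by case: ifP => // _; rewrite dist_above.
have gauss0 : gauss 0 = 1 by rewrite /gauss big_ord0.
rewrite /gap; have [h|h] := leqP M m.
  rewrite gap_hi //; have -> : (M.-1 - m = 0)%N.
    by apply/eqP; rewrite subn_eq0 (leq_trans (leq_pred _) h).
  by rewrite gauss0 mulr1.
rewrite gap_lo //; have -> : (m - M = 0)%N by apply/eqP; rewrite subn_eq0 ltnW.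
by rewrite gauss0 mul1r.
Qed.

Lemma prod_g m : (m < N)%N ->
  \prod_(i < N | i != m :> nat) g ((m - i) + (i - m)) <= C ^+ 2.
Proof.
move=> lt; rewrite (@prod_skip _ N m (fun i => g ((m - i) + (i - m))) lt) expr2.
apply: ler_pM; try by apply: prodr_ge0 => i _; exact: g0.
  rewrite (eq_bigr (fun i : 'I_m => g i.+1)) => [|i _]; first exact: prodg1.
  by rewrite dist_below.
rewrite (eq_bigr (fun i : 'I_(N - m.+1) => g i.+1)) => [|i _]; first exact: prodg1.
by rewrite dist_above.
Qed.

Lemma pn_ufac_prod m : (m < N)%N ->
  \prod_(i < N | i != m :> nat) pn nm 1 (ufac n M v0 q m i) ^+ n
    <= (gauss (gap m) * C ^+ 2) ^+ n.
Proof.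
move=> lt; rewrite prodrXl; apply: lerXn2r; rewrite ?nnegrE.
- by apply: prodr_ge0 => i _; apply: pn_ge0.
- apply: mulr_ge0; last by rewrite exprn_ge0.
  by apply: prodr_ge0 => i _; rewrite !mulr_ge0 ?QV.
apply: le_trans (_ : \prod_(i < N | i != m :> nat)
   ((if btw M m i then 2 * K * Q ^- ((m - i) + (i - m)) else 1) *
     g ((m - i) + (i - m))) <= _).
  apply: ler_prod => i im; rewrite pn_ge0 ?ler01 //=; apply: pn_ufac => //.
rewrite big_split /= prod_btw //; apply: ler_wpM2l (prod_g lt).
by apply: prodr_ge0 => i _; rewrite !mulr_ge0 ?QV.
Qed.

Lemma nm_node i : (i < N)%N ->
  nm (v i) = if (i < M)%N then nm (v M.-1) * Q ^- gap i else nm (v M) * Q ^+ gap i.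
Proof.
move=> lt; rewrite /gap; case: ltnP => h.
  rewrite gap_lo // -(nm_node_div Q1 v0_neq0) ?ltn_pred //.
  by rewrite mulrC -avM divfK ?(node_neq0 Q1).
rewrite gap_hi //.
rewrite -{1}(subnK h) /node addnC exprD mulrA avM nmX.
by [].
Qed.

Lemma pn_f i : (i < N)%N -> pn nm 1 (f i) <= g (gap i).
Proof.
move=> lt; rewrite /f pnZ.
have h : pn nm 1 ('X - (v i)%:P) <= 1 + nm (v i).
  apply: le_trans (pnD _ ler01 _ _) _; rewrite -polyCN pnC nmN.
  by rewrite -['X]mul1r pnMX pn1 mul1r.
apply: le_trans (ler_wpM2l (av_ge0 _ _) h) _.
have gQ k : 1 + Q ^- k <= g k by rewrite lerD2l ler_peMl ?QV //; move: K1 => *; lra.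
apply: le_trans (gQ _); rewrite /lead; case: ifP => hi; have := nm_node lt; rewrite hi => e.
  by rewrite nm1 mul1r e lerD2l ler_piMl ?QV.
have vp : 0 < nm (v i) by rewrite av_gt0 (node_neq0 Q1).
rewrite nmN nmV mulrDr mulr1 mulVf ?gt_eqF // addrC lerD2l lef_pV2 ?posrE ?exprn_gt0 //.
by rewrite e ler_peMl // exprn_ge0 // ltW.
Qed.

(** Normalised by [lead], a factor has norm 1 + O(Q^-gap), and each value of the gap occurs once
    inside and once outside the disc. Hence the bound C² per multiplicity, independent of M and
    m. *)
Lemma pn_omega m : (m < N)%N -> pn nm 1 (omega n N v c m) <= (C ^+ 2) ^+ n.
Proof.
move=> lt; apply: le_trans (pn_prod _ ler01 _ _ _) _.
apply: le_trans (_ : \prod_(i < N | i != m :> nat) g (gap i) ^+ n <= _).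
  apply: ler_prod => i im; rewrite pn_ge0 ?ler01 //=.
  apply: le_trans (pnX _ ler01 _ _) _; apply: lerXn2r; rewrite ?nnegrE ?pn_ge0 ?ler01 ?g0 //.
  by apply: pn_f.
rewrite prodrXl; apply: lerXn2r; rewrite ?nnegrE ?exprn_ge0 //.
  by apply: prodr_ge0 => i _; exact: g0.
apply: le_trans (_ : \prod_(i < N) g (gap i) <= _).
  rewrite [leRHS](bigID (fun i : 'I_N => i != m :> nat)) /= ler_peMr //.
    by apply: prodr_ge0 => i _; exact: g0.
  apply: (big_ind (fun x => 1 <= x)) => // x y hx hy.
  by apply: (le_trans hx); rewrite ler_peMr // (le_trans ler01 hx).
rewrite /N big_split_ord expr2; apply: ler_pM; try by apply: prodr_ge0 => i _; exact: g0.
  rewrite (reindex_inj rev_ord_inj) /=.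
  rewrite (eq_bigr (fun i : 'I_M => g i)) => [|i _]; first exact: HC.
  by rewrite /gap gap_rev.
rewrite (eq_bigr (fun i : 'I_M => g i)) => [|i _]; first exact: HC.
by rewrite /gap /= gap_add.
Qed.

End CoreBound.

(** * Bound for the middle coefficient *)

(** The n-jet at v, in the coordinate v(1 - X), of the Laurent polynomial z^-T Σ b_k z^(e_k). *)
Definition jet_at (F : numFieldType) (n T : nat) (v : F) (I : Type) (ks : seq I)
    (b : I -> F) (e : I -> nat) : {poly F} :=
  \sum_(k <- ks) (b k * v ^+ e k / v ^+ T) *: binjet n ((e k)%:R - T%:R).

Lemma jet_atP (F : numFieldType) (n T : nat) (v : F) (I : Type) (ks : seq I)
    (b : I -> F) (e : I -> nat) : v != 0 ->
  jeq n ((\sum_(k <- ks) b k *: 'X ^+ e k) \Po (v *: (1 - 'X)))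
    ((v *: (1 - 'X)) ^+ T * jet_at n T v ks b e).
Proof.
move=> v0; rewrite /jet_at raddf_sum /= big_distrr /=; apply: jeq_sum => k _.
rewrite comp_polyZ rmorphXn /= comp_polyX !exprZn -scalerAl -scalerAr !scalerA.
have -> : v ^+ T * (b k * v ^+ e k / v ^+ T) = b k * v ^+ e k.
  by rewrite mulrC divfK // expf_neq0.
by apply: jeqZ; apply: binjet_nat.
Qed.

Section CoreInterp.
Variables (F : numFieldType) (R : realFieldType) (nm : absval F R).
Variables (n M : nat) (v0 q : F).
Let Q := nm q.
Hypotheses (Q1 : 1 < Q) (M0 : (0 < M)%N) (v0_neq0 : v0 != 0).
Let N := (M + M)%N.
Local Notation v := (node v0 q).
Local Notation c := (lead M v0 q).
Let f i : {poly F} := c i *: ('X - (v i)%:P).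
Hypotheses (hin : nm (v M.-1) <= 1) (hout : 1 <= nm (v M)).
Variables (K C : R).
Hypotheses (KNK : KN n Q <= K) (K1 : 1 <= K).
Hypothesis HC : forall L, \prod_(k < L) (1 + 2 * K * Q ^- k) <= C.
Let Q0 : 0 < Q. Proof. exact: lt_trans ltr01 Q1. Qed.
Local Notation loc := (loc v0 q).

(** Inverts the factor loc m left over by [ufac]. It is kept apart because it is never estimated: it
    cancels in [interp_jet]. *)
Definition wfac m (i : nat) : {poly F} :=
  if (i < M)%N then ((v m)^-1 *: geo n 1) ^+ n else 1.
Definition interp_inv m : {poly F} :=
  \prod_(i < N | i != m :> nat) (ufac n M v0 q m i ^+ n * wfac m i).
Definition jet_prod m : {poly F} :=
  \prod_(i < N | i != m :> nat) ufac n M v0 q m i ^+ n.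
Definition own m : {poly F} := if (m < M)%N then loc m ^+ n else 1.

Let vn0 i : v i != 0. Proof. exact: (node_neq0 Q1). Qed.

Lemma wfacP m i : jeq n (wfac m i * (if (i < M)%N then loc m else 1) ^+ n) 1.
Proof.
rewrite /wfac; case: ifP => _; last by rewrite expr1n mulr1.
rewrite -exprMn -[X in jeq _ _ X](expr1n _ n); apply: jeqX.
rewrite /loc -scalerAl -scalerAr scalerA mulVf // scale1r mulrC.
by have := @geoP F n 1; rewrite scale1r.
Qed.

Lemma interp_invP m : jeq n (interp_inv m * (omega n N v c m \Po loc m)) 1.
Proof.
rewrite /omega /interp_inv rmorph_prod -big_split /=.
apply: (@jeq_trans _ _ (\prod_(i < N | i != m :> nat) 1)); last by rewrite big1.
apply: jeq_prod => i im.
rewrite rmorphXn /= mulrAC -exprMn mulrC.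
apply: jeq_trans (wfacP m i); apply: jeqM => //; apply: jeqX.
exact: (@ufacP _ _ _ n M _ _ Q1 v0_neq0 _ _ im).
Qed.

Lemma prod_loc m : (m < N)%N ->
  loc m ^+ (n * M) = (\prod_(i < N | i != m :> nat) (if (i < M)%N then loc m else 1) ^+ n) * own m.
Proof.
move=> lt; have -> : loc m ^+ (n * M) = \prod_(i < N) (if (i < M)%N then loc m else 1) ^+ n.
  rewrite prodrXl mulnC exprM; congr (_ ^+ _).
  rewrite /N big_split_ord /= [X in _ * X]big1 ?mulr1 => [|i _].
    rewrite (eq_bigr (fun=> loc m)) => [|i _]; first by rewrite prodr_const card_ord.
    by rewrite ltn_ord.
  by rewrite ltnNge leq_addr.
rewrite (bigD1 (Ordinal lt)) //= mulrC; congr (_ * _).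
by rewrite /own; case: ifP => // _; rewrite expr1n.
Qed.

Variables (I : Type) (ks : seq I) (b : I -> F) (e : I -> nat).
Definition sparse : {poly F} := \sum_(k <- ks) b k *: 'X ^+ e k.
Definition jet m : {poly F} := jet_at n (n * M) (v m) ks b e.

Lemma jetP m : jeq n (sparse \Po loc m) (loc m ^+ (n * M) * jet m).
Proof. exact: jet_atP. Qed.

(** The centring exponent nM is the number of inner factors with multiplicity, so loc m ^+ (n M)
    cancels all the [wfac]. Only [own] survives, when v_m is itself an inner node and is skipped by
    the product. *)
Lemma interp_jet m : (m < N)%N ->
  jeq n (interp_inv m * (sparse \Po loc m)) (jet_prod m * own m * jet m).
Proof.
move=> lt; apply: (@jeq_trans _ _ (interp_inv m * (loc m ^+ (n * M) * jet m))).
  by apply: jeqM => //; apply: jetP.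
rewrite mulrA; apply: jeqM => //.
rewrite prod_loc // mulrA; apply: jeqM => //.
rewrite /interp_inv -big_split /=; apply: jeq_prod => i im.
rewrite -mulrA -[X in jeq _ _ X]mulr1; apply: jeqM => //; exact: wfacP.
Qed.

(** The four factors bound, in order, [omega], the inverses of the other factors, [own], and the
    return from the local coordinate, where |1/v_m| <= Q^(gap + 1). *)
Definition growth (k : nat) : R :=
  (C ^+ 2) ^+ n * (gauss nm q K k * C ^+ 2) ^+ n * 2 ^+ n * (1 + Q ^+ k.+1) ^+ n.

Lemma pn_comp_le (A : {poly F}) (a : F) : (size A <= n)%N ->
  pn nm 1 (A \Po (1 - a *: 'X)) <= pn nm 1 A * (1 + nm a) ^+ n.
Proof.
move=> sA; rewrite comp_polyE; apply: le_trans (pn_sum _ ler01 _ _ _) _.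
rewrite {2}/pn mulr_suml; apply: ler_sum => i _; rewrite expr1n mulr1 pnZ.
apply: ler_wpM2l; first exact: av_ge0.
apply: le_trans (pnX _ ler01 _ _) _.
have h : pn nm 1 (1 - a *: 'X) <= 1 + nm a.
  apply: le_trans (pnD _ ler01 _ _) _; rewrite pn1 lerD2l -scaleNr pnZ nmN.
  by rewrite -['X]mul1r pnMX pn1 !mulr1.
apply: (@le_trans _ _ ((1 + nm a) ^+ i)).
  by apply: lerXn2r; rewrite ?nnegrE ?pn_ge0 ?ler01 ?addr_ge0 ?av_ge0.
by rewrite ler_weXn2l ?lerDl ?av_ge0 // (leq_trans _ sA) // ltnW.
Qed.

(* The middle coefficient is controlled by the jets at the nodes, with weights decaying like the
   products [gauss] in the distance of the node from the unit circle. *)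
Lemma core_bound : (size sparse <= n * N)%N ->
  nm sparse`_(n * M) <= \sum_(m < N) growth (gap M m) * pn nm 1 (jet m).
Proof.
move=> sz; have K0 : 0 <= K by exact: le_trans ler01 K1.
have -> : sparse = \sum_(m < N) omega n N v c m *
      (take_poly n (interp_inv m * (sparse \Po loc m)) \Po (1 - (v m)^-1 *: 'X)).
  apply: hermite_interp => //.
  - by move=> i _; apply: (lead_neq0 _ Q1).
  - by move=> i j _ _; apply: (node_inj Q1).
  - by move=> m; apply: interp_invP.
rewrite coef_sum; apply: le_trans (nm_sum _ _ _ _) _.
apply: ler_sum => m _; set A := take_poly _ _.
have := pn_coef nm ler01 (omega n N v c m * (A \Po (1 - (v m)^-1 *: 'X))) (n * M).
rewrite expr1n mulr1 => h; apply: le_trans h _.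
apply: le_trans (pnM _ ler01 _ _) _.
have hA : pn nm 1 A <= (gauss nm q K (gap M m) * C ^+ 2) ^+ n * 2 ^+ n * pn nm 1 (jet m).
  have -> : A = take_poly n (jet_prod m * own m * jet m).
    by apply/polyP => i; rewrite !coef_take_poly; case: ifP => // hi; rewrite interp_jet.
  apply: le_trans (pn_take _ ler01 _ _) _; apply: le_trans (pnM _ ler01 _ _) _.
  apply: ler_wpM2r; first by rewrite pn_ge0 ?ler01.
  apply: le_trans (pnM _ ler01 _ _) _; apply: ler_pM; rewrite ?pn_ge0 ?ler01 //.
    apply: le_trans (pn_prod _ ler01 _ _ _) _.
    apply: le_trans (pn_ufac_prod Q1 M0 v0_neq0 KNK K1 HC (ltn_ord m)).
    apply: ler_prod => i _; rewrite pn_ge0 ?ler01 //=; exact: pnX.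
  rewrite /own; case: ifP => hm; last by rewrite pn1 exprn_ege1 // ler1n.
  apply: le_trans (pnX _ ler01 _ _) _; apply: lerXn2r; rewrite ?nnegrE ?pn_ge0 ?ler01 ?ler0n //.
  rewrite /loc pnZ -[leRHS]mul1r; apply: ler_pM; rewrite ?av_ge0 ?pn_ge0 ?ler01 ?pn_1X //.
  have := nm_node Q1 M0 v0_neq0 (ltn_ord m); rewrite hm => ->.
  by rewrite mulr_ile1 ?av_ge0 ?invr_ge0 ?exprn_ge0 ?(ltW Q0) // invf_le1 ?exprn_gt0 // exprn_ege1 // ltW.
have hv : 1 + nm (v m)^-1 <= 1 + Q ^+ (gap M m).+1.
  rewrite lerD2l nmV.
  have := nm_node Q1 M0 v0_neq0 (ltn_ord m); case: ifP => hm ev.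
    (* v_M = q v_(M-1) lies outside the open unit disc, so v_(M-1) cannot be smaller than 1/Q. *)
    have hq : Q^-1 <= nm (v M.-1).
      rewrite -[leLHS]mul1r ler_pdivrMr // -avM; apply: le_trans hout _.
      by rewrite /node -mulrA -exprSr prednK.
    rewrite ev exprS invfM invrK; apply: ler_pM => //; rewrite ?invr_ge0 ?av_ge0 ?exprn_ge0 ?(ltW Q0) //.
    by rewrite -[leRHS]invrK lef_pV2 ?posrE ?invr_gt0 // av_gt0.
  apply: (@le_trans _ _ 1); last by rewrite exprn_ege1 // ltW.
  by rewrite invf_le1 ?av_gt0 // ev mulr_ege1 // exprn_ege1 // ltW.
have sA : (size A <= n)%N by apply: size_take_poly.
have h2 := pn_comp_le (v m)^-1 sA.
rewrite /growth -!mulrA.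
apply: ler_pM; rewrite ?pn_ge0 ?ler01 //.
  exact: (@pn_omega _ _ nm n M v0 q Q1 M0 v0_neq0 hin hout K C K1 HC m (ltn_ord m)).
apply: (le_trans h2).
have -> (x y z t : R) : x * (y * (z * t)) = x * y * t * z by ring.
apply: ler_pM => //.
- by rewrite pn_ge0 ?ler01.
- by rewrite exprn_ge0 // addr_ge0 ?av_ge0.
by apply: lerXn2r; rewrite ?nnegrE ?addr_ge0 ?av_ge0 ?exprn_ge0 ?(ltW Q0).
Qed.

End CoreInterp.

End Jets.

Module Fibers.
Import mathcomp.boot.all_boot mathcomp.order.all_order mathcomp.algebra.all_algebra.
Import mathcomp.real_closed.complex mathcomp.reals_stdlib.Rstruct.
Import mathcomp.algebra_tactics.ring mathcomp.algebra_tactics.lra mathcomp.zify.zify mathcomp.zify.ssrZ.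
Import Order.TTheory GRing.Theory Num.Theory Jets.
Set Implicit Arguments. Unset Strict Implicit. Unset Printing Implicit Defensive.
Local Open Scope ring_scope.

Arguments exp x%_ring_scope.
Arguments cos x%_ring_scope.
Arguments sin x%_ring_scope.

(** * The complex exponential *)

Lemma expD (x y : R) : exp (x + y) = exp x * exp y. Proof. exact: exp_plus. Qed.
Lemma expN (x : R) : exp (- x) = (exp x)^-1. Proof. by rewrite -RinvE; exact: exp_Ropp. Qed.
Lemma exp0 : exp 0 = 1 :> R. Proof. exact: exp_0. Qed.
Lemma exp_gt0 (x : R) : 0 < exp x. Proof. by apply/RltP; exact: exp_pos. Qed.
Lemma exp_ge0 (x : R) : 0 <= exp x. Proof. exact: ltW (exp_gt0 x). Qed.
Lemma exp_ge1Dx (x : R) : 1 + x <= exp x. Proof. by apply/RleP; exact: exp_ineq1_le. Qed.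
Lemma ler_exp (x y : R) : x <= y -> exp x <= exp y.
Proof.
rewrite le_eqVlt => /orP[/eqP->//|/RltP h]; apply/ltW/RltP; exact: exp_increasing.
Qed.
Lemma ltr_exp (x y : R) : x < y -> exp x < exp y.
Proof. by move/RltP=> h; apply/RltP; exact: exp_increasing. Qed.
Lemma expX (x : R) k : exp x ^+ k = exp (k%:R * x).
Proof.
elim: k => [|k IH]; first by rewrite mul0r exp0.
by rewrite exprS IH -natr1 mulrDl mul1r expD mulrC.
Qed.
Lemma cosD (x y : R) : cos (x + y) = cos x * cos y - sin x * sin y.
Proof. exact: cos_plus. Qed.
Lemma sinD (x y : R) : sin (x + y) = sin x * cos y + cos x * sin y.
Proof. exact: sin_plus. Qed.
Lemma cos2sin2 (x : R) : cos x ^+ 2 + sin x ^+ 2 = 1.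
Proof.
by rewrite addrC !expr2; exact: sin2_cos2.
Qed.
Definition cabs_fun (z : R[i]) : R := ComplexField.Normc.normc z.
Program Definition cabs : absval R[i] R := @AbsVal _ _ cabs_fun _ _ _ _.
Next Obligation. by case: x => a b; rewrite /cabs_fun /= sqrtr_ge0. Qed.
Next Obligation.
apply/eqP/eqP => [|->]; [exact: ComplexField.Normc.eq0_normc | exact: ComplexField.Normc.normc0].
Qed.
Next Obligation. exact: ComplexField.Normc.normcM. Qed.
Next Obligation. exact: le_normcD. Qed.

Lemma cabs2 (x y : R) : cabs (x +i* y)%C ^+ 2 = x ^+ 2 + y ^+ 2.
Proof. by rewrite /av /= /cabs_fun /= sqr_sqrtr // addr_ge0 ?sqr_ge0. Qed.

Lemma cabs_real (x : R) : 0 <= x -> cabs x%:C%C = x.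
Proof. by move=> x0; rewrite /av /= /cabs_fun /= expr0n /= addr0 sqrtr_sqr ger0_norm. Qed.

Definition cis (x : R) : R[i] := (cos x +i* sin x)%C.
Arguments cis x%_ring_scope.
Lemma cisD x y : cis (x + y) = cis x * cis y.
Proof. by rewrite /cis cosD sinD [_ * _ in RHS]/GRing.mul /= [cos x * sin y + _]addrC. Qed.
Lemma cis0 : cis 0 = 1. Proof. by rewrite /cis cos_0 sin_0. Qed.
Lemma cisX x k : cis x ^+ k = cis (k%:R * x).
Proof.
elim: k => [|k IH]; first by rewrite mul0r cis0.
by rewrite exprS IH -natr1 mulrDl mul1r cisD mulrC.
Qed.
Lemma cabs_cis x : cabs (cis x) = 1.
Proof.
apply/eqP; rewrite -(@eqrXn2 _ 2) ?av_ge0 ?ler01 // expr1n.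
by apply/eqP; rewrite cabs2 cos2sin2.
Qed.
Lemma cabsZ (x : R) z : 0 <= x -> cabs (x%:C%C * z) = x * cabs z.
Proof. by move=> x0; rewrite avM cabs_real. Qed.

Lemma prod_exp_le (c x : R) L : 0 <= c -> 0 <= x < 1 ->
  \prod_(k < L) (1 + c * x ^+ k) <= exp (c / (1 - x)).
Proof.
move=> c0 /andP[x0 x1]; apply: (@le_trans _ _ (exp (c * ((1 - x ^+ L) / (1 - x))))).
  elim: L => [|L IH].
    by rewrite big_ord0 expr0 subrr mul0r mulr0 exp0.
  rewrite big_ord_recr /=.
  have -> : c * ((1 - x ^+ L.+1) / (1 - x)) = c * ((1 - x ^+ L) / (1 - x)) + c * x ^+ L.
    by rewrite exprS; field; rewrite subr_eq0 gt_eqF.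
  rewrite expD; apply: ler_pM => //; last exact: exp_ge1Dx.
    by apply: prodr_ge0 => i _; rewrite addr_ge0 ?mulr_ge0 ?exprn_ge0.
  by rewrite addr_ge0 ?mulr_ge0 ?exprn_ge0.
apply: ler_exp; rewrite ler_wpM2l // ler_piMl ?invr_ge0 ?subr_ge0 ?(ltW x1) //.
by rewrite gerBl exprn_ge0.
Qed.

Lemma quad_exp (d A B : R) (x : R) : 0 < d ->
  exp (A * x - d * x ^+ 2 + B) <= exp (B + (A + 1) ^+ 2 / (4 * d)) * exp (- x).
Proof.
move=> d0; rewrite -expD; apply: ler_exp.
rewrite -subr_ge0.
have -> : B + (A + 1) ^+ 2 / (4 * d) + - x - (A * x - d * x ^+ 2 + B) =
   (2 * d * x - (A + 1)) ^+ 2 / (4 * d) by field; lra.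
by rewrite mulr_ge0 ?sqr_ge0 // invr_ge0; lra.
Qed.

(** * Decay of the interpolation weights *)

Section GrowthBound.
Variables (a h : R) (n : nat).
Hypotheses (a0 : 0 < a) (h0 : 0 < h) (n0 : (0 < n)%N) (anh : h < a * n%:R).
Variables (q : R[i]) (K C : R).
Hypotheses (hq : cabs q = exp (2 * PI * a * h)) (K1 : 1 <= K) (C0 : 0 <= C).

Let PI0 : 0 < PI :> R. Proof. by apply/RltP; exact: PI_RGT_0. Qed.

Let K0 : 0 <= K. Proof. exact: le_trans ler01 K1. Qed.

(** 2K <= exp(2K), and Q^-1, ..., Q^-k multiply to exp(-πah k(k + 1)). *)
Lemma gauss_le k :
  gauss cabs q K k <= exp (2 * K * k%:R - PI * a * h * (k%:R * (k%:R + 1))).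
Proof.
have := (K1, h0, a0) => -[[K1' h0'] a0'].
elim: k => [|k IH].
  by rewrite /gauss big_ord0 !(mulr0, mul0r) subr0 exp0.
rewrite /gauss big_ord_recr /= -/(gauss cabs q K k).
have -> : 2 * K * k.+1%:R - PI * a * h * (k.+1%:R * (k.+1%:R + 1)) =
   (2 * K * k%:R - PI * a * h * (k%:R * (k%:R + 1))) + (2 * K + - (k.+1%:R * (2 * PI * a * h))).
  by rewrite -natr1; ring.
rewrite expD; apply: ler_pM => //.
- by apply: prodr_ge0 => i _; rewrite !mulr_ge0 ?invr_ge0 ?exprn_ge0 ?av_ge0.
- by rewrite mulr_ge0 // ?mulr_ge0 // invr_ge0 exprn_ge0 // av_ge0.
rewrite expD expN hq expX; apply: ler_pM; rewrite ?invr_ge0 ?exp_ge0 // ?mulr_ge0 //.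
by apply: le_trans (exp_ge1Dx _); lra.
Qed.

(* The only use of h < an: the Gaussian exp(πs²) in front of the jets loses against [gauss]^n.
   *)
Lemma growth_bound : exists G : R, forall (k : nat) (s : R), `|s| <= (k%:R + 1) * h ->
  growth cabs n q K C k * (exp (PI * s ^+ 2) * (n%:R * ((`|s| + 1) / a + n%:R) ^+ n)) <= G * exp (- k%:R).
Proof.
have := (K1, h0, a0) => -[[K1' h0'] a0'].
have n1 : 1 <= n%:R :> R by rewrite ler1n.
have PA0 : 0 <= PI * a * h := mulr_ge0 (mulr_ge0 (ltW PI0) (ltW a0)) (ltW h0).
(* The coefficient of -k² in the exponent: πahn from the n-th power of [gauss], less πh² from
   exp(πs²) with |s| <= (k + 1)h. A and B collect the linear and constant terms. *)
pose d := PI * h * (a * n%:R - h).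
have d0 : 0 < d by apply: mulr_gt0; [exact: mulr_gt0 | rewrite subr_gt0].
pose A := n%:R * (2 * K - PI * a * h) + n%:R * (2 * PI * a * h) + 2 * PI * h ^+ 2 + n%:R * (h / a).
pose B := n%:R * (2 * PI * a * h) + PI * h ^+ 2 + n%:R * ((h + 1) / a + n%:R).
pose D := (C ^+ 2) ^+ n * (C ^+ 2) ^+ n * 2 ^+ n * 2 ^+ n * n%:R.
have D0 : 0 <= D by rewrite !mulr_ge0 ?exprn_ge0.
exists (D * exp (B + (A + 1) ^+ 2 / (4 * d))) => k s sk.
have k0 : 0 <= k%:R :> R by [].
have g0 : 0 <= gauss cabs q K k.
  by apply: prodr_ge0 => i _; rewrite !mulr_ge0 ?invr_ge0 ?exprn_ge0 ?av_ge0.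
have e1 : gauss cabs q K k ^+ n <= exp (n%:R * (2 * K * k%:R - PI * a * h * (k%:R * (k%:R + 1)))).
  by rewrite -expX; apply: lerXn2r; rewrite ?nnegrE ?exp_ge0 // gauss_le.
have e2 : (1 + cabs q ^+ k.+1) ^+ n <= 2 ^+ n * exp (n%:R * ((k%:R + 1) * (2 * PI * a * h))).
  rewrite -expX -exprMn; apply: lerXn2r; rewrite ?nnegrE ?mulr_ge0 ?exp_ge0 ?addr_ge0 ?exprn_ge0 ?av_ge0 //.
  have : 1 <= exp ((k%:R + 1) * (2 * PI * a * h)).
    by rewrite -[X in X <= _]exp0; apply: ler_exp; apply: mulr_ge0; lra.
  by rewrite hq expX -[k.+1%:R]natr1; move: (exp _) => E *; lra.
have e3 : exp (PI * s ^+ 2) <= exp (PI * ((k%:R + 1) * h) ^+ 2).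
  apply: ler_exp; apply: ler_wpM2l; first exact: ltW.
  by rewrite -(real_normK (num_real s)); apply: lerXn2r; rewrite ?nnegrE // mulr_ge0 ?ltW //; lra.
have b0 : 0 <= (`|s| + 1) / a + n%:R.
  by rewrite addr_ge0 // divr_ge0 ?addr_ge0 ?(ltW a0).
have e4 : ((`|s| + 1) / a + n%:R) ^+ n <= exp (n%:R * (((k%:R + 1) * h + 1) / a + n%:R)).
  rewrite -expX; apply: lerXn2r; rewrite ?nnegrE ?exp_ge0 //.
  apply: le_trans (exp_ge1Dx _).
  have : (`|s| + 1) / a <= ((k%:R + 1) * h + 1) / a by rewrite ler_wpM2r ?invr_ge0 ?(ltW a0) ?lerD2r.
  by move=> *; lra.
rewrite /growth [(gauss _ _ _ _ * _) ^+ n]exprMn.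
apply: (@le_trans _ _ (D * exp (A * k%:R - d * k%:R ^+ 2 + B))); last first.
  by rewrite -[leRHS]mulrA; apply: ler_wpM2l => //; apply: quad_exp.
have -> : A * k%:R - d * k%:R ^+ 2 + B =
  n%:R * (2 * K * k%:R - PI * a * h * (k%:R * (k%:R + 1))) +
  n%:R * ((k%:R + 1) * (2 * PI * a * h)) + PI * ((k%:R + 1) * h) ^+ 2 +
  n%:R * (((k%:R + 1) * h + 1) / a + n%:R).
  by rewrite /A /B /d; field; rewrite gt_eqF.
move: e1 e2 e3 e4; set X1 := n%:R * (2 * K * _ - _); set X2 := n%:R * (_ * _).
set X3 := PI * (_ * h) ^+ 2; set X4 := n%:R * (_ / a + _).
rewrite !expD /D.
set E1 := exp X1; set E2 := exp X2; set E3 := exp X3; set E4 := exp X4 => e1 e2 e3 e4.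
have -> : (C ^+ 2) ^+ n * (C ^+ 2) ^+ n * 2 ^+ n * 2 ^+ n * n%:R * (E1 * E2 * E3 * E4) =
  (C ^+ 2) ^+ n * (E1 * (C ^+ 2) ^+ n) * 2 ^+ n * (2 ^+ n * E2) * (E3 * (n%:R * E4)) by ring.
have EE1 : 0 <= E1 by exact: exp_ge0.
have ps : 0 <= (C ^+ 2) ^+ n by rewrite !exprn_ge0.
have t0 : 0 <= 2 ^+ n :> R by rewrite exprn_ge0.
have gn0 : 0 <= gauss cabs q K k ^+ n by rewrite exprn_ge0.
have q0 : 0 <= (1 + cabs q ^+ k.+1) ^+ n by rewrite exprn_ge0 // addr_ge0 // exprn_ge0 // av_ge0.
have b1 : 0 <= ((`|s| + 1) / a + n%:R) ^+ n by rewrite exprn_ge0.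
have H1 : (C ^+ 2) ^+ n * (gauss cabs q K k ^+ n * (C ^+ 2) ^+ n) * 2 ^+ n <=
  (C ^+ 2) ^+ n * (E1 * (C ^+ 2) ^+ n) * 2 ^+ n.
  by apply: ler_wpM2r => //; apply: ler_wpM2l => //; apply: ler_wpM2r.
have H2 : exp (PI * s ^+ 2) * (n%:R * ((`|s| + 1) / a + n%:R) ^+ n) <= E3 * (n%:R * E4).
  by apply: ler_pM => //; [exact: exp_ge0 | exact: mulr_ge0 | exact: ler_wpM2l].
apply: ler_pM => //; [| by rewrite mulr_ge0 ?exp_ge0 ?mulr_ge0 |].
  by rewrite !mulr_ge0.
by apply: ler_pM => //; rewrite !mulr_ge0.
Qed.

End GrowthBound.

Local Open Scope complex_scope.

Lemma IZRD x y : IZR (Z.add x y) = IZR x + IZR y. Proof. exact: plus_IZR. Qed.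
Lemma IZRB x y : IZR (Z.sub x y) = IZR x - IZR y. Proof. exact: minus_IZR. Qed.
Lemma IZRN x : IZR (Z.opp x) = - IZR x. Proof. exact: opp_IZR. Qed.
Lemma IZR_nat k : IZR (Z.of_nat k) = k%:R.
Proof. by rewrite -INR_IZR_INZ INRE. Qed.

Definition gauss_fun (s : R) : R := exp (- (PI * s ^+ 2)).
Arguments gauss_fun s%_ring_scope.

(** * Moments and falling factorials *)

Section Moments.
Variables (n : nat) (ks : seq Z) (w : Z -> R[i]) (sg x : Z -> R) (s a : R).
Hypotheses (a0 : 0 < a) (xs : forall k, x k = (s - sg k) / a).
Let V : R := \sum_(i < n) cabs (\sum_(k <- ks) w k * (sg k ^+ i)%:C).
Let B := (`|s| + 1) / a + n%:R.

(** Coefficients of [binjet] are falling factorials of x = (s - σ)/a. Each factor x - l is affine in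
    σ, so removing it costs at most B and may raise the power of σ by one; the bound i + j < n keeps
    all moments among those in V. *)
Lemma moment_bound j i : (i + j < n)%N ->
  cabs (\sum_(k <- ks) w k * (sg k ^+ i)%:C * (\prod_(l < j) (x k - l%:R))%:C) <= B ^+ j * V.
Proof.
have V0 : 0 <= V by apply: sumr_ge0 => k _; exact: av_ge0.
have B0 : 0 <= B by rewrite addr_ge0 // divr_ge0 ?addr_ge0 ?(ltW a0).
elim: j i => [|j IH] i Hi.
  rewrite expr0 mul1r; rewrite addn0 in Hi.
  rewrite (eq_bigr (fun k => w k * (sg k ^+ i)%:C)) => [|k _].
    rewrite /V (bigD1 (Ordinal Hi)) //= lerDl; apply: sumr_ge0 => *; exact: av_ge0.
  by rewrite big_ord0 mulr1.
have e k : w k * (sg k ^+ i)%:C * (\prod_(l < j.+1) (x k - l%:R))%:C =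
   (s / a - j%:R)%:C * (w k * (sg k ^+ i)%:C * (\prod_(l < j) (x k - l%:R))%:C) +
   (- a^-1)%:C * (w k * (sg k ^+ i.+1)%:C * (\prod_(l < j) (x k - l%:R))%:C).
  rewrite big_ord_recr /= xs exprS.
  have -> : (s - sg k) / a - j%:R = (s / a - j%:R) + (- a^-1) * sg k by ring.
  rewrite !(rmorphM, rmorphD) /=; ring.
rewrite (eq_bigr _ (fun k _ => e k)) big_split /= -!mulr_sumr.
apply: le_trans (avD _ _ _) _; rewrite !avM.
have h1 : cabs (s / a - j%:R)%:C <= `|s| / a + j%:R.
  have -> : cabs (s / a - j%:R)%:C = `|s / a - j%:R|.
    by rewrite /av /= /cabs_fun /= expr0n /= addr0 sqrtr_sqr.
  apply: le_trans (ler_normB _ _) _.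
  by rewrite normrM normfV (gtr0_norm a0) normr_nat.
have h2 : cabs (- a^-1)%:C = a^-1.
  by rewrite rmorphN nmN cabs_real // invr_ge0 ltW.
have i1 := IH i (ltn_trans (ltnSn _) (eq_rect _ (fun k => (k < n)%N) Hi _ (addnS _ _))).
have i2 := IH i.+1 (eq_rect _ (fun k => (k < n)%N) Hi _ (esym (addSnnS _ _))).
rewrite h2 exprS -mulrA.
apply: (@le_trans _ _ ((`|s| / a + j%:R) * (B ^+ j * V) + a^-1 * (B ^+ j * V))).
  by apply: lerD; [apply: ler_pM => //; exact: av_ge0 | apply: ler_wpM2l => //; rewrite invr_ge0 ltW].
rewrite -mulrDl; apply: ler_wpM2r; first by rewrite mulr_ge0 ?exprn_ge0.
have -> : B = `|s| / a + n%:R + a^-1 by rewrite /B; ring.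
rewrite lerD2r lerD2l ler_nat ltnW //.
by apply: leq_ltn_trans Hi; rewrite addnS ltnW // ltnS leq_addl.
Qed.
End Moments.

(** * Fibre sums as jets of a Laurent polynomial *)

Section Center.
Variables (a h cc : R) (n : nat).
Hypotheses (a0 : 0 < a) (h0 : 0 < h) (n0 : (0 < n)%N) (anh : h < a * n%:R).

Definition fiber_weight (b : Z -> R[i]) (t : R) (m k : Z) : R[i] :=
  b k * cis (2 * PI * cc * IZR k * IZR m * h) * (gauss_fun (t + IZR m * h - a * IZR k))%:C.
(* The fibre sums: the sum over k at the point s = t + mh of the header, with a window t^j φ(t).
   *)
Definition psum ks b t (m : Z) (j : nat) : R[i] :=
  \sum_(k <- ks) fiber_weight b t m k * ((t + IZR m * h - a * IZR k) ^+ j)%:C.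
Definition psumV ks b t m : R := \sum_(j < n) cabs (psum ks b t m j).

(** Recentres the indices: i = M - 1 becomes m = 0 and i = M becomes m = 1. For t in [-h, 0] these
    two nodes lie on either side of the unit circle. *)
Definition ndx M (i : nat) : Z := Z.sub (Z.of_nat i) (Z.of_nat M.-1).
Definition base M (t : R) : R[i] :=
  (exp (2 * PI * a * (t - M.-1%:R * h)))%:C * cis (- (2 * PI * cc * M.-1%:R * h)).
Definition ratio : R[i] := (exp (2 * PI * a * h))%:C * cis (2 * PI * cc * h).

Lemma nodeE M t i : node (base M t) ratio i =
  (exp (2 * PI * a * (t + IZR (ndx M i) * h)))%:C * cis (2 * PI * cc * IZR (ndx M i) * h).
Proof.
rewrite /node /base /ratio exprMn -rmorphXn /= expX cisX mulrACA -rmorphM /= -expD -cisD.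
by congr ((exp _)%:C * cis _); rewrite /ndx IZRB !IZR_nat; ring.
Qed.

Lemma cabs_ratio : cabs ratio = exp (2 * PI * a * h).
Proof. by rewrite /ratio cabsZ ?exp_ge0 // cabs_cis mulr1. Qed.

(* exp(-π(s - ak)²) = exp(-πs²) exp(-πa²k²) exp(2πaks) is the power z_m^k up to factors
   depending on k or m only. *)
Lemma jet_weight (b : Z -> R[i]) M t i (k : Z) (e : nat) :
  e%:R = IZR k + (n * M)%:R ->
  (b k * (exp (- (PI * (a * IZR k) ^+ 2)))%:C) * node (base M t) ratio i ^+ e /
     node (base M t) ratio i ^+ (n * M) =
  (exp (PI * (t + IZR (ndx M i) * h) ^+ 2))%:C * fiber_weight b t (ndx M i) k.
Proof.
move=> He; rewrite nodeE; set m := ndx M i; set s := t + IZR m * h.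
set X := 2 * PI * a * s; set Y := 2 * PI * cc * IZR m * h.
have e1 : ((exp X)%:C * cis Y) ^+ e =
   (exp (IZR k * X))%:C * cis (IZR k * Y) * ((exp X)%:C * cis Y) ^+ (n * M).
  rewrite !exprMn -!rmorphXn /= !expX !cisX mulrACA -rmorphM /= -expD -cisD -!mulrDl.
  by rewrite He.
have nz : ((exp X)%:C * cis Y) ^+ (n * M) != 0.
  rewrite expf_neq0 // -(av_gt0 cabs) cabsZ ?exp_ge0 // cabs_cis mulr1; exact: exp_gt0.
rewrite e1 mulrA mulfK // /fiber_weight -/s.
have -> : gauss_fun (s - a * IZR k) = exp (- (PI * s ^+ 2)) * exp (- (PI * (a * IZR k) ^+ 2)) * exp (IZR k * X).
  by rewrite /gauss_fun -!expD; congr exp; rewrite /X; ring.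
have -> : 2 * PI * cc * IZR k * IZR m * h = IZR k * Y by rewrite /Y; ring.
have ex : (exp (PI * s ^+ 2))%:C * (exp (- (PI * s ^+ 2)))%:C = 1 :> R[i].
  by rewrite -rmorphM /= -expD subrr exp0.
rewrite !rmorphM /=; move: ex.
set E1 := (exp (PI * s ^+ 2))%:C; set E2 := (exp (- (PI * s ^+ 2)))%:C.
set E3 := (exp (- _))%:C; set E4 := (exp (IZR k * X))%:C => ex.
have -> : E1 * (b k * cis (IZR k * Y) * (E2 * E3 * E4)) =
  (E1 * E2) * (b k * E3 * (E4 * cis (IZR k * Y))) by ring.
by rewrite ex mul1r.
Qed.
End Center.
Arguments fiber_weight (a h cc)%_ring_scope b t%_ring_scope m k.
Arguments psum (a h cc)%_ring_scope ks b t%_ring_scope m j.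
Arguments psumV (a h cc)%_ring_scope n ks b t%_ring_scope m.
Arguments base (a h cc)%_ring_scope M t%_ring_scope.
Arguments ratio (a h cc)%_ring_scope.

Lemma to_nat_shift (k : Z) (T : nat) : Z.le (Z.opp (Z.of_nat T)) k ->
  Z.of_nat (Z.to_nat (Z.add k (Z.of_nat T))) = Z.add k (Z.of_nat T).
Proof. by move=> H; apply: Z2Nat.id; lia. Qed.

Lemma shift_lt (k : Z) (T : nat) : Z.lt (Z.opp (Z.of_nat T)) k -> Z.lt k (Z.of_nat T) ->
  (Z.to_nat (Z.add k (Z.of_nat T)) < T + T)%N.
Proof. lia. Qed.

Lemma shift_eq (k : Z) (T : nat) : Z.lt (Z.opp (Z.of_nat T)) k ->
  (T == Z.to_nat (Z.add k (Z.of_nat T))) = (k == 0).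
Proof. by move=> H; apply/eqP/eqP; [lia | move=> ->; rewrite Nat2Z.id]. Qed.

Section CenterBound.
Variables (a h cc : R) (n : nat).
Hypotheses (a0 : 0 < a) (h0 : 0 < h) (n0 : (0 < n)%N) (anh : h < a * n%:R).

(** By [jet_weight] the jet is exp(πs²) times a combination of the [binjet n k]; its coefficients
    are falling-factorial sums, bounded through [moment_bound] by the moments in [psumV]. *)
Lemma pn_jet_le (ks : seq Z) (b : Z -> R[i]) M t i (e : Z -> nat) :
  {in ks, forall k, (e k)%:R = IZR k + (n * M)%:R :> R} ->
  let s := t + IZR (ndx M i) * h in
  pn cabs 1 (jet n M (base a h cc M t) (ratio a h cc) ks
     (fun k => b k * (exp (- (PI * (a * IZR k) ^+ 2)))%:C) e i) <=
  exp (PI * s ^+ 2) * (n%:R * ((`|s| + 1) / a + n%:R) ^+ n) * psumV a h cc n ks b t (ndx M i).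
Proof.
rewrite /=; move=> He; set s := t + _ * h; set J := jet _ _ _ _ _ _ _ _; set m := ndx M i.
have eJ : J = \sum_(k <- ks) ((exp (PI * s ^+ 2))%:C * fiber_weight a h cc b t m k) *: binjet n (IZR k)%:C.
  rewrite /J /jet /jet_at big_seq [RHS]big_seq; apply: eq_bigr => k ik.
  rewrite (jet_weight _ _ _ _ _ _ (He k ik)); congr (_ *: binjet n _).
  have /(congr1 (real_complex R)) := He k ik.
  by rewrite rmorphD !rmorph_nat => ->; rewrite addrK.
have sJ : (size J <= n)%N.
  rewrite eJ; apply: leq_trans (size_sum _ _ _) _; apply/bigmax_leqP_seq => k _ _.
  by apply: leq_trans (size_scale_leq _ _) (size_poly _ _).
rewrite (pn_widen _ _ sJ).
set B := (`|s| + 1) / a + n%:R.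
have B1 : 1 <= B.
  rewrite /B -[leLHS]add0r lerD // ?ler1n // divr_ge0 ?addr_ge0 ?(ltW a0) //.
set V := psumV _ _ _ _ _ _ _ _.
have V0 : 0 <= V by apply: sumr_ge0 => k _; exact: av_ge0.
apply: (@le_trans _ _ (\sum_(j < n) exp (PI * s ^+ 2) * (B ^+ n * V))); last first.
  rewrite sumr_const card_ord -[leLHS]mulr_natl.
  have -> (x y z u : R) : x * (y * (z * u)) = y * (x * z) * u by ring.
  by [].
apply: ler_sum => j _; rewrite expr1n mulr1.
have -> : J`_j = (exp (PI * s ^+ 2))%:C * ((-1) ^+ j / j`!%:R) *
   \sum_(k <- ks) fiber_weight a h cc b t m k * ((s - a * IZR k) ^+ 0)%:C * (\prod_(l < j) (IZR k - l%:R))%:C.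
  rewrite eJ coef_sum mulr_sumr; apply: eq_bigr => k _.
  rewrite coefZ coef_poly ltn_ord expr0 mulr1 /binc.
  have -> : (\prod_(l < j) (IZR k - l%:R))%:C = \prod_(l < j) ((IZR k)%:C - l%:R) :> R[i].
    by rewrite rmorph_prod; apply: eq_bigr => l _; rewrite rmorphB rmorph_nat.
  ring.
rewrite !avM cabs_real ?exp_ge0 // nmV nmX nmN nm1 expr1n mul1r -mulrA.
apply: ler_wpM2l; first exact: exp_ge0.
have c1 : (cabs j`!%:R)^-1 <= 1.
  rewrite -(rmorph_nat (real_complex R)) cabs_real ?ler0n // invf_le1 ?ler1n ?ltr0n ?fact_gt0 //.
have xs k : IZR k = (s - (s - a * IZR k)) / a.
  by rewrite opprB addrCA subrr addr0 mulrAC divff ?gt_eqF // mul1r.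
have := @moment_bound n ks (fiber_weight a h cc b t m) (fun k => s - a * IZR k) (fun k => IZR k) s a a0 xs j 0.
rewrite add0n => /(_ (ltn_ord j)) mb.
rewrite -[leRHS]mul1r; apply: ler_pM => //; rewrite ?invr_ge0 ?av_ge0 //.
apply: (le_trans mb); rewrite -/B; apply: ler_wpM2r => //.
by apply: ler_weXn2l => //; apply: ltnW.
Qed.

Lemma ndx_gap (t : R) M (i : 'I_(M + M)) : (0 < M)%N -> - h <= t <= 0 ->
  `|t + IZR (ndx M i) * h| <= ((gap M i)%:R + 1) * h.
Proof.
move=> M0 /andP[t1 t2]; have h0' := h0; rewrite /ndx IZRB !IZR_nat /gap.
have [lt|le] := ltnP i M.
  rewrite gap_lo // natrB ?ltn_pred // ler_norml.
  have : (i : nat)%:R <= (M.-1)%:R :> R by rewrite ler_nat ltn_pred.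
  rewrite -subr_ge0; move: (i : nat)%:R (M.-1)%:R => x y /mulr_ge0 /(_ (ltW h0)) xy.
  by apply/andP; split; lra.
rewrite gap_hi // natrB // ler_norml -[in M%:R](prednK M0) -natr1.
have : M%:R <= (i : nat)%:R :> R by rewrite ler_nat.
rewrite -{1}(prednK M0) -natr1.
rewrite -subr_ge0; move: (i : nat)%:R (M.-1)%:R => x y /mulr_ge0 /(_ (ltW h0)) xy.
by apply/andP; split; lra.
Qed.

(** The conditional sum stands for b_0, read as 0 if 0 is not among the indices; it is the
    coefficient of index nM after the shift by nM. [core_bound] gives the weights, and
    [growth_bound] makes them decay with a constant independent of t, M and the indices. *)
Lemma center_bound : exists C : R, 0 <= C /\ forall t : R, - h <= t <= 0 ->
  forall (ks : seq Z) (b : Z -> R[i]) (M : nat), (0 < M)%N ->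
  {in ks, forall k, Z.lt (Z.opp (Z.of_nat (n * M))) k /\ Z.lt k (Z.of_nat (n * M))} ->
  cabs (\sum_(k <- ks | k == 0) b k) <=
    C * \sum_(i < M + M) exp (- (gap M i)%:R) * psumV a h cc n ks b t (ndx M i).
Proof.
have PI0 : 0 < PI by apply/RltP; exact: PI_RGT_0.
pose q := ratio a h cc; pose Q := cabs q.
have hQ : Q = exp (2 * PI * a * h) by exact: cabs_ratio.
have Q1 : 1 < Q.
  by rewrite hQ -[ltLHS]exp0; apply: ltr_exp; do !apply: mulr_gt0 => //.
have Q0 : 0 < Q := lt_trans ltr01 Q1.
pose K := KN n Q + 1.
have K1 : 1 <= K by rewrite lerDr (KN_ge0 n Q1).
have K0 : 0 <= K := le_trans ler01 K1.
pose C := exp (2 * K / (1 - Q^-1)).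
have HC L : \prod_(k < L) (1 + 2 * K * Q ^- k) <= C.
  rewrite (eq_bigr (fun k : 'I_L => 1 + (2 * K) * Q^-1 ^+ k)) => [|k _]; last by rewrite exprVn.
  by apply: prod_exp_le; rewrite ?mulr_ge0 // invr_ge0 (ltW Q0) invf_lt1.
have [G HG] := growth_bound a0 h0 n0 anh hQ K1 (exp_ge0 _ : 0 <= C).
exists (Num.max G 0); split=> [|t /andP[t1 t2] ks b M M0 Hk]; first by rewrite le_max lexx orbT.
pose e k := Z.to_nat (Z.add k (Z.of_nat (n * M))).
have He k : k \in ks -> (e k)%:R = IZR k + (n * M)%:R :> R.
  move=> ik; by rewrite -!IZR_nat -IZRD to_nat_shift //; apply: Z.lt_le_incl; case: (Hk k ik).
pose b' k := b k * (exp (- (PI * (a * IZR k) ^+ 2)))%:C.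
have v00 : base a h cc M t != 0.
  by rewrite -(av_gt0 cabs) cabsZ ?exp_ge0 // cabs_cis mulr1 exp_gt0.
have cn i : cabs (node (base a h cc M t) q i) = exp (2 * PI * a * (t + IZR (ndx M i) * h)).
  by rewrite nodeE cabsZ ?exp_ge0 // cabs_cis mulr1.
have ndx0 : IZR (ndx M M.-1) = 0 by rewrite /ndx IZRB subrr.
have ndx1 : IZR (ndx M M) = 1 by rewrite /ndx IZRB !IZR_nat -[in M%:R](prednK M0) -natr1; ring.
have pa : 0 <= 2 * PI * a := mulr_ge0 (mulr_ge0 (ler0n _ 2) (ltW PI0)) (ltW a0).
have hin : cabs (node (base a h cc M t) q M.-1) <= 1.
  by rewrite cn ndx0 mul0r addr0 -[leRHS]exp0 ler_exp // mulr_ge0_le0.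
have hout : 1 <= cabs (node (base a h cc M t) q M).
  by rewrite cn ndx1 mul1r -[leLHS]exp0 ler_exp // mulr_ge0 // -lerBlDr sub0r.
have sz : (size (sparse ks b' e) <= n * (M + M))%N.
  rewrite /sparse; apply: leq_trans (size_sum _ _ _) _; apply/bigmax_leqP_seq => k ik _.
  apply: leq_trans (size_scale_leq _ _) _; rewrite size_polyXn /e.
  by case: (Hk k ik) => *; rewrite mulnDr; apply: shift_lt.
have KQ : KN n Q <= K by rewrite lerDl.
have main := core_bound Q1 M0 v00 hin hout KQ K1 HC sz.
have -> : \sum_(k <- ks | k == 0) b k = (sparse ks b' e)`_(n * M).
  rewrite /sparse coef_sum [RHS]big_seq big_mkcond /= [LHS]big_seq; apply: eq_bigr => k ik.
  rewrite coefZ coefXn /b'.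
  have -> : (n * M == e k)%N = (k == 0) by apply: shift_eq; case: (Hk k ik).
  case: eqP => [->|_]; last by rewrite mulr0.
  have -> : IZR 0 = 0 :> R by [].
  by rewrite mulr0 expr0n /= mulr0 oppr0 exp0 !mulr1.
apply: (le_trans main); rewrite mulr_sumr; apply: ler_sum => i _.
have H := pn_jet_le b t i He.
apply: (@le_trans _ _ (growth cabs n q K C (gap M i) * (exp (PI * (t + IZR (ndx M i) * h) ^+ 2) *
   (n%:R * ((`|t + IZR (ndx M i) * h| + 1) / a + n%:R) ^+ n) * psumV a h cc n ks b t (ndx M i)))).
  apply: ler_wpM2l H; rewrite /growth.
  have c0 : 0 <= C ^+ 2 by apply: sqr_ge0.
  have g0 : 0 <= gauss cabs q K (gap M i).
    by apply: prodr_ge0 => j _; rewrite !mulr_ge0 ?invr_ge0 ?exprn_ge0 ?av_ge0.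
  apply: mulr_ge0; last by apply: exprn_ge0; rewrite addr_ge0 // exprn_ge0 // av_ge0.
  have d0 : 0 <= (C ^+ 2) ^+ n by rewrite exprn_ge0.
  have d1 : 0 <= (gauss cabs q K (gap M i) * C ^+ 2) ^+ n by rewrite exprn_ge0 // mulr_ge0.
  by apply: mulr_ge0; [exact: mulr_ge0 | rewrite exprn_ge0].
have := HG (gap M i) (t + IZR (ndx M i) * h) (ndx_gap i M0 _).
rewrite t1 t2 => /(_ isT).
have V0 : 0 <= psumV a h cc n ks b t (ndx M i) by apply: sumr_ge0 => j _; exact: av_ge0.
have x0 := exp_ge0 (- (gap M i)%:R).
move: (growth _ _ _ _ _ _) (exp (PI * _) * _) (psumV _ _ _ _ _ _ _ _) (exp _) V0 x0 => g E V x V0 x0 Hg.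
rewrite mulrA mulrA; apply: ler_wpM2r => //; apply: (le_trans Hg).
by apply: ler_wpM2r => //; rewrite le_max lexx.
Qed.
End CenterBound.

Section Schur.
Variable F : realFieldType.

(** * Schur's test *)

(** Nonnegativity of the weighted variance Σ W (V - T/S)², where S only needs to exceed the total
    weight. *)
Lemma wsum_sqr_le (J : Type) (L : seq J) (W V : J -> F) (S : F) : 0 < S ->
  (forall j, 0 <= W j) -> \sum_(j <- L) W j <= S ->
  (\sum_(j <- L) W j * V j) ^+ 2 <= S * \sum_(j <- L) W j * V j ^+ 2.
Proof.
move=> S0 W0 WS; set T := \sum_(j <- L) W j * V j; set U := \sum_(j <- L) W j * V j ^+ 2.
have H : 0 <= \sum_(j <- L) W j * (V j - T / S) ^+ 2.
  by apply: sumr_ge0 => j _; rewrite mulr_ge0 ?sqr_ge0.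
have e : \sum_(j <- L) W j * (V j - T / S) ^+ 2 =
    U - 2 * (T / S) * T + (T / S) ^+ 2 * \sum_(j <- L) W j.
  rewrite {1}/U {3}/T !mulr_sumr -sumrB -big_split /=; apply: eq_bigr => j _; ring.
rewrite e in H.
have H2 : (T / S) ^+ 2 * (\sum_(j <- L) W j) <= (T / S) ^+ 2 * S by rewrite ler_wpM2l ?sqr_ge0.
have H3 : 0 <= U - T ^+ 2 / S.
  apply: le_trans (_ : U - 2 * (T / S) * T + (T / S) ^+ 2 * S <= _); first by lra.
  by rewrite le_eqVlt; apply/orP; left; apply/eqP; field; rewrite gt_eqF.
by rewrite mulrC -ler_pdivrMr // -subr_ge0.
Qed.

(** Weighted Cauchy-Schwarz in each row, followed by an exchange of sums and the column bound. *)
Lemma schur_test (I J : Type) (L1 : seq I) (L2 : seq J) (W : I -> J -> F)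
    (y : I -> F) (V : J -> F) (S1 S2 : F) :
  0 < S1 -> 0 < S2 -> (forall i j, 0 <= W i j) -> (forall i, 0 <= y i) ->
  (forall i, \sum_(j <- L2) W i j <= S1) -> (forall j, \sum_(i <- L1) W i j <= S2) ->
  (forall i, y i <= \sum_(j <- L2) W i j * V j) ->
  \sum_(i <- L1) y i ^+ 2 <= S1 * S2 * \sum_(j <- L2) V j ^+ 2.
Proof.
move=> S10 S20 W0 y0 H1 H2 Hy.
apply: (@le_trans _ _ (\sum_(i <- L1) S1 * \sum_(j <- L2) W i j * V j ^+ 2)).
  apply: ler_sum => i _; apply: le_trans (wsum_sqr_le _ S10 (W0 i) (H1 i)).
  by apply: lerXn2r; rewrite ?nnegrE //; apply: le_trans (Hy i).
rewrite -mulr_sumr exchange_big /= -mulrA; apply: ler_wpM2l; first exact: ltW.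
rewrite mulr_sumr; apply: ler_sum => j _.
by rewrite -mulr_suml; apply: ler_wpM2r; rewrite ?sqr_ge0.
Qed.

Lemma sqr_sum_le (n : nat) (V : 'I_n -> F) : (0 < n)%N ->
  (\sum_(j < n) V j) ^+ 2 <= n%:R * \sum_(j < n) V j ^+ 2.
Proof.
move=> n0.
have := @wsum_sqr_le _ (index_enum 'I_n) (fun=> 1) V n%:R.
rewrite ltr0n n0 ler01 sumr_const card_ord lexx => /(_ isT (fun=> isT) isT).
rewrite (eq_bigr V) => [|i _]; last by rewrite mul1r.
by rewrite [X in _ <= _ * X](eq_bigr (fun i => V i ^+ 2)) // => i _; rewrite mul1r.
Qed.

Lemma sum_subset (T : eqType) (L L' : seq T) (f : T -> F) :
  uniq L -> uniq L' -> {subset L <= L'} -> (forall x, 0 <= f x) ->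
  \sum_(x <- L) f x <= \sum_(x <- L') f x.
Proof.
move=> u u' sub f0; rewrite [leRHS](bigID (mem L)) /= -[X in _ <= X + _]big_filter.
rewrite [X in _ <= X + _](perm_big L) /=; first by rewrite lerDl sumr_ge0.
apply: uniq_perm; rewrite ?filter_uniq // => x; rewrite mem_filter andb_idr //.
exact: sub.
Qed.
End Schur.

(** * Sums over finite sets of integers *)

Definition zr (M : nat) : seq Z :=
  [seq Z.of_nat i | i <- iota 0 M] ++ [seq Z.opp (Z.of_nat i.+1) | i <- iota 0 M].

Lemma mem_zr M z : (z \in zr M) <-> (Z.le (Z.opp (Z.of_nat M)) z /\ Z.lt z (Z.of_nat M)).
Proof.
rewrite mem_cat; split.
  by case/orP => /mapP[ii]; rewrite mem_iota => /andP[_ hi] ->; lia.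
move=> [h1 h2]; apply/orP; case: (Z_lt_le_dec z Z0) => hz.
  right; apply/mapP; exists (Z.to_nat (Z.sub (Z.opp z) 1)); last by lia.
  by rewrite mem_iota; lia.
left; apply/mapP; exists (Z.to_nat z); last by lia.
by rewrite mem_iota; lia.
Qed.

Lemma uniq_zr M : uniq (zr M).
Proof.
rewrite cat_uniq !map_inj_in_uniq ?iota_uniq ?andbT /=; last 2 first.
- by move=> i j _ _; lia.
- by move=> i j _ _; lia.
by apply/hasPn => z /mapP[ii _ ->]; apply/negP => /mapP[j _]; lia.
Qed.

Lemma sub_zr (L : seq Z) : exists M : nat, {subset L <= zr M}.
Proof.
elim: L => [|z L [M IH]]; first by exists 0%N.
exists (M + (Z.to_nat (Z.abs z)).+1)%N => x; rewrite inE => /orP[/eqP->|/IH/mem_zr]; move=> *; apply/mem_zr; lia.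
Qed.

Lemma zadd_inj z : injective (Z.add z). Proof. by move=> i j; lia. Qed.

Lemma exists_floor (x : R) : exists z : Z, IZR z <= x < IZR z + 1.
Proof.
exists (Z.sub (up x) 1); have [/RltP h1 /RleP h2] := archimed x.
have e1 : IZR 1 = 1 by []. rewrite IZRB e1; move: h1 h2; rewrite RminusE => h1 h2; apply/andP; split; lra.
Qed.

(** Replacing x by its floor costs exp(eta) and is an injective reindexing; two geometric series
    remain. The bound is thus uniform in x. *)
Lemma sum_exp_Z (eta : R) : 0 < eta -> exists S : R, 0 < S /\
  forall (L : seq Z) (x : R), uniq L ->
  \sum_(m <- L) exp (- (eta * `|x + IZR m|)) <= S.
Proof.
move=> e0; set r := exp (- eta).
have r1 : r < 1 by rewrite /r -[ltRHS]exp0; apply: ltr_exp; rewrite oppr_lt0.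
have r0 : 0 < r := exp_gt0 _.
have rr0 : 0 < (1 - r)^-1 by rewrite invr_gt0 subr_gt0.
have geom M : \sum_(i < M) r ^+ i <= (1 - r)^-1.
  apply: (@le_trans _ _ ((1 - r ^+ M) / (1 - r))).
    elim: M => [|M IH]; first by rewrite big_ord0 expr0 subrr mul0r.
    rewrite big_ord_recr /=; apply: le_trans (lerD IH (lexx _)) _.
    rewrite le_eqVlt; apply/orP; left; apply/eqP; rewrite exprS; field.
    by rewrite subr_eq0 gt_eqF.
  by rewrite ler_piMl ?(ltW rr0) // gerBl exprn_ge0 // ltW.
have sz M : \sum_(m <- zr M) exp (- (eta * `|IZR m|)) <= 2 * (1 - r)^-1.
  have eio : iota 0 M = index_iota 0 M by rewrite /index_iota subn0.
  rewrite /zr big_cat !big_map mulr2n mulrDl !mul1r; apply: lerD.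
    rewrite eio big_mkord; apply: le_trans (geom M).
    apply: ler_sum => i _; rewrite IZR_nat normr_nat expX; apply: ler_exp.
    by rewrite mulrN mulrC.
  rewrite eio big_mkord; apply: le_trans (geom M).
  apply: ler_sum => i _; rewrite IZRN normrN IZR_nat normr_nat expX; apply: ler_exp.
  by rewrite mulrN lerN2 mulrC ler_wpM2l ?(ltW e0) // ler_nat.
exists (exp eta * (2 * (1 - r)^-1)); split.
  by apply: mulr_gt0; [exact: exp_gt0 | exact: mulr_gt0].
move=> L x uL; have [z /andP[z1 z2]] := exists_floor x.
have [M HM] := sub_zr [seq Z.add z m | m <- L].
apply: (@le_trans _ _ (\sum_(m <- L) exp eta * exp (- (eta * `|IZR (Z.add z m)|)))).
  apply: ler_sum => m _; rewrite -expD; apply: ler_exp; rewrite IZRD.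
  have : `|IZR z + IZR m| <= `|x + IZR m| + 1.
    have -> : IZR z + IZR m = (x + IZR m) + (IZR z - x) by ring.
    by apply: le_trans (ler_normD _ _) _; rewrite lerD2l ler_norml; apply/andP; split; lra.
  by rewrite -(ler_pM2l e0) mulrDr mulr1 => ?; lra.
rewrite -mulr_sumr; apply: ler_wpM2l; first exact: exp_ge0.
apply: le_trans (sz M); rewrite -(big_map (Z.add z) xpredT (fun m => exp (- (eta * `|IZR m|)))).
apply: sum_subset => //; [|exact: uniq_zr|by move=> *; exact: exp_ge0].
by rewrite map_inj_uniq //; exact: zadd_inj.
Qed.

Arguments exists_floor x%_ring_scope.

Section FiberBounds.
Variables (a h cc : R) (n : nat).
Hypotheses (a0 : 0 < a) (h0 : 0 < h) (n0 : (0 < n)%N).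
Local Notation psum := (psum a h cc).
Local Notation psumV := (psumV a h cc n).
(** Decay in the distance from the fibre point t + mh to the translate ak, in units of h. Row and
    column sums are bounded uniformly in t, as Schur's test requires. *)
Let W (k m : Z) (t : R) : R := exp (- (h^-1 * `|t + IZR m * h - a * IZR k|)).

Lemma fiber_row : exists S : R, 0 < S /\ forall (L : seq Z) t k, uniq L ->
  \sum_(m <- L) W k m t <= S.
Proof.
have [S [S0 HS]] := sum_exp_Z ltr01; exists S; split=> // L t k uL.
apply: le_trans (HS L ((t - a * IZR k) / h) uL); apply: ler_sum => m _; rewrite /W.
rewrite le_eqVlt; apply/orP; left; apply/eqP; congr (exp (- _)).
have hp : 0 <= h^-1 by rewrite invr_ge0 ltW.
rewrite mul1r -{1}(ger0_norm hp) -normrM; congr (`|_|).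
by field; rewrite gt_eqF.
Qed.

Lemma fiber_col : exists S : R, 0 < S /\ forall (L : seq Z) t m, uniq L ->
  \sum_(k <- L) W k m t <= S.
Proof.
have ah : 0 < a / h by rewrite divr_gt0.
have [S [S0 HS]] := sum_exp_Z ah; exists S; split=> // L t m uL.
apply: le_trans (HS L (- (t + IZR m * h) / a) uL); apply: ler_sum => k _; rewrite /W.
rewrite le_eqVlt; apply/orP; left; apply/eqP; congr (exp (- _)).
have hp : 0 <= h^-1 by rewrite invr_ge0 ltW.
rewrite -normrN -{1}(ger0_norm hp) -{1}(ger0_norm (ltW ah)) -!normrM; congr (`|_|).
by field; rewrite !gt_eqF.
Qed.

End FiberBounds.

Lemma zsubK k k0 : Z.add (Z.sub k k0) k0 = k. Proof. lia. Qed.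
Lemma zsub_eq0 (k k0 : Z) : (Z.sub k k0 == 0) = (k == k0).
Proof. by apply/eqP/eqP; lia. Qed.
Lemma zr_diff (n K : nat) (k k0 : Z) : (0 < n)%N -> k \in zr K -> k0 \in zr K ->
  Z.lt (Z.opp (Z.of_nat (n * (K + K).+1))) (Z.sub k k0) /\
  Z.lt (Z.sub k k0) (Z.of_nat (n * (K + K).+1)).
Proof.
move=> n0 /mem_zr h1 /mem_zr h2.
have : ((K + K).+1 <= n * (K + K).+1)%N by rewrite leq_pmull.
lia.
Qed.
Lemma zr_window (M1 M2 M i : nat) (m0 : Z) : (i < M1 + M1)%N -> m0 \in zr M2 ->
  (M1 + M2 <= M)%N -> Z.add m0 (ndx M1 i) \in zr M.
Proof. by move=> hi /mem_zr hm le; apply/mem_zr; rewrite /ndx; lia. Qed.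
Lemma ndx_inj M (m0 : Z) (i j : nat) : Z.add m0 (ndx M i) = Z.add m0 (ndx M j) -> i = j.
Proof. by rewrite /ndx; lia. Qed.
Lemma mem_zrP M z : `|IZR z| < M%:R -> z \in zr M.
Proof.
rewrite -IZR_nat ltr_norml -IZRN => /andP[/RltP h1 /RltP h2]; apply/mem_zr.
by have := lt_IZR _ _ h1; have := lt_IZR _ _ h2; lia.
Qed.

Section Fiber.
Variables (a h cc : R) (n : nat).
Hypotheses (a0 : 0 < a) (h0 : 0 < h) (n0 : (0 < n)%N).
Local Notation psum := (psum a h cc).
Local Notation psumV := (psumV a h cc n).

(** * Bounds for the fibre sums *)

(* Translation by the lattice point (k0, m0) reduces the bound for b_{k0} to [center_bound]. *)
Lemma psum_recenter ks b (t : R) (k0 m0 m : Z) j :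
  psum [seq Z.sub k k0 | k <- ks]
     (fun k => b (Z.add k k0) * cis (2 * PI * cc * IZR k * IZR m0 * h))
     (t - a * IZR k0 + IZR m0 * h) m j =
  cis (- (2 * PI * cc * IZR k0 * IZR (Z.add m0 m) * h)) * psum ks b t (Z.add m0 m) j.
Proof.
rewrite /psum big_map mulr_sumr; apply: eq_bigr => k _.
rewrite /fiber_weight zsubK IZRB IZRD.
have -> : t - a * IZR k0 + IZR m0 * h + IZR m * h - a * (IZR k - IZR k0) =
   t + (IZR m0 + IZR m) * h - a * IZR k by ring.
rewrite !mulrA; congr (_ * _ * _); rewrite -mulrA -cisD [RHS]mulrAC -cisD mulrC.
congr (cis _ * _); ring.
Qed.

(** For each k0 some m0 moves t - a k0 into [-h, 0], where [center_bound] controls |b_(k0)| by the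
    fibre with weights exp(-gap). A gap is at least |t + mh - a k0|/h - 1, so the weights decay off
    the diagonal and Schur's test sums over k0. The truncation must contain every translated window,
    hence depends on the indices but not on t or b. *)
Lemma fiber_lower : h < a * n%:R -> exists A : R, 0 < A /\ forall ks : seq Z, uniq ks ->
  exists M0 : nat, forall M, (M0 <= M)%N -> forall (t : R), `|t| <= h -> forall b,
  A * \sum_(k <- ks) cabs (b k) ^+ 2 <=
    \sum_(m <- zr M) \sum_(j < n) cabs (psum ks b t m j) ^+ 2.
Proof.
move=> anh; have [C [C0 HC]] := center_bound cc a0 h0 n0 anh.
have [S1 [S10 HS1]] := fiber_row a h0.
have [S2 [S20 HS2]] := fiber_col a0 h0.
(* exp 1 absorbs the 1 in the bound (gap + 1)h of [ndx_gap]; C + 1 is positive even for C = 0. *)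
pose D := (C + 1) * exp 1.
have D0 : 0 < D by rewrite mulr_gt0 ?exp_gt0 // ltr_pwDr.
have n0' : 0 < n%:R :> R by rewrite ltr0n.
pose A := ((D * S1) * (D * S2) * n%:R)^-1.
have A0 : 0 < A by rewrite invr_gt0; exact: mulr_gt0 (mulr_gt0 (mulr_gt0 D0 S10) (mulr_gt0 D0 S20)) n0'.
exists A; split=> // ks uks.
have [K HK] := sub_zr ks.
pose M1 := (K + K).+1.
have [bd Hbd] : exists bd : nat, forall t : R, `|t| <= h -> forall k, k \in ks ->
   forall m0, - h <= t - a * IZR k + IZR m0 * h <= 0 -> m0 \in zr bd.
  pose X := (h + a * K.+1%:R) / h + 2.
  exists (Num.bound X) => t th k kk m0 /andP[m1 m2]; apply: mem_zrP.
  apply: le_lt_trans (_ : X < _); last by apply: archi_boundP; rewrite addr_ge0 // divr_ge0 ?addr_ge0 ?mulr_ge0 ?(ltW h0) ?(ltW a0).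
  have kb : `|IZR k| <= K.+1%:R.
    have /mem_zr[e1 e2] := HK k kk.
    rewrite -IZR_nat ler_norml -IZRN; apply/andP; split; apply/RleP; apply: IZR_le; move: e1 e2; clear; lia.
  have ak : `|a * IZR k| <= a * K.+1%:R by rewrite normrM (gtr0_norm a0) ler_wpM2l // ltW.
  rewrite -(ler_pM2r h0) -{1}(gtr0_norm h0) -normrM /X mulrDl divfK ?gt_eqF //.
  move: th ak m1 m2; move: (IZR m0 * h) (a * IZR k) (a * K.+1%:R) => x y z.
  rewrite !ler_norml => /andP[? ?] /andP[? ?] ? ?; have h0' := h0; apply/andP; split; lra.
exists (M1 + bd)%N => M leM t th b.
pose W (k m : Z) : R := exp (- (h^-1 * `|t + IZR m * h - a * IZR k|)).
have W0 k m : 0 <= W k m by exact: exp_ge0.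
have V0 m : 0 <= psumV ks b t m by apply: sumr_ge0 => j _; exact: av_ge0.
have key k0 : k0 \in ks -> cabs (b k0) <= \sum_(m <- zr M) (D * W k0 m) * psumV ks b t m.
  move=> k0s.
  have [m0 Hm0] : exists m0, - h <= t - a * IZR k0 + IZR m0 * h <= 0.
    have [z /andP[z1 z2]] := exists_floor ((t - a * IZR k0) / h).
    exists (Z.sub (Z.opp z) 1); rewrite IZRB IZRN; have e1 : IZR 1 = 1 by []. rewrite e1.
    rewrite ler_pdivlMr // in z1; rewrite ltr_pdivrMr // in z2.
    by move: z1 z2; move: (a * IZR k0) => y *; apply/andP; split; lra.
  have m0s := Hbd t th k0 k0s m0 Hm0.
  set t' := t - a * IZR k0 + IZR m0 * h in Hm0.
  pose ks' := [seq Z.sub k k0 | k <- ks].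
  pose b' k := b (Z.add k k0) * cis (2 * PI * cc * IZR k * IZR m0 * h).
  have Hks' : {in ks', forall k, Z.lt (Z.opp (Z.of_nat (n * M1))) k /\ Z.lt k (Z.of_nat (n * M1))}.
    by move=> k /mapP[k1 k1s ->]; apply: zr_diff => //; apply: HK.
  have := HC t' Hm0 ks' b' M1 isT Hks'.
  have -> : \sum_(k <- ks' | k == 0) b' k = b k0.
    rewrite /ks' big_map (eq_bigl (fun k => k == k0)) => [|k]; last exact: zsub_eq0.
    rewrite -big_filter filter_pred1_uniq // big_seq1 /b' zsubK IZRB subrr.
    by rewrite mulr0 !mul0r cis0 mulr1.
  move=> h1; apply: (le_trans h1); rewrite mulr_sumr.
  have VE (i : nat) : psumV ks' b' t' (ndx M1 i) = psumV ks b t (Z.add m0 (ndx M1 i)).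
    apply: eq_bigr => j _; rewrite /ks' /b' /t' psum_recenter avM cabs_cis mul1r.
    by [].
  apply: (@le_trans _ _ (\sum_(m <- [seq Z.add m0 (ndx M1 (i : 'I_(M1 + M1))) | i <- index_enum 'I_(M1 + M1)])
     (D * W k0 m) * psumV ks b t m)); last first.
    apply: sum_subset.
    - rewrite map_inj_uniq ?index_enum_uniq // => i j /ndx_inj; exact: val_inj.
    - exact: uniq_zr.
    - by move=> m /mapP[i _ ->]; apply: zr_window m0s leM; apply: ltn_ord.
    - by move=> m; apply: mulr_ge0 => //; apply: mulr_ge0 => //; exact: ltW D0.
  rewrite big_map; apply: ler_sum => i _; rewrite VE mulrA; apply: ler_wpM2r => //.
  rewrite /D -mulrA; apply: ler_pM; rewrite ?exp_ge0 //; first by rewrite lerDl.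
  rewrite /W -expD; apply: ler_exp.
  have := ndx_gap h0 i isT Hm0; rewrite -ler_pdivrMr //.
  have -> : t + IZR (Z.add m0 (ndx M1 i)) * h - a * IZR k0 = t' + IZR (ndx M1 i) * h.
    by rewrite IZRD /t'; ring.
  by rewrite mulrC => ?; lra.
(* [schur_test] asks for the pointwise bound at every index, while [key] holds on ks. *)
pose y k := if k \in ks then cabs (b k) else 0.
have := @schur_test R Z Z ks (zr M) (fun k m => D * W k m) y (psumV ks b t) (D * S1) (D * S2).
have -> : \sum_(k <- ks) y k ^+ 2 = \sum_(k <- ks) cabs (b k) ^+ 2.
  by rewrite big_seq [RHS]big_seq; apply: eq_bigr => k kk; rewrite /y kk.
move=> sch.
have H : \sum_(k <- ks) cabs (b k) ^+ 2 <= D * S1 * (D * S2) * \sum_(m <- zr M) psumV ks b t m ^+ 2.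
  apply: sch => //; [exact: mulr_gt0 D0 S10 | exact: mulr_gt0 D0 S20 | | | | |].
  - by move=> k m; apply: mulr_ge0 => //; exact: ltW D0.
  - by move=> k; rewrite /y; case: ifP => // _; exact: av_ge0.
  - by move=> k; rewrite -mulr_sumr ler_wpM2l ?(ltW D0) //; apply: HS1; exact: uniq_zr.
  - by move=> m; rewrite -mulr_sumr ler_wpM2l ?(ltW D0) //; apply: HS2.
  - move=> k; rewrite /y; case: ifP => kk; first exact: key.
    by apply: sumr_ge0 => m _; apply: mulr_ge0 => //; apply: mulr_ge0 => //; exact: ltW D0.
have H2 : \sum_(m <- zr M) psumV ks b t m ^+ 2 <=
    n%:R * \sum_(m <- zr M) \sum_(j < n) cabs (psum ks b t m j) ^+ 2.
  by rewrite mulr_sumr; apply: ler_sum => m _; exact: sqr_sum_le.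
have DS0 : 0 < D * S1 * (D * S2) := mulr_gt0 (mulr_gt0 D0 S10) (mulr_gt0 D0 S20).
rewrite /A -ler_pdivlMl ?invr_gt0 ?(mulr_gt0 DS0 n0') // invrK; apply: (le_trans H).
by rewrite -[leRHS]mulrA; apply: ler_wpM2l => //; exact: ltW.
Qed.

Lemma gauss_decay (kap : R) : exists D : R, 0 < D /\ forall (x : R) (j : nat), (j < n)%N ->
  gauss_fun x * `|x| ^+ j <= D * exp (- (kap * `|x|)).
Proof.
have PI0 : 0 < PI by apply/RltP; exact: PI_RGT_0.
exists (exp (0 + (n%:R + kap - 1 + 1) ^+ 2 / (4 * PI))); split=> [|x j jn]; first exact: exp_gt0.
have := quad_exp (n%:R + kap - 1) 0 `|x| PI0.
have e1 : `|x| ^+ j <= exp (n%:R * `|x|).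
  apply: (@le_trans _ _ (exp `|x| ^+ j)).
    apply: lerXn2r; rewrite ?nnegrE ?exp_ge0 //; apply: le_trans (exp_ge1Dx _); lra.
  by rewrite expX; apply: ler_exp; rewrite ler_wpM2r // ler_nat ltnW.
move=> H; apply: (@le_trans _ _ (gauss_fun x * exp (n%:R * `|x|))).
  by apply: ler_wpM2l => //; exact: exp_ge0.
have -> : gauss_fun x * exp (n%:R * `|x|) =
    exp ((n%:R + kap - 1) * `|x| - PI * `|x| ^+ 2 + 0) * exp (- ((kap - 1) * `|x|)).
  by rewrite /gauss_fun -!expD -normrX (ger0_norm (sqr_ge0 x)); congr exp; ring.
apply: le_trans (ler_wpM2r (exp_ge0 _) H) _.
rewrite -[leLHS]mulrA; apply: ler_wpM2l; first exact: exp_ge0.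
by rewrite -expD; apply: ler_exp; lra.
Qed.

Lemma cabs_psum_le ks b t m j :
  cabs (psum ks b t m j) <= \sum_(k <- ks) gauss_fun (t + IZR m * h - a * IZR k) *
     `|t + IZR m * h - a * IZR k| ^+ j * cabs (b k).
Proof.
apply: le_trans (nm_sum _ _ _ _) _; apply: ler_sum => k _.
rewrite /fiber_weight !avM cabs_cis mulr1 cabs_real ?exp_ge0 //.
have -> (x : R) : cabs x%:C = `|x| by rewrite /av /= /cabs_fun /= expr0n /= addr0 sqrtr_sqr.
by rewrite normrX -mulrA mulrC.
Qed.

(** The weights φ(x)|x|^j decay at least like exp(-|x|/h) by [gauss_decay], so Schur's test applies
    for each j with the kernel of [fiber_row] and [fiber_col]. *)
Lemma fiber_upper : exists B : R, 0 < B /\ forall (ks : seq Z), uniq ks -> forall (t : R) b M,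
  \sum_(m <- zr M) \sum_(j < n) cabs (psum ks b t m j) ^+ 2 <=
    B * \sum_(k <- ks) cabs (b k) ^+ 2.
Proof.
have [S1 [S10 HS1]] := fiber_row a h0.
have [S2 [S20 HS2]] := fiber_col a0 h0.
have [D [D0 HD]] := gauss_decay h^-1.
have n0' : 0 < n%:R :> R by rewrite ltr0n.
exists (n%:R * (D * S2 * (D * S1))); split=> [|ks uks t b M].
  exact: mulr_gt0 n0' (mulr_gt0 (mulr_gt0 D0 S20) (mulr_gt0 D0 S10)).
rewrite exchange_big /=.
apply: (@le_trans _ _ (\sum_(j < n) D * S2 * (D * S1) * \sum_(k <- ks) cabs (b k) ^+ 2)); last first.
  by rewrite sumr_const card_ord -[leLHS]mulr_natl mulrA.
apply: ler_sum => j _.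
apply: (@schur_test R Z Z (zr M) ks (fun m k => D * exp (- (h^-1 * `|t + IZR m * h - a * IZR k|)))
  (fun m => cabs (psum ks b t m j)) (fun k => cabs (b k))).
- exact: mulr_gt0.
- exact: mulr_gt0.
- by move=> m k; rewrite mulr_ge0 ?exp_ge0 // ltW.
- by move=> m; exact: av_ge0.
- by move=> m; rewrite -mulr_sumr ler_wpM2l ?(ltW D0) //; apply: HS2.
- by move=> k; rewrite -mulr_sumr ler_wpM2l ?(ltW D0) //; apply: HS1; exact: uniq_zr.
move=> m; apply: le_trans (cabs_psum_le _ _ _ _ _) _; apply: ler_sum => k _.
by apply: ler_wpM2r; rewrite ?av_ge0 // HD.
Qed.

End Fiber.

(** * Polynomials with prescribed zeros *)

(** For 0 <= z <= 1, 1/(1 - θz) <= 1 + θz/(1 - θ) <= exp(θz/(1 - θ)); the exponents then sum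
    geometrically. *)
Lemma prod_exp_ge (th x : R) L : 0 <= th < 1 -> 0 <= x < 1 ->
  exp (- (th / ((1 - th) * (1 - x)))) <= \prod_(k < L) (1 - th * x ^+ k).
Proof.
move=> /andP[t0 t1] /andP[x0 x1].
have t1' : 0 < 1 - th by rewrite subr_gt0.
have x1' : 0 < 1 - x by rewrite subr_gt0.
apply: (@le_trans _ _ (exp (- (th / (1 - th) * ((1 - x ^+ L) / (1 - x)))))).
  have -> : th / ((1 - th) * (1 - x)) = th / (1 - th) * (1 - x)^-1 by rewrite invfM mulrA.
  apply: ler_exp; rewrite lerN2; apply: ler_wpM2l.
    by rewrite mulr_ge0 // invr_ge0 ltW.
  by rewrite ler_piMl ?invr_ge0 ?(ltW x1') // gerBl exprn_ge0.
elim: L => [|L IH].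
  by rewrite big_ord0 expr0 subrr mul0r mulr0 oppr0 exp0.
rewrite big_ord_recr /=.
have -> : - (th / (1 - th) * ((1 - x ^+ L.+1) / (1 - x))) =
    - (th / (1 - th) * ((1 - x ^+ L) / (1 - x))) + - (th / (1 - th) * x ^+ L).
  by rewrite exprS; field; rewrite !gt_eqF.
rewrite expD; apply: ler_pM; rewrite ?exp_ge0 //.
set z := x ^+ L; have z0 : 0 <= z by rewrite exprn_ge0.
have z1 : z <= 1 by rewrite exprn_ile1 // ltW.
have zt : th * z <= th by rewrite ler_piMr.
have p : 0 < 1 - th * z by rewrite subr_gt0 (le_lt_trans zt).
rewrite expN -[leRHS]invrK lef_pV2 ?posrE ?exp_gt0 ?invr_gt0 //.
apply: le_trans (exp_ge1Dx _).
rewrite -subr_ge0.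
have -> : 1 + th / (1 - th) * z - (1 - th * z)^-1 =
   th * z * ((1 - th)^-1 - (1 - th * z)^-1) by field; rewrite !gt_eqF.
rewrite mulr_ge0 ?mulr_ge0 // subr_ge0 lef_pV2 ?posrE //; lra.
Qed.

Section FailPoly.
Variables (a h cc : R) (n M : nat).
Hypotheses (a0 : 0 < a) (h0 : 0 < h).

(* The zeros lie half way, in logarithmic scale, between consecutive nodes of the fibre t = 0;
   they are the nodes of the fibre t = -h/2. *)
Definition zero_radius (l : nat) : R := exp (2 * PI * a * (l%:R + 2^-1) * h).
Definition outer_zero (l : nat) : R[i] := (zero_radius l)%:C * cis (2 * PI * cc * l.+1%:R * h).
Definition inner_zero (l : nat) : R[i] := ((zero_radius l)^-1)%:C * cis (- (2 * PI * cc * l%:R * h)).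
(** The n-th power of a truncated theta product. Inner factors are monic and outer ones have
    constant term 1, so that after division by z^(nM) they read 1 - η/z and 1 - z/ξ. *)
Definition zeros_poly : {poly R[i]} :=
  (\prod_(l < M) (('X - (inner_zero l)%:P) * (1 - (outer_zero l)^-1 *: 'X))) ^+ n.

Lemma rad_gt0 l : 0 < zero_radius l. Proof. exact: exp_gt0. Qed.
Lemma cabs_xo l : cabs (outer_zero l) = zero_radius l.
Proof. by rewrite cabsZ ?(ltW (rad_gt0 l)) // cabs_cis mulr1. Qed.
Lemma cabs_xi l : cabs (inner_zero l) = (zero_radius l)^-1.
Proof. by rewrite cabsZ ?invr_ge0 ?(ltW (rad_gt0 l)) // cabs_cis mulr1. Qed.
Lemma xo_neq0 l : outer_zero l != 0. Proof. by rewrite -(av_gt0 cabs) cabs_xo rad_gt0. Qed.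
Lemma size_zeros_poly : (size zeros_poly <= (n * M + n * M).+1)%N.
Proof.
have sz (p : {poly R[i]}) k : (size (p ^+ k) <= ((size p).-1 * k).+1)%N by exact: size_poly_exp_leq.
apply: leq_trans (sz _ _) _; rewrite ltnS -mulnDr mulnC leq_mul2l; apply/orP; right.
elim: M => [|L IH]; first by rewrite big_ord0 size_poly1.
rewrite big_ord_recr /=; set P := \prod_(l < L) _ in IH *; set q := (X in P * X).
have sq : (size q <= 3)%N.
  apply: leq_trans (size_polyMleq _ _) _; rewrite size_XsubC /=.
  apply: leq_trans (size_polyD _ _) _; rewrite size_poly1 size_polyN geq_max /=.
  by apply: leq_trans (size_scale_leq _ _) _; rewrite size_polyX.
have := size_polyMleq P q; move: IH sq; rewrite -/P; move: (size P) (size q) (size (P * q)) => x y z; clear; lia.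
Qed.

Lemma pn_zeros_poly r : 0 < r -> r ^- (n * M) * pn cabs r zeros_poly <=
  (\prod_(l < M) ((1 + (zero_radius l)^-1 / r) * (1 + r / zero_radius l))) ^+ n.
Proof.
move=> r0; have r0' := ltW r0; rewrite mulrC ler_pdivrMr ?exprn_gt0 //.
apply: le_trans (pnX _ r0' _ _) _; rewrite mulnC exprM -exprMn.
apply: lerXn2r; rewrite ?nnegrE ?pn_ge0 //.
  apply: mulr_ge0; last exact: exprn_ge0.
  by apply: prodr_ge0 => l _; rewrite mulr_ge0 ?addr_ge0 ?divr_ge0 ?invr_ge0 ?(ltW (rad_gt0 _)).
apply: le_trans (pn_prod _ r0' _ _ _) _.
have -> : r ^+ M = \prod_(l < M) r by rewrite prodr_const card_ord.
rewrite -big_split /=; apply: ler_prod => l _; rewrite pn_ge0 //=.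
apply: le_trans (pnM _ r0' _ _) _.
have h1 : pn cabs r ('X - (inner_zero l)%:P) <= r + (zero_radius l)^-1.
  apply: le_trans (pnD _ r0' _ _) _; rewrite -polyCN pnC nmN cabs_xi.
  by rewrite -['X]mul1r pnMX pn1 mulr1.
have h2 : pn cabs r (1 - (outer_zero l)^-1 *: 'X) <= 1 + r / zero_radius l.
  apply: le_trans (pnD _ r0' _ _) _; rewrite pn1 -scaleNr pnZ nmN nmV cabs_xo.
  by rewrite -['X]mul1r pnMX pn1 mulr1 mulrC.
apply: le_trans (ler_pM _ _ h1 h2) _; rewrite ?pn_ge0 //.
rewrite le_eqVlt; apply/orP; left; apply/eqP; field.
by rewrite !gt_eqF ?rad_gt0.
Qed.

(** The reverse triangle inequality in each factor. It multiplies only while every 1 - |η|/|z| is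
    nonnegative; the second alternative records the opposite case, which cannot occur for |z| >=
    1. *)
Lemma nm_zeros_poly_ge (z : R[i]) : z != 0 ->
  (\prod_(l < M) ((1 - (zero_radius l)^-1 / cabs z) * `|1 - cabs z / zero_radius l|)) ^+ n <=
  cabs (zeros_poly.[z] / z ^+ (n * M)) \/ exists2 l, (l < M)%N & cabs z < (zero_radius l)^-1.
Proof.
move=> z0; have cz : 0 < cabs z by rewrite av_gt0.
case: (boolP [forall l : 'I_M, (zero_radius l)^-1 <= cabs z]) => [/forallP H|]; last first.
  by rewrite negb_forall => /existsP[l]; rewrite -ltNge => ?; right; exists l.
left; rewrite /zeros_poly horner_exp horner_prod avM nmV !nmX mulnC exprM -exprVn -exprMn.
apply: lerXn2r; rewrite ?nnegrE.
- apply: prodr_ge0 => l _; rewrite mulr_ge0 ?subr_ge0 ?ler_pdivrMr ?mul1r //.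
- by rewrite mulr_ge0 ?av_ge0 // invr_ge0 exprn_ge0 ?av_ge0.
have -> : (cabs z ^+ M)^-1 = \prod_(l < M) (cabs z)^-1 by rewrite prodr_const card_ord exprVn.
rewrite nm_prod -big_split /=; apply: ler_prod => l _; apply/andP; split.
  by rewrite mulr_ge0 ?subr_ge0 ?ler_pdivrMr ?mul1r.
rewrite hornerM !hornerE avM mulrAC.
apply: ler_pM; rewrite ?subr_ge0 ?ler_pdivrMr ?mul1r //.
  rewrite ler_pdivlMr // mulrBl mul1r divfK ?gt_eqF // -cabs_xi; exact: nmB_ge.
rewrite -cabs_xo -nmV -avM ler_norml.
rewrite mulrC; apply/andP; split.
  rewrite lerNl opprB; have := nmB_ge cabs (z / outer_zero l) 1; rewrite nm1.
  by rewrite -[z / outer_zero l - 1]opprB nmN mulrC.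
by have := nmB_ge cabs 1 (z / outer_zero l); rewrite nm1 mulrC.
Qed.
End FailPoly.

(** (v(1 - X))^T is a unit modulo X^n, so the jet inherits the n-fold zero of the polynomial. *)
Lemma jet_at_zero (F : numFieldType) (n T : nat) (v : F) (I : Type) (ks : seq I)
    (b : I -> F) (e : I -> nat) : v != 0 ->
  ('X - v%:P) ^+ n %| \sum_(k <- ks) b k *: 'X ^+ e k -> jeq n (jet_at n T v ks b e) 0.
Proof.
move=> v0 /dvdpP[g Hg].
have z : jeq n ((v *: (1 - 'X)) ^+ T * jet_at n T v ks b e) 0.
  apply: (jeq_trans (jeq_sym (@jet_atP F n T v I ks b e v0))); rewrite Hg comp_polyM.
  apply/jeq_dvd/dvdp_mull; rewrite rmorphXn /= comp_polyB comp_polyX comp_polyC.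
  have -> : v *: (1 - 'X) - v%:P = - v *: 'X.
    by rewrite scalerBr -[v *: 1]mul_polyC mulr1 addrAC subrr sub0r scaleNr.
  by rewrite exprZn dvdpZr // expf_neq0 // oppr_eq0.
have w : jeq n ((v^-1 *: geo n 1) ^+ T * (v *: (1 - 'X)) ^+ T) 1.
  rewrite -exprMn -[X in jeq _ _ X](expr1n _ T); apply: jeqX.
  rewrite -scalerAl -scalerAr scalerA mulVf // scale1r mulrC.
  by have := @geoP F n 1; rewrite scale1r.
rewrite -[jet_at _ _ _ _ _ _]mul1r.
apply: (jeq_trans (jeqM (jeq_sym w) (@jeq_refl F n _))).
rewrite -mulrA -[X in jeq _ _ X](mulr0 ((v^-1 *: geo n 1) ^+ T)).
by apply: jeqM.
Qed.

(** The change from falling factorials to powers is triangular: σ = (s - aj) - a(x - j) exchanges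
    one power of σ for one more falling factor. The induction on i therefore carries all j with i +
    j < n. *)
Lemma moment_zero (n : nat) (I : Type) (ks : seq I) (w : I -> R[i]) (sg x : I -> R) (s a : R) :
  a != 0 -> (forall k, a * x k = s - sg k) ->
  (forall j, (j < n)%N -> \sum_(k <- ks) w k * (\prod_(l < j) (x k - l%:R))%:C = 0) ->
  forall i, (i < n)%N -> \sum_(k <- ks) w k * (sg k ^+ i)%:C = 0.
Proof.
move=> a0 xs H.
suff G i : forall j, (i + j < n)%N ->
    \sum_(k <- ks) w k * (sg k ^+ i)%:C * (\prod_(l < j) (x k - l%:R))%:C = 0.
  move=> i Hi; rewrite -[RHS](G i 0%N) ?addn0 //; apply: eq_bigr => k _.
  by rewrite big_ord0 mulr1.
elim: i => [|i IH] j Hij.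
  by rewrite -[RHS](H j Hij); apply: eq_bigr => k _; rewrite expr0 mulr1.
have e k : w k * (sg k ^+ i.+1)%:C * (\prod_(l < j) (x k - l%:R))%:C =
   (s - a * j%:R)%:C * (w k * (sg k ^+ i)%:C * (\prod_(l < j) (x k - l%:R))%:C) +
   (- a)%:C * (w k * (sg k ^+ i)%:C * (\prod_(l < j.+1) (x k - l%:R))%:C).
  rewrite big_ord_recr /= exprS.
  have -> : sg k = (s - a * j%:R) + (- a) * (x k - j%:R).
    by have := xs k; move: (sg k) => y e; rewrite mulrBr !mulNr e; ring.
  move: (\prod_(_ < j) _) (_ ^+ i) => P y; rewrite !(rmorphM, rmorphD) /=; ring.
rewrite (eq_bigr _ (fun k _ => e k)) big_split /= -!mulr_sumr !IH ?mulr0 ?addr0 //.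
  by rewrite addnS.
by apply: leq_trans Hij; rewrite addSn ltnW.
Qed.

Section FailSeq.
Variables (a h cc : R) (n M : nat).
Hypotheses (a0 : 0 < a) (h0 : 0 < h) (M0 : (0 < M)%N).
Let T := (n * M)%N.
Local Notation psum := (psum a h cc).
Local Notation zeros_poly := (zeros_poly a h cc n M).

Definition zeros_index : seq Z := [seq Z.sub (Z.of_nat i) (Z.of_nat T) | i <- iota 0 (T + T).+1].
(* The coefficients b_k turning the Laurent polynomial z^(-nM) [zeros_poly] into fibre sums. *)
Definition zeros_coef (k : Z) : R[i] :=
  zeros_poly`_(Z.to_nat (Z.add k (Z.of_nat T))) * (exp (PI * (a * IZR k) ^+ 2))%:C.
Definition fiber_node t (m : Z) : R[i] :=
  (exp (2 * PI * a * (t + IZR m * h)))%:C * cis (2 * PI * cc * IZR m * h).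

Lemma zeros_index_uniq : uniq zeros_index.
Proof. by rewrite map_inj_uniq ?iota_uniq // => i j; clear; lia. Qed.

Lemma zn_neq0 t m : fiber_node t m != 0.
Proof. by rewrite -(av_gt0 cabs) cabsZ ?exp_ge0 // cabs_cis mulr1 exp_gt0. Qed.

Lemma cabs_zn t m : cabs (fiber_node t m) = exp (2 * PI * a * (t + IZR m * h)).
Proof. by rewrite cabsZ ?exp_ge0 // cabs_cis mulr1. Qed.

Lemma fidx (i : nat) : Z.to_nat (Z.add (Z.sub (Z.of_nat i) (Z.of_nat T)) (Z.of_nat T)) = i.
Proof. by rewrite zsubK Nat2Z.id. Qed.

Lemma fiber_weight_zeros t m (i : nat) :
  fiber_weight a h cc zeros_coef t m (Z.sub (Z.of_nat i) (Z.of_nat T)) =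
  (exp (- (PI * (t + IZR m * h) ^+ 2)))%:C * (zeros_poly`_i * fiber_node t m ^+ i / fiber_node t m ^+ T).
Proof.
set s := t + IZR m * h; rewrite /fiber_weight /zeros_coef fidx IZRB !IZR_nat -/s.
set X := 2 * PI * a * s; set Y := 2 * PI * cc * IZR m * h.
set k : R := (i%:R - T%:R)%R.
have e1 : fiber_node t m ^+ i = (exp (k * X))%:C * cis (k * Y) * fiber_node t m ^+ T.
  rewrite /fiber_node -/s -/X -/Y !exprMn -!rmorphXn /= !expX !cisX mulrACA -rmorphM /= -expD -cisD -!mulrDl.
  by rewrite /k subrK.
have -> : zeros_poly`_i * fiber_node t m ^+ i / fiber_node t m ^+ T = zeros_poly`_i * ((exp (k * X))%:C * cis (k * Y)).
  by rewrite e1 mulrA mulfK ?expf_neq0 ?zn_neq0.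
have -> : gauss_fun (s - a * k) = exp (- (PI * s ^+ 2)) * exp (- (PI * (a * k) ^+ 2)) * exp (k * X).
  by rewrite /gauss_fun -!expD; congr exp; rewrite /X; ring.
have -> : 2 * PI * cc * k * IZR m * h = k * Y by rewrite /Y; ring.
have ex : (exp (PI * (a * k) ^+ 2))%:C * (exp (- (PI * (a * k) ^+ 2)))%:C = 1 :> R[i].
  by rewrite -rmorphM /= -expD subrr exp0.
rewrite !rmorphM /=; move: ex.
set E1 := (exp (PI * (a * k) ^+ 2))%:C; set E2 := (exp (- (PI * (a * k) ^+ 2)))%:C.
set E3 := (exp (- _))%:C; set E4 := (exp (k * X))%:C => ex.
have -> : zeros_poly`_i * E1 * cis (k * Y) * (E3 * E2 * E4) =
  (E1 * E2) * (E3 * (zeros_poly`_i * (E4 * cis (k * Y)))) by ring.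
by rewrite ex mul1r.
Qed.

Lemma psum_zeros_coef t m j : psum zeros_index zeros_coef t m j =
  (exp (- (PI * (t + IZR m * h) ^+ 2)))%:C * \sum_(i < (T + T).+1)
    (zeros_poly`_i * fiber_node t m ^+ i / fiber_node t m ^+ T) * ((t + IZR m * h - a * (i%:R - T%:R)) ^+ j)%:C.
Proof.
rewrite /psum /zeros_index big_map mulr_sumr.
have -> : iota 0 (T + T).+1 = index_iota 0 (T + T).+1 by rewrite /index_iota subn0.
rewrite big_mkord; apply: eq_bigr => i _.
by rewrite fiber_weight_zeros IZRB !IZR_nat -mulrA.
Qed.

Lemma zeros_poly_sum : zeros_poly = \sum_(i <- index_enum 'I_(T + T).+1) zeros_poly`_i *: 'X ^+ i.
Proof.
rewrite -[LHS]coefK poly_def (big_ord_widen (T + T).+1 (fun i => zeros_poly`_i *: 'X^i)); last exact: size_zeros_poly.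
rewrite big_mkcond /=; apply: eq_bigr => i _; case: ltnP => // h'.
by rewrite nth_default // scale0r.
Qed.

(** An n-fold zero at the fibre node annihilates the jet, whose coefficients are the
    falling-factorial sums, and [moment_zero] passes to the powers appearing in [psum]. *)
Lemma psum_zero t m j : (j < n)%N -> ('X - (fiber_node t m)%:P) ^+ n %| zeros_poly ->
  psum zeros_index zeros_coef t m j = 0.
Proof.
move=> jn; rewrite {1}zeros_poly_sum => dv; rewrite psum_zeros_coef.
set s := t + IZR m * h.
have jz := jet_at_zero T (zn_neq0 t m) dv.
rewrite (@moment_zero n _ (index_enum 'I_(T + T).+1) (fun i => zeros_poly`_i * fiber_node t m ^+ i / fiber_node t m ^+ T)
  (fun i => s - a * (i%:R - T%:R)) (fun i => i%:R - T%:R) s a) ?mulr0 //.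
- by rewrite gt_eqF.
- by move=> i; ring.
move=> l ln; have := jz l ln; rewrite coef0 /jet_at coef_sum => e0.
have : (-1) ^+ l / l`!%:R != 0 :> R[i].
  by rewrite mulf_neq0 ?expf_neq0 ?oppr_eq0 ?oner_eq0 // invr_eq0 pnatr_eq0 -lt0n fact_gt0.
move=> nz; apply: (mulfI nz); rewrite mulr0 -[RHS]e0 mulr_sumr; apply: eq_bigr => i _.
rewrite coefZ coef_poly ln /binc.
have -> : (\prod_(l0 < l) (i%:R - T%:R - l0%:R))%:C = \prod_(l0 < l) ((i : nat)%:R - T%:R - l0%:R) :> R[i].
  by rewrite rmorph_prod; apply: eq_bigr => l0 _; rewrite !rmorphB !rmorph_nat.
ring.
Qed.

Lemma zeros_poly_dvd_outer l : (l < M)%N -> ('X - (outer_zero a h cc l)%:P) ^+ n %| zeros_poly.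
Proof.
move=> lM; apply: dvdp_exp2r; rewrite (bigD1 (Ordinal lM)) //=; apply: dvdp_mulr; apply: dvdp_mull.
have -> : 1 - (outer_zero a h cc l)^-1 *: 'X = - (outer_zero a h cc l)^-1 *: ('X - (outer_zero a h cc l)%:P).
  by rewrite scalerBr scaleNr -[_ *: _%:P]mul_polyC -polyCM mulNr mulVf ?xo_neq0 // polyCN opprK addrC.
by rewrite dvdpZr // oppr_eq0 invr_eq0 xo_neq0.
Qed.

Lemma zeros_poly_dvd_inner l : (l < M)%N -> ('X - (inner_zero a h cc l)%:P) ^+ n %| zeros_poly.
Proof.
move=> lM; apply: dvdp_exp2r; rewrite (bigD1 (Ordinal lM)) //=; apply: dvdp_mulr; exact: dvdp_mulr.
Qed.

(** At t = -h/2 the node m has modulus exp(2πa(m - 1/2)h): m = l + 1 is the outer zero l and m = -l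
    the inner zero l. The killed indices are thus -(M - 1), ..., M. *)
Lemma zn_node m : m \in [seq Z.of_nat l.+1 | l <- iota 0 M] ++ [seq Z.opp (Z.of_nat l) | l <- iota 0 M] ->
  ('X - (fiber_node (- (h / 2)) m)%:P) ^+ n %| zeros_poly.
Proof.
rewrite mem_cat => /orP[] /mapP[l]; rewrite mem_iota => /andP[_ lM] ->.
  suff -> : fiber_node (- (h / 2)) (Z.of_nat l.+1) = outer_zero a h cc l by exact: zeros_poly_dvd_outer.
  rewrite /fiber_node /outer_zero /zero_radius IZR_nat; congr ((exp _)%:C * _).
  by rewrite -[l.+1%:R]natr1; field.
suff -> : fiber_node (- (h / 2)) (Z.opp (Z.of_nat l)) = inner_zero a h cc l by exact: zeros_poly_dvd_inner.
rewrite /fiber_node /inner_zero /zero_radius IZRN IZR_nat -expN; congr ((exp _)%:C * cis _); last by ring.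
by field.
Qed.

End FailSeq.
Arguments fiber_node (a h cc t)%_ring_scope m.

(** * Smallness of a fibre *)

Lemma PI_gt0 : 0 < PI :> R. Proof. by apply/RltP; exact: PI_RGT_0. Qed.

Lemma prod_exp (f : nat -> R) L : \prod_(l < L) exp (f l) = exp (\sum_(l < L) f l).
Proof.
elim: L => [|L IH]; first by rewrite !big_ord0 exp0.
by rewrite !big_ord_recr /= IH expD.
Qed.

Lemma sum_half L : \sum_(l < L) (l%:R + 2^-1) = L%:R ^+ 2 / 2 :> R.
Proof.
elim: L => [|L IH]; first by rewrite big_ord0 expr0n /= mul0r.
by rewrite big_ord_recr /= IH -[L.+1%:R]natr1; field.
Qed.

Arguments sum_exp_Z eta%_ring_scope.

Lemma node_out (M : nat) (m : Z) :
  m \notin [seq Z.of_nat l.+1 | l <- iota 0 M] ++ [seq Z.opp (Z.of_nat l) | l <- iota 0 M] ->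
  Z.le (Z.add (Z.of_nat M) 1) m \/ Z.le m (Z.opp (Z.of_nat M)).
Proof.
rewrite mem_cat negb_or => /andP[/mapP n1 /mapP n2].
case: (Z_lt_le_dec m (Z.add (Z.of_nat M) 1)) => h1; [right|by left].
case: (Z_lt_le_dec (Z.opp (Z.of_nat M)) m) => h2 //; exfalso.
case: (Z_lt_le_dec 0 m) => h3.
  by apply: n1; exists (Z.to_nat m).-1; [rewrite mem_iota; lia | lia].
by apply: n2; exists (Z.to_nat (Z.opp m)); [rewrite mem_iota; lia | lia].
Qed.

Section FailEstimates.
Variables (a h cc : R) (n : nat).
Hypotheses (a0 : 0 < a) (h0 : 0 < h) (n0 : (0 < n)%N).
Local Notation zero_radius := (zero_radius a h).
(** x is 1/Q and [th] its square root, which reflects the half-step offset of the zeros: the inverse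
    radii are th x^l. *)
Let x : R := exp (- (2 * PI * a * h)).
Let th : R := exp (- (PI * a * h)).

Let pah0 : 0 < PI * a * h. Proof. exact: mulr_gt0 (mulr_gt0 PI_gt0 a0) h0. Qed.
Let x0 : 0 < x. Proof. exact: exp_gt0. Qed.
Let x1 : x < 1.
Proof. rewrite -[ltRHS]exp0; apply: ltr_exp; have := pah0; lra. Qed.
Let t0 : 0 < th. Proof. exact: exp_gt0. Qed.
Let t1 : th < 1.
Proof. rewrite -[ltRHS]exp0; apply: ltr_exp; have := pah0; lra. Qed.

Lemma radE l : zero_radius l = exp (2 * (PI * a * h) * l%:R + PI * a * h).
Proof. by rewrite /zero_radius; congr exp; field. Qed.

Lemma rad_inv l : (zero_radius l)^-1 = th * x ^+ l.
Proof. by rewrite radE -expN /th /x expX -expD; congr exp; ring. Qed.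

Lemma prod_rad M : \prod_(l < M) zero_radius l = exp (PI * a * h * M%:R ^+ 2).
Proof.
rewrite /Fibers.zero_radius (prod_exp (fun l => 2 * PI * a * (l%:R + 2^-1) * h)); congr exp.
rewrite (eq_bigr (fun l : 'I_M => (2 * PI * a * h) * ((l : nat)%:R + 2^-1))) => [|l _]; last by ring.
by rewrite -mulr_sumr sum_half; field.
Qed.

Lemma prod_low : exists c : R, 0 < c /\ forall L, c <= \prod_(k < L) (1 - th * x ^+ k).
Proof.
exists (exp (- (th / ((1 - th) * (1 - x))))); split=> [|L]; first exact: exp_gt0.
by apply: prod_exp_ge; rewrite ?(ltW t0) ?(ltW x0).
Qed.

Lemma prod_up : exists c : R, 0 < c /\ forall L, \prod_(k < L) (1 + x ^+ k) <= c.
Proof.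
exists (exp (1 / (1 - x))); split=> [|L]; first exact: exp_gt0.
have := @prod_exp_le 1 x L ler01; rewrite (ltW x0) x1 => /(_ isT).
by under eq_bigr do rewrite mul1r.
Qed.

(** At |z| = Q^m the inner factors, and the outer ones with l >= m, each multiply to at least c. The
    outer factors with l < m are large: listed downwards from l = m - 1, |z| over the radius runs
    through the radii again, so they multiply to at least c times the product of m radii,
    exp(πahm²). *)
Lemma prod_mid (c : R) (M m : nat) : 0 < c ->
  (forall L, c <= \prod_(k < L) (1 - th * x ^+ k)) -> (m < M)%N ->
  exp (PI * a * h * m%:R ^+ 2) * c ^+ 3 <=
  \prod_(l < M) ((1 - (zero_radius l)^-1 / exp (2 * PI * a * h * m%:R)) *
     `|1 - exp (2 * PI * a * h * m%:R) / zero_radius l|).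
Proof.
move=> c0 Hc mM; rewrite big_split /=.
have -> (e : R) : e * c ^+ 3 = c * (c * (c * e)) by ring.
set z := exp (2 * PI * a * h * m%:R).
have z1 : 1 <= z.
  by rewrite -[leLHS]exp0; apply: ler_exp; rewrite mulr_ge0 //; have := pah0; lra.
have f0 k : 0 <= 1 - th * x ^+ k.
  by rewrite subr_ge0 mulr_ile1 ?exprn_ge0 ?exprn_ile1 ?(ltW t0) ?(ltW t1) ?(ltW x0) ?(ltW x1).
apply: ler_pM; [exact: ltW c0 | by rewrite !(mulr_ge0 (ltW c0)) ?exp_ge0 | |].
  apply: le_trans (Hc M) _; apply: ler_prod => l _; rewrite f0 /= lerD2l lerN2 rad_inv.
  apply: ler_piMr; first by rewrite mulr_ge0 ?exprn_ge0 ?(ltW t0) ?(ltW x0).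
  by rewrite invf_le1 //; exact: lt_le_trans ltr01 z1.
have -> : \prod_(l < M) `|1 - z / zero_radius l| =
   (\prod_(l < m) `|1 - z / zero_radius l|) * \prod_(l < M - m) `|1 - z / zero_radius (m + l)|.
  rewrite -(big_mkord xpredT (fun l => `|1 - z / zero_radius l|)) (@big_cat_nat _ _ _ m) //=; last exact: ltnW.
  rewrite big_mkord; congr (_ * _); rewrite -{1}[m]add0n big_addn big_mkord.
  by apply: eq_bigr => l _; rewrite addnC.
rewrite [leRHS]mulrC.
have zr k : z / zero_radius k = exp (2 * (PI * a * h) * (m%:R - k%:R) - PI * a * h).
  by rewrite radE -expN -expD; congr exp; ring.
apply: ler_pM; [exact: ltW c0 | by rewrite (mulr_ge0 (ltW c0)) ?exp_ge0 | |].
  apply: le_trans (Hc (M - m)%N) _; apply: ler_prod => l _; rewrite f0 /=.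
  rewrite zr natrD.
  have -> : exp (2 * (PI * a * h) * (m%:R - (m%:R + (l : nat)%:R)) - PI * a * h) = th * x ^+ l.
    by rewrite /th /x expX -expD; congr exp; ring.
  exact: ler_norm.
have -> : exp (PI * a * h * m%:R ^+ 2) = \prod_(l < m) zero_radius l by rewrite prod_rad.
apply: le_trans (_ : (\prod_(l < m) (1 - th * x ^+ l)) * \prod_(l < m) zero_radius l <= _).
  by apply: ler_wpM2r => //; apply: prodr_ge0 => l _; exact: ltW (rad_gt0 _ _ _).
rewrite -big_split /= (reindex_inj rev_ord_inj) [leRHS](reindex_inj rev_ord_inj) /=.
have -> : \prod_(l < m) ((1 - th * x ^+ (m - l.+1)) * zero_radius (m - l.+1)) =
  \prod_(l < m) ((1 - th * x ^+ l) * zero_radius l).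
  by rewrite [RHS](reindex_inj rev_ord_inj).
apply: ler_prod => l _; rewrite mulr_ge0 ?f0 ?(ltW (rad_gt0 _ _ _)) //=.
rewrite zr natrB ?ltn_ord // -[l.+1%:R]natr1.
have -> : exp (2 * (PI * a * h) * (m%:R - (m%:R - ((l : nat)%:R + 1))) - PI * a * h) = zero_radius l.
  by rewrite radE; congr exp; ring.
rewrite -rad_inv mulrBl mul1r mulVf ?gt_eqF ?rad_gt0 // -normrN opprB; exact: ler_norm.
Qed.

Hypothesis anh : a * n%:R <= h.
Let Ef (M : nat) : R := exp (- (PI * h * (h - a * n%:R) * M%:R ^+ 2)).

(* The fibre t = 0 avoids the zeros: M of its nodes contribute at least a fixed multiple of (Ef
   M)^2 each. *)
Lemma fail_lower : exists c : R, 0 < c /\ forall M, (0 < M)%N ->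
  c * M%:R * Ef M ^+ 2 <= \sum_(k <- zeros_index n M) cabs (zeros_coef a h cc n M k) ^+ 2.
Proof.
have [B [B0 HB]] := fiber_upper cc a0 h0 n0.
have [c [c0 Hc]] := prod_low.
exists (B^-1 * ((c ^+ 3) ^+ n) ^+ 2); split=> [|M M0].
  by rewrite mulr_gt0 ?invr_gt0 ?exprn_gt0.
rewrite -mulrA -mulrA mulrC ler_pdivrMr // [leRHS]mulrC.
(* The upper fibre bound read backwards: B Σ |b_k|² is at least the fibre sum at t = 0, of which
   only 0 <= m < M and j = 0 are kept. *)
apply: le_trans (HB _ (zeros_index_uniq n M) 0%R (zeros_coef a h cc n M) M).
rewrite /zr big_cat big_map.
have -> : iota 0 M = index_iota 0 M by rewrite /index_iota subn0.
rewrite big_mkord.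
apply: (@le_trans _ _ (\sum_(m < M) \sum_(j < n) cabs (psum a h cc (zeros_index n M) (zeros_coef a h cc n M) 0 (Z.of_nat m) j) ^+ 2)); last first.
  rewrite lerDl; apply: sumr_ge0 => m _; apply: sumr_ge0 => j _; exact: sqr_ge0.
have -> : ((c ^+ 3) ^+ n) ^+ 2 * (M%:R * Ef M ^+ 2) = \sum_(m < M) ((c ^+ 3) ^+ n * Ef M) ^+ 2.
  by rewrite sumr_const card_ord exprMn -[RHS]mulr_natl; ring.
apply: ler_sum => m _.
rewrite (bigD1 (Ordinal n0)) //=; set rest := \sum_(_ < n | _) _.
have r0 : 0 <= rest by apply: sumr_ge0 => j _; exact: sqr_ge0.
apply: (@le_trans _ _ (cabs (psum a h cc (zeros_index n M) (zeros_coef a h cc n M) 0 (Z.of_nat m) 0) ^+ 2)); last by rewrite lerDl.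
apply: lerXn2r; rewrite ?nnegrE ?av_ge0 ?mulr_ge0 ?exp_ge0 ?exprn_ge0 ?(ltW c0) //.
rewrite psum_zeros_coef avM cabs_real ?exp_ge0 //.
set z := fiber_node a h cc 0 (Z.of_nat m).
have -> : \sum_(i < (n * M + n * M).+1) (zeros_poly a h cc n M)`_i * z ^+ i / z ^+ (n * M) *
     ((0 + IZR (Z.of_nat m) * h - a * (i%:R - (n * M)%:R)) ^+ 0)%:C = (zeros_poly a h cc n M).[z] / z ^+ (n * M).
  rewrite (horner_coef_wide _ (size_zeros_poly a h cc n M)) mulr_suml; apply: eq_bigr => i _.
  by rewrite expr0 mulr1.
have cz : cabs z = exp (2 * PI * a * h * m%:R).
  by rewrite cabs_zn IZR_nat; congr exp; ring.
have z1 : 1 <= cabs z.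
  by rewrite cz -[leLHS]exp0; apply: ler_exp; rewrite mulr_ge0 //; have := pah0; lra.
have [low|[l lM bad]] := nm_zeros_poly_ge a h cc n M (zn_neq0 a h cc 0 (Z.of_nat m)); last first.
  have : (zero_radius l)^-1 <= 1 by rewrite rad_inv mulr_ile1 ?exprn_ge0 ?exprn_ile1 ?(ltW t0) ?(ltW t1) ?(ltW x0) ?(ltW x1).
  by move=> H; have := lt_le_trans bad (le_trans H z1); rewrite ltxx.
have mid := prod_mid c0 Hc (ltn_ord m); rewrite -cz in mid.
apply: le_trans (_ : exp (- (PI * (IZR (Z.of_nat m) * h) ^+ 2)) * (exp (PI * a * h * m%:R ^+ 2) * c ^+ 3) ^+ n <= _); last first.
  rewrite add0r; apply: ler_wpM2l; first exact: exp_ge0.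
  apply: le_trans low; apply: lerXn2r => //; rewrite ?nnegrE ?mulr_ge0 ?exp_ge0 ?exprn_ge0 ?(ltW c0) //.
  by apply: le_trans mid; rewrite mulr_ge0 ?exp_ge0 ?exprn_ge0 ?(ltW c0).
rewrite [(exp _ * c ^+ 3) ^+ n]exprMn expX [leRHS]mulrA -expD [leRHS]mulrC; apply: ler_wpM2l; first by rewrite !exprn_ge0 // ltW.
(* The exponent -πh²m² + nπahm² equals -πh(h - an)m², which is nonincreasing in m because an <=
   h. *)
apply: ler_exp; rewrite IZR_nat.
have hb : (m : nat)%:R ^+ 2 <= M%:R ^+ 2 :> R.
  by apply: lerXn2r; rewrite ?nnegrE // ler_nat ltnW.
have hp : 0 <= PI * h * (h - a * n%:R).
  by rewrite mulr_ge0 ?subr_ge0 // mulr_ge0 ?(ltW PI_gt0) ?(ltW h0).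
have := ler_wpM2l hp hb; lra.
Qed.

Lemma pow_le_exp (eta : R) : 0 < eta -> exists D : R, 0 < D /\
  forall (y : R) (j : nat), (j < n)%N -> 0 <= y -> y ^+ j <= D * exp (eta * y).
Proof.
move=> e0; have n0' : 0 < n%:R :> R by rewrite ltr0n.
exists ((1 + n%:R / eta) ^+ n); split=> [|y j jn y0].
  by rewrite exprn_gt0 // ltr_pwDl ?divr_ge0 ?(ltW e0).
have D1 : 1 <= 1 + n%:R / eta by rewrite lerDl divr_ge0 // ltW.
have h1 : y <= (1 + n%:R / eta) * exp (eta * y / n%:R).
  have e1 : eta * y / n%:R <= exp (eta * y / n%:R) by apply: le_trans (exp_ge1Dx _); lra.
  apply: (@le_trans _ _ (n%:R / eta * exp (eta * y / n%:R))).
    apply: le_trans (ler_wpM2l _ e1); last by rewrite divr_ge0 // ltW.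
    rewrite le_eqVlt; apply/orP; left; apply/eqP; field.
    by rewrite !gt_eqF.
  by apply: ler_wpM2r; rewrite ?exp_ge0 // lerDr.
have E1 : 1 <= exp (eta * y / n%:R).
  by rewrite -[leLHS]exp0; apply: ler_exp; rewrite divr_ge0 // mulr_ge0 // ltW.
have G1 : 1 <= (1 + n%:R / eta) * exp (eta * y / n%:R) by rewrite mulr_ege1.
apply: (@le_trans _ _ (((1 + n%:R / eta) * exp (eta * y / n%:R)) ^+ j)).
  by apply: lerXn2r; rewrite ?nnegrE // (le_trans ler01 G1).
apply: (@le_trans _ _ (((1 + n%:R / eta) * exp (eta * y / n%:R)) ^+ n)).
  by apply: ler_weXn2l => //; exact: ltnW.
rewrite exprMn expX; apply: ler_wpM2l; first by rewrite exprn_ge0 // (le_trans ler01 D1).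
by apply: ler_exp; rewrite mulrC divfK // gt_eqF.
Qed.

(** The bound of [pn_zeros_poly] at radius r before the n-th power. The zeros have pairwise inverse
    moduli, so it is symmetric under r ↦ 1/r and both ends of the fibre are treated at once. *)
Let majorant (M : nat) (r : R) : R :=
  \prod_(l < M) ((1 + (zero_radius l)^-1 / r) * (1 + r / zero_radius l)).

Lemma majorant_inv M r : 0 < r -> majorant M r^-1 = majorant M r.
Proof.
move=> r0; apply: eq_bigr => l _; rewrite invrK mulrC.
by rewrite [r^-1 / _]mulrC [_^-1 * r]mulrC.
Qed.

(** The radius r exceeds all zeros, so 1 + r/ρ = (r/ρ)(1 + ρ/r). The factors r/ρ multiply to the
    exponential; the factors 1 + ρ/r and the inner ones are dominated by 1 + x^k and contribute C
    each. *)
Lemma majorant_le (C : R) M w : 0 < C -> (forall L, \prod_(k < L) (1 + x ^+ k) <= C) ->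
  0 <= w ->
  majorant M (exp (2 * PI * a * h * (M%:R + w) - PI * a * h)) <=
   C ^+ 2 * exp (M%:R * (2 * PI * a * h * (M%:R + w) - PI * a * h) - PI * a * h * M%:R ^+ 2).
Proof.
move=> C0 HC w0; case: M => [|M].
  rewrite /majorant big_ord0 !mul0r expr0n mulr0 subr0 exp0 mulr1.
  by rewrite exprn_ege1 //; have := HC 0; rewrite big_ord0.
set N := M.+1; set r := exp _.
have N1 : 1 <= N%:R :> R by rewrite ler1n.
have r1 : 1 <= r.
  rewrite -[leLHS]exp0; apply: ler_exp.
  have h1 : PI * a * h * 1 <= PI * a * h * (N%:R + w).
    by apply: ler_wpM2l; [exact: ltW pah0 | lra].
  have := pah0; lra.
have r0 : 0 < r := exp_gt0 _.
rewrite /majorant big_split /= expr2 -mulrA; apply: ler_pM.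
- by apply: prodr_ge0 => l _; rewrite addr_ge0 // divr_ge0 ?invr_ge0 ?(ltW r0) ?(ltW (rad_gt0 _ _ _)).
- by apply: prodr_ge0 => l _; rewrite addr_ge0 // divr_ge0 ?(ltW r0) ?(ltW (rad_gt0 _ _ _)).
- apply: le_trans (HC N); apply: ler_prod => l _.
  rewrite addr_ge0 ?divr_ge0 ?invr_ge0 ?(ltW r0) ?(ltW (rad_gt0 _ _ _)) //= lerD2l rad_inv.
  apply: (@le_trans _ _ (th * x ^+ l)).
    by apply: ler_piMr; rewrite ?invf_le1 // mulr_ge0 ?exprn_ge0 ?(ltW t0) ?(ltW x0).
  by apply: ler_piMl; rewrite ?exprn_ge0 ?(ltW x0) ?(ltW t1).
have -> : exp (N%:R * (2 * PI * a * h * (N%:R + w) - PI * a * h) - PI * a * h * N%:R ^+ 2) =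
    \prod_(l < N) (r / zero_radius l).
  rewrite big_split /= prodr_const card_ord expX.
  have -> : \prod_(l < N) (zero_radius l)^-1 = exp (- (PI * a * h * N%:R ^+ 2)).
    by rewrite expN -prod_rad prodfV.
  by rewrite -expD.
apply: (@le_trans _ _ ((\prod_(l < N) (1 + x ^+ (N - l.+1))) * \prod_(l < N) (r / zero_radius l))); last first.
  apply: ler_wpM2r.
    by apply: prodr_ge0 => l _; rewrite divr_ge0 ?(ltW r0) ?(ltW (rad_gt0 _ _ _)).
  have -> : \prod_(l < N) (1 + x ^+ (N - l.+1)) = \prod_(l < N) (1 + x ^+ l).
    by rewrite [RHS](reindex_inj rev_ord_inj).
  exact: HC.
rewrite -big_split /=; apply: ler_prod => l _.
have rr : 0 < r / zero_radius l by rewrite divr_gt0 // rad_gt0.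
rewrite addr_ge0 ?(ltW rr) //= mulrDl mul1r addrC lerD2l.
rewrite -ler_pdivrMr // mul1r invf_div radE /r -expN -expD /x expX; apply: ler_exp.
rewrite natrB ?ltn_ord // -[l.+1%:R]natr1.
have := mulr_ge0 (ltW pah0) w0; lra.
Qed.

Let eta := PI * h.

(** Beyond the zeros s - a(i - nM) keeps the sign of s, since a n M <= M h <= |s|. Hence its j-th
    power is at most D times an exponential that is geometric in i, which is absorbed by moving the
    radius from exp(2πas) to r. *)
Lemma psum_tail (D : R) M m j s : (j < n)%N -> 0 < D ->
  (forall (y : R) (j : nat), (j < n)%N -> 0 <= y -> y ^+ j <= D * exp (eta * y)) ->
  s = - (h / 2) + IZR m * h -> M%:R * h <= `|s| ->
  cabs (psum a h cc (zeros_index n M) (zeros_coef a h cc n M) (- (h / 2)) m j) <=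
    exp (- (PI * s ^+ 2)) * (D * exp (eta * `|s|) *
      majorant M (exp (a * (2 * PI * `|s| - eta))) ^+ n).
Proof.
move=> jn D0 HD es Ms; rewrite psum_zeros_coef -es avM cabs_real ?exp_ge0 //.
apply: ler_wpM2l; first exact: exp_ge0.
set T := (n * M)%N; set z := fiber_node _ _ _ _ _.
have cz : cabs z = exp (2 * PI * a * s) by rewrite /z cabs_zn -es.
have aT : a * T%:R <= M%:R * h.
  by rewrite natrM mulrA mulrC; apply: ler_wpM2l.
have [sg [sg1 ss]] : exists sg : R, (sg = 1 \/ sg = -1) /\ `|s| = sg * s.
  by case: (ger0P s) => _; [exists 1; rewrite mul1r | exists (-1); rewrite mulN1r]; split=> //; [left | right].
pose r := exp (a * (2 * PI * s - sg * eta)).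
have r0 : 0 < r := exp_gt0 _.
have mE : majorant M (exp (a * (2 * PI * `|s| - eta))) = majorant M r.
  rewrite /r; case: sg1 ss => -> ->; first by rewrite !mul1r.
  rewrite -majorant_inv ?exp_gt0 // -expN; congr (majorant M (exp _)); ring.
rewrite mE; apply: le_trans (_ : D * exp (eta * `|s|) * (r ^- T * pn cabs r (zeros_poly a h cc n M)) <= _); last first.
  apply: ler_wpM2l; first by rewrite mulr_ge0 ?exp_ge0 // ltW.
  exact: pn_zeros_poly.
rewrite (pn_widen _ _ (size_zeros_poly a h cc n M)) !mulr_sumr.
apply: le_trans (nm_sum _ _ _ _) _; apply: ler_sum => i _.
rewrite !avM nmV !nmX cz.
have -> (y : R) : cabs y%:C = `|y| by rewrite /av /= /cabs_fun /= expr0n /= addr0 sqrtr_sqr.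
rewrite normrX; set y := s - _.
have iT : (i : nat)%:R <= T%:R + T%:R :> R by rewrite -natrD ler_nat -ltnS.
have ai : a * (i : nat)%:R <= a * (T%:R + T%:R) by rewrite ler_wpM2l // ltW.
have ai0 : 0 <= a * (i : nat)%:R by rewrite mulr_ge0 // ltW.
have yE : `|y| = sg * y.
  case: sg1 ss => -> ss.
    by rewrite mul1r ger0_norm // /y; move: Ms; rewrite ss mul1r; lra.
  by rewrite mulN1r ler0_norm // /y; move: Ms; rewrite ss mulN1r; lra.
have yj := HD _ _ jn (normr_ge0 y).
apply: (@le_trans _ _ (cabs (zeros_poly a h cc n M)`_i * exp (2 * PI * a * s) ^+ i / exp (2 * PI * a * s) ^+ T * (D * exp (eta * `|y|)))).
  apply: ler_wpM2l => //; apply: mulr_ge0; last by rewrite invr_ge0 exprn_ge0 // exp_ge0.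
  by apply: mulr_ge0; rewrite ?av_ge0 // exprn_ge0 // exp_ge0.
rewrite le_eqVlt; apply/orP; left; apply/eqP.
rewrite /r yE ss /y !expX -!expN.
have -> (A B C' D' E' : R) : A * B * C' * (D' * E') = D' * A * (B * C' * E') by ring.
have -> (A B C' D' E' : R) : D' * E' * (A * (B * C')) = D' * B * (E' * A * C') by ring.
by rewrite -!expD; congr (_ * exp _); ring.
Qed.

(* At t = -h/2 only the nodes outside the zeros contribute, and they form a convergent series.
   *)
Lemma fail_upper : exists C : R, 0 < C /\ forall M, (0 < M)%N -> forall M',
  \sum_(m <- zr M') \sum_(j < n)
     cabs (psum a h cc (zeros_index n M) (zeros_coef a h cc n M) (- (h / 2)) m j) ^+ 2 <= C * Ef M ^+ 2.
Proof.
have [C [C0 HC]] := prod_up.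
have e0 : 0 < eta by rewrite mulr_gt0 // PI_gt0.
have [D [D0 HD]] := pow_le_exp e0.
have Ph0 : 0 < PI * h ^+ 2 by rewrite mulr_gt0 ?PI_gt0 // exprn_gt0.
have [S [S0 HS]] := @sum_exp_Z (2 * (PI * h ^+ 2))%R (mulr_gt0 (ltr0n _ 2) Ph0).
pose G := D * (C ^+ 2) ^+ n.
have G0 : 0 < G by rewrite mulr_gt0 // !exprn_gt0.
exists (n%:R * (G ^+ 2 * exp (2 * (PI * h ^+ 2)) * (S + S))); split.
  apply: mulr_gt0; first by rewrite ltr0n.
  by apply: mulr_gt0; [apply: mulr_gt0; [rewrite exprn_gt0 | exact: exp_gt0] | exact: addr_gt0].
move=> M M0 M'.
have K0 : 0 <= n%:R * (G ^+ 2 * exp (2 * (PI * h ^+ 2))) * Ef M ^+ 2.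
  apply: mulr_ge0; last by rewrite exprn_ge0 // exp_ge0.
  by apply: mulr_ge0 => //; apply: mulr_ge0; [rewrite exprn_ge0 // ltW | exact: exp_ge0].
pose g (m : Z) := exp (- (2 * (PI * h ^+ 2) * `|- (2^-1) - M%:R + IZR m|)) +
                  exp (- (2 * (PI * h ^+ 2) * `|- (2^-1) + M%:R + IZR m|)).
have g0 m : 0 <= g m by rewrite addr_ge0 ?exp_ge0.
apply: (@le_trans _ _ (\sum_(m <- zr M') n%:R * (G ^+ 2 * exp (2 * (PI * h ^+ 2)) * Ef M ^+ 2) * g m)); last first.
  rewrite -mulr_sumr.
  have -> (A B E' X : R) : A * (B * X) * E' = (A * B) * X * E' by ring.
  apply: (@le_trans _ _ (n%:R * (G ^+ 2 * exp (2 * (PI * h ^+ 2))) * Ef M ^+ 2 * (S + S))).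
    apply: ler_wpM2l; first exact: K0.
    by rewrite big_split; apply: lerD; apply: HS; exact: uniq_zr.
  by rewrite le_eqVlt; apply/orP; left; apply/eqP; ring.
apply: ler_sum => m _.
pose s := - (h / 2) + IZR m * h.
have [mn|mn] := boolP (m \in [seq Z.of_nat l.+1 | l <- iota 0 M] ++ [seq Z.opp (Z.of_nat l) | l <- iota 0 M]).
  rewrite big1 => [|j _]; last by rewrite (@psum_zero a h cc n M a0 _ m j (ltn_ord j) (zn_node a h cc n mn)) nm0 expr0n.
  by apply: mulr_ge0 => //; move: K0; rewrite -!mulrA.
(* w measures, in periods, how far |s| lies beyond M h; the two terms of g serve the two ends of the
   fibre. *)
have [w [w1 sE gE]] : exists w : R, [/\ 2^-1 <= w, `|s| = (M%:R + w) * h &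
    exp (- (2 * (PI * h ^+ 2) * w)) <= g m].
  case: (node_out mn) => /IZR_le/RleP mM.
    rewrite IZRD IZR_nat in mM; have e1 : IZR 1 = 1 by [].
    rewrite e1 in mM; exists (IZR m - 2^-1 - M%:R); split; first by lra.
      have -> : s = (IZR m - 2^-1) * h by rewrite /s; field.
      rewrite normrM (gtr0_norm h0); congr (_ * h); rewrite ger0_norm; first by ring.
      by have : 0 <= M%:R :> R by []; lra.
    rewrite /g ger0_norm; last by lra.
    have -> : - 2^-1 - M%:R + IZR m = IZR m - 2^-1 - M%:R by ring.
    by rewrite lerDl exp_ge0.
  rewrite IZRN IZR_nat in mM; exists (2^-1 - IZR m - M%:R); split; first by lra.
    have -> : s = - ((2^-1 - IZR m) * h) by rewrite /s; field.
    rewrite normrN normrM (gtr0_norm h0); congr (_ * h); rewrite ger0_norm; first by ring.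
    by have : 0 <= M%:R :> R by []; lra.
  rewrite /g -[X in _ <= _ + X]mulr1.
  have -> : `|- 2^-1 + M%:R + IZR m| = 2^-1 - IZR m - M%:R by rewrite ler0_norm; [ring | lra].
  by rewrite mulr1 lerDr exp_ge0.
have w0 : 0 <= w by apply: le_trans w1; rewrite invr_ge0.
have Ms : M%:R * h <= `|s| by rewrite sE ler_wpM2r ?(ltW h0) // lerDl.
pose H := exp (PI * h ^+ 2 * (1 - w)).
have bound (j : 'I_n) : cabs (psum a h cc (zeros_index n M) (zeros_coef a h cc n M) (- (h / 2)) m j) <= G * Ef M * H.
  apply: le_trans (psum_tail (ltn_ord j) D0 HD (erefl s) Ms) _.
  have eM : a * (2 * PI * `|s| - eta) = 2 * PI * a * h * (M%:R + w) - PI * a * h.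
    by rewrite sE /eta; ring.
  rewrite eM; have mj := @majorant_le C M w C0 HC w0.
  have mj0 : 0 <= majorant M (exp (2 * PI * a * h * (M%:R + w) - PI * a * h)).
    apply: prodr_ge0 => l _; rewrite mulr_ge0 ?addr_ge0 ?divr_ge0 ?invr_ge0 ?exp_ge0 //.
  have mjn := lerXn2r n mj0 (le_trans mj0 mj) mj; rewrite exprMn expX in mjn.
  apply: (@le_trans _ _ (exp (- (PI * s ^+ 2)) * (D * exp (eta * `|s|) * ((C ^+ 2) ^+ n *
     exp (n%:R * (M%:R * (2 * PI * a * h * (M%:R + w) - PI * a * h) - PI * a * h * M%:R ^+ 2)))))).
    apply: ler_wpM2l; first exact: exp_ge0.
    by apply: ler_wpM2l => //; rewrite mulr_ge0 ?exp_ge0 // ltW.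
  have -> (A B C' D' E' : R) : A * (B * C' * (D' * E')) = (B * D') * (A * (C' * E')) by ring.
  rewrite -/G -[leRHS]mulrA; apply: ler_wpM2l; first exact: ltW.
  rewrite /Ef /H -!expD.
  apply: ler_exp; rewrite -subr_ge0 -(real_normK (num_real s)) sE /eta.
  (* The slack in the exponent is a sum of nonnegative terms, by w >= 1/2 and an <= h. *)
  have -> : - (PI * h * (h - a * n%:R) * M%:R ^+ 2) + PI * h ^+ 2 * (1 - w) -
     (- (PI * ((M%:R + w) * h) ^+ 2) + (PI * h * ((M%:R + w) * h) +
       n%:R * (M%:R * (2 * PI * a * h * (M%:R + w) - PI * a * h) - PI * a * h * M%:R ^+ 2))) =
     PI * h * (h * (w - 1) ^+ 2 + M%:R * (2 * w - 1) * (h - a * n%:R)) by ring.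
  have Ph : 0 <= PI * h by rewrite mulr_ge0 ?(ltW PI_gt0) ?(ltW h0).
  apply: mulr_ge0 => //; apply: addr_ge0; first by rewrite mulr_ge0 ?sqr_ge0 ?(ltW h0).
  apply: mulr_ge0; last by rewrite subr_ge0.
  by apply: mulr_ge0 => //; lra.
apply: (@le_trans _ _ (\sum_(j < n) (G * Ef M * H) ^+ 2)).
  apply: ler_sum => j _; apply: lerXn2r; rewrite ?nnegrE ?av_ge0 //.
  by apply: mulr_ge0; [apply: mulr_ge0; [exact: ltW | exact: exp_ge0] | exact: exp_ge0].
rewrite sumr_const card_ord -[leLHS]mulr_natl -[leRHS]mulrA; apply: ler_wpM2l => //.
have -> : (G * Ef M * H) ^+ 2 = G ^+ 2 * exp (2 * (PI * h ^+ 2)) * Ef M ^+ 2 * exp (- (2 * (PI * h ^+ 2) * w)).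
  have e : H ^+ 2 = exp (2 * (PI * h ^+ 2)) * exp (- (2 * (PI * h ^+ 2) * w)).
    by rewrite expr2 /H -!expD; congr exp; ring.
  by rewrite !exprMn e; move: (G ^+ 2) (Ef M ^+ 2) (exp _) (exp _) => A B E1 E2; ring.
apply: ler_wpM2l => //; apply: mulr_ge0; last by rewrite exprn_ge0 // exp_ge0.
by apply: mulr_ge0; [rewrite exprn_ge0 // ltW | exact: exp_ge0].
Qed.

Lemma fiber_fail (eps : R) : 0 < eps -> exists (ks : seq Z) (b : Z -> R[i]),
  [/\ uniq ks, 0 < \sum_(k <- ks) cabs (b k) ^+ 2 & forall M,
    \sum_(m <- zr M) \sum_(j < n) cabs (psum a h cc ks b (- (h / 2)) m j) ^+ 2 <=
      eps * \sum_(k <- ks) cabs (b k) ^+ 2].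
Proof.
move=> e0; have [c [c0 Hc]] := fail_lower; have [C [C0 HC]] := fail_upper.
(* The Gaussian factors of the two bounds cancel and leave the ratio C/(cM), at most eps once M >=
   C/(eps c). *)
pose X := C / (eps * c).
have X0 : 0 <= X by rewrite divr_ge0 ?mulr_ge0 ?(ltW C0) ?(ltW e0) ?(ltW c0).
pose M := (Num.bound X).+1.
have MX : X <= M%:R.
  by apply: ltW; apply: lt_le_trans (archi_boundP X0) _; rewrite ler_nat.
have E0 : 0 < Ef M ^+ 2 by rewrite exprn_gt0 // exp_gt0.
exists (zeros_index n M), (zeros_coef a h cc n M); split; first exact: zeros_index_uniq.
  by apply: lt_le_trans (Hc M isT); rewrite mulr_gt0 // mulr_gt0 ?ltr0n.
move=> M'; apply: (le_trans (HC M isT M')).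
apply: (@le_trans _ _ (eps * (c * M%:R * Ef M ^+ 2))); last by rewrite ler_wpM2l ?(ltW e0) ?Hc.
rewrite mulrA; apply: ler_wpM2r; first exact: ltW.
by rewrite mulrA -ler_pdivrMl ?mulr_gt0 // mulrC.
Qed.

End FailEstimates.

Import Analysis.

(** * Transfer to real and imaginary parts *)

Lemma sumR_big T (F : T -> R) (s : seq T) : sumR (List.map F s) = \sum_(x <- s) F x.
Proof.
elim: s => [|x s IH]; first by rewrite big_nil.
by rewrite big_cons -IH.
Qed.

Lemma zrangeE M : zrange M = zr M.
Proof.
have e s : List.seq s M = iota s M by elim: M s => [|m IH] s //=; rewrite IH.
by rewrite /zrange e.
Qed.

Lemma NoDup_uniq (T : eqType) (s : seq T) : List.NoDup s -> uniq s.
Proof.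
elim: s => [|x s IH] // h; inversion h as [|? ? hx hs]; subst.
rewrite /= IH // andbT; apply/negP => xs; apply: hx.
elim: s xs {IH h hs} => [|y s IH] //; rewrite inE => /orP[/eqP->|/IH]; by [left | right].
Qed.

Lemma uniq_NoDup (T : eqType) (s : seq T) : uniq s -> List.NoDup s.
Proof.
elim: s => [|x s IH] /=; first by constructor.
case/andP=> /negP xs /IH h; constructor => // hx; apply: xs.
elim: s hx {IH h} => [|y s IH] //= [->|/IH h]; first exact: mem_head.
by rewrite inE h orbT.
Qed.

Definition toC (z : R * R) : R[i] := z.1 +i* z.2.
Definition ofC (z : R[i]) : R * R := (complex.Re z, complex.Im z).

Lemma cabs_toC z : cabs (toC z) ^+ 2 = pow z.1 2 + pow z.2 2.
Proof. by rewrite /toC cabs2 !RpowE. Qed.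

Lemma eq_leRL (x y : R) : x = y -> x <= y. Proof. by move=> ->. Qed.

Section Bridge.
Variables (a hh cc d : R) (n : nat).

Lemma coef_sq_axis ks (b : Z * Z -> R * R) :
  coef_sq (axis ks) b = \sum_(k <- ks) cabs (toC (b (k, Z0))) ^+ 2.
Proof.
rewrite /coef_sq /axis List.map_map sumR_big; apply: eq_bigr => k _.
by rewrite cabs_toC.
Qed.

(** The modulation at t + mh has phase 2πck t + 2πck mh; [psum] contains the second part, so the
    first is put into the coefficients, where it does not change moduli. *)
Lemma psum_gsum ks (b : Z * Z -> R * R) t m j :
  psum a hh cc ks (fun k => cis (2 * PI * cc * IZR k * t) * toC (b (k, Z0))) t m j =
  gsum_re psi a 0 cc d (axis ks) b j (t + IZR m * hh) +i*
  gsum_im psi a 0 cc d (axis ks) b j (t + IZR m * hh).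
Proof.
rewrite /psum /gsum_re /gsum_im /axis !List.map_map !sumR_big.
elim: ks => [|k ks IH]; first by rewrite !big_nil.
rewrite !big_cons IH.
set s := (t + IZR m * hh)%R; set th := (2 * PI * lat_w a 0 cc d (k, Z0) * s)%R.
have -> : lat_x a 0 cc d (k, Z0) = a * IZR k.
  by rewrite /lat_x /= !RplusE !RmultE (_ : IZR 0 = 0) // mulr0 addr0.
have eth : th = 2 * PI * cc * IZR k * t + 2 * PI * cc * IZR k * IZR m * hh.
  by rewrite /th /s /lat_w /= !RplusE !RmultE (_ : IZR 0 = 0) //; ring.
set g := psi j _.
have exp_growth : g = gauss_fun (s - a * IZR k) * (s - a * IZR k) ^+ j.
  by rewrite /g /psi /gauss_fun !RpowE; exact: mulrC.
rewrite /fiber_weight -/s (_ : cis _ * _ * cis _ = cis th * toC (b (k, Z0))); last first.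
  by rewrite mulrAC -cisD -eth.
rewrite -[_ * (_ ^+ _)%:C]mulrA -rmorphM /= -exp_growth /toC.
by case: (b (k, Z0)) => x y; congr (_ +i* _); rewrite /= ?RminusE ?RplusE; rewrite ?RmultE; ring.
Qed.

Lemma psum_sq ks (b : Z * Z -> R * R) t m :
  \sum_(j < n) cabs (psum a hh cc ks (fun k => cis (2 * PI * cc * IZR k * t) * toC (b (k, Z0))) t m j) ^+ 2
  = gsum_sq n psi a 0 cc d (axis ks) b (t + IZR m * hh).
Proof.
rewrite /gsum_sq.
have -> : List.seq 0 n = iota 0 n.
  by move: 0%N; elim: (n) => [|k IH] s //=; rewrite IH.
have E (F : nat -> R) : \sum_(j < n) F j = \sum_(j <- iota 0 n) F j.
  by rewrite -[n in iota _ n]subn0 -/(index_iota 0 n) big_mkord.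
rewrite sumR_big -E; apply: eq_bigr => j _.
by rewrite psum_gsum cabs2 !RpowE.
Qed.

Local Open Scope R_scope.
Lemma fiber_lower_gsum : 0 < a -> 0 < hh -> (0 < n)%N -> hh < a * INR n ->
  exists A : R, 0 < A /\ forall ks, List.NoDup ks -> exists M, forall t : R, Rabs t <= hh ->
  forall b, A * coef_sq (axis ks) b <=
    sumR (List.map (fun m => gsum_sq n psi a 0 cc d (axis ks) b (t + IZR m * hh)) (zrange M)).
Proof.
move=> /RltP a0 /RltP h0 n0; rewrite INRE => /RltP an; have [A [A0 HA]] := fiber_lower cc a0 h0 n0 an.
exists A; split; first exact/RltP.
move=> ks /NoDup_uniq uk; have [M HM] := HA ks uk.
exists M => t; rewrite RabsE => /RleP ht b; apply/RleP; rewrite coef_sq_axis zrangeE sumR_big.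
rewrite (eq_bigr _ (fun m _ => esym (psum_sq ks b t m))).
apply: le_trans (HM M (leqnn M) t ht _); rewrite ler_pM2l //.
by apply: ler_sum => k _; rewrite avM cabs_cis mul1r.
Qed.

Lemma fiber_upper_gsum : 0 < a -> 0 < hh -> (0 < n)%N ->
  exists B : R, 0 < B /\ forall ks, List.NoDup ks -> forall t b M,
    sumR (List.map (fun m => gsum_sq n psi a 0 cc d (axis ks) b (t + IZR m * hh)) (zrange M)) <=
    B * coef_sq (axis ks) b.
Proof.
move=> /RltP a0 /RltP h0 n0; have [B [B0 HB]] := fiber_upper cc a0 h0 n0.
exists B; split; first exact/RltP.
move=> ks /NoDup_uniq uk t b M; apply/RleP; rewrite coef_sq_axis zrangeE sumR_big.
rewrite (eq_bigr _ (fun m _ => esym (psum_sq ks b t m))).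
apply: le_trans (HB ks uk t _ M) _; rewrite ler_pM2l //.
by apply: ler_sum => k _; rewrite avM cabs_cis mul1r.
Qed.

Lemma fiber_fail_gsum : 0 < a -> 0 < hh -> (0 < n)%N -> a * INR n <= hh -> forall eps : R, 0 < eps ->
  exists ks b, List.NoDup ks /\ 0 < coef_sq (axis ks) b /\ forall M,
    sumR (List.map (fun m => gsum_sq n psi a 0 cc d (axis ks) b (- (hh / 2) + IZR m * hh)) (zrange M)) <=
    eps * coef_sq (axis ks) b.
Proof.
move=> /RltP a0 /RltP h0 n0; rewrite INRE => /RleP an eps /RltP e0; have [ks [b [uk b0 Hb]]] := fiber_fail cc a0 h0 n0 an e0.
set t : R := - (hh / 2).
(* Undoes the phase exp(2πi c k t) that [psum_sq] places on the coefficients. *)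
pose co (p : Z * Z) := ofC (cis (- (2 * PI * cc * IZR p.1 * t)) * b p.1)%R.
have cE k : (cis (2 * PI * cc * IZR k * t) * toC (co (k, Z0)) = b k)%R.
  have ofCK z : toC (ofC z) = z by case: z.
  by rewrite /co ofCK mulrA -cisD subrr cis0 mul1r.
have e : (coef_sq (axis ks) co = \sum_(k <- ks) cabs (b k) ^+ 2)%R.
  by rewrite coef_sq_axis; apply: eq_bigr => k _; rewrite -(cE k) avM cabs_cis mul1r.
exists ks, co; split; [exact: uniq_NoDup | rewrite e; split; first exact/RltP].
move=> M; apply/RleP.
rewrite zrangeE sumR_big (eq_bigr _ (fun m _ => esym (psum_sq ks co t m))).
apply: le_trans (Hb M); apply: ler_sum => m _; apply: ler_sum => j _.
apply: eq_leRL; congr (cabs _ ^+ 2); rewrite /psum.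
by apply: eq_bigr => k _; rewrite /fiber_weight cE.
Qed.
End Bridge.

Local Open Scope R_scope.
Lemma sum_exp_zrange (eta : R) : 0 < eta -> exists S : R, forall M x,
  sumR (List.map (fun m => exp (- (eta * Rabs (x + IZR m)))) (zrange M)) <= S.
Proof.
move=> /RltP e0; have [S [_ HS]] := sum_exp_Z e0; exists S => M x; apply/RleP.
rewrite zrangeE sumR_big; apply: le_trans (HS (zr M) x (uniq_zr M)).
by apply: ler_sum => m _; rewrite RabsE.
Qed.

End Fibers.

(** * The density criterion *)

Import Analysis Fibers.

Theorem theorem7 (n : nat) (h : nat -> R -> R) (a b c d : R) :
  (1 <= n)%nat -> is_hermite_family h -> a * d - b * c <> 0 ->
  (gabor_riesz n h a b c d <-> lattice_density a b c d < INR n).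
Proof.
  intros Hn Hf HD.
  assert (n0 : is_true (ssrnat.leq 1 n)) by now apply (ssrbool.introT ssrnat.leP).
  destruct (hermite_family_like h Hf) as [cj [E1 [E2 [Hh [H1 H2]]]]].
  destruct (lattice_reduce n h cj E1 E2 a b c d Hh H1 H2 HD) as [a' [c' [d' [a0 [d0 [det ->]]]]]].
  unfold lattice_density. rewrite <- det.
  assert (h0 := period_pos d' d0). set (hh := / Rabs d') in *.
  (* The density is hh/a', so it is below n if and only if hh < a' n, the dichotomy of the fibre
     bounds. *)
  assert (E : / Rabs (a' * d') * a' = hh).
  { assert (p := Rabs_pos_lt d' d0).
    rewrite Rabs_mult, (Rabs_right a') by lra. unfold hh. field. split; lra. }
  destruct (Rlt_le_dec (/ Rabs (a' * d')) (INR n)) as [lt|ge].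
  - split; [intros _; exact lt | intros _].
    assert (an : hh < a' * INR n).
    { rewrite <- E, (Rmult_comm a' (INR n)). now apply Rmult_lt_compat_r. }
    apply (riesz_of_fibers n h cj E1 E2 a' c' d' Hh H1 H2 d0).
    + exact (fiber_lower_gsum c' d' a0 h0 n0 an).
    + exact (fiber_upper_gsum c' d' a0 h0 n0).
  - split; [intros HR; exfalso | lra].
    assert (an : a' * INR n <= hh).
    { rewrite <- E, (Rmult_comm a' (INR n)). apply Rmult_le_compat_r; lra. }
    revert HR; apply (not_riesz_of_fibers n h cj a' c' d' Hh d0).
    + exact (fiber_fail_gsum c' d' a0 h0 n0 an).
    + exact sum_exp_zrange.
Qed.
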